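(* Let $u$, $v$ be two strong solutions on $[0,T]$ to $\partial_tv=L(\mathbf F(v))$ with the same initial datum $v_0\in L_{\mathbf K}(\Omega;\mathbb R^n)$. Then, for every $t\in[0,T)$, $u(t,\cdot)=v(t,\cdot)$ a.e. in $\Omega$.
   Context: **Spaces and matrices.** $\Omega=\mathbb T^d$ is the periodic box with Lebesgue measure, $(u,w)=\int_\Omega u\cdot w\,dx$ (for matrix fields, the Frobenius product $A:B$ is used). $\mathbb R^{N\times N}_s$ and $\mathbb R^{N\times N}_+$ are the symmetric and the nonnegative-definite matrices. $I$ is the identity matrix. A Young function is a convex even $\Phi:\mathbb R\to\mathbb R_+$ with $\Phi(s)=0$ iff $s=0$, $\Phi(s)/s\to0$ as $s\to0$ and $\Phi(s)/s\to+\infty$ as $s\to+\infty$. An $N$-function is a convex even $\mathbf K:\mathbb R^n\to\mathbb R_+$ such that $\Phi_-(|y|)\le\mathbf K(y)\le\Phi_+(|y|)$ for some Young functions $\Phi_\pm$. It satisfies the $\Delta_2$-condition if $\mathbf K(2y)\le C(\mathbf K(y)+1)$ for all $y$. $\mathbf K^*$ is the Legendre transform. $L_{\mathbf K}(Q;\mathbb R^n)$ is the anisotropic Orlicz space of measurable $f:Q\to\mathbb R^n$ with $\int_Q\mathbf K(f)\,dx<\infty$ (a Banach space with the Luxemburg norm; its dual is $L_{\mathbf K^*}$). **Data and standing assumptions.** $\mathbf F:\mathbb R^n\to\mathbb R^{N\times N}_s$ is $C^2$; $L$ is a linear differential operator with constant coefficients mapping $\mathbb R^{N\times N}_s$-valued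 functions on $\Omega$ to $\mathbb R^n$-valued functions, and $L^*$ is its adjoint, with values in $\mathbb R^{N\times N}_s$. It is assumed that: 1. (Entropy) $\mathbf K(v):=\frac12\operatorname{Tr}(\mathbf F(v)-\mathbf F(0))$ is strictly convex, is an $N$-function, and $\mathbf K,\mathbf K^*$ satisfy $\Delta_2$. Write $v^{\#}:=\nabla\mathbf K(v)$, so that $v=\nabla\mathbf K^*(v^{\#})$. 2. ($\Lambda$-convexity) Let $\Lambda\subset\mathbb R^{N\times N}_s$ be the smallest linear subspace containing $I$ and all values $L^*u(x)$, $u:\Omega\to\mathbb R^n$ smooth, $x\in\Omega$. For every $P\in\Lambda\cap\mathbb R^{N\times N}_+$ the function $\mathbf F:P$ is convex. 3. ($\Lambda$-order) Let $\mathbb R^{N\times N}_\Lambda=\{\Xi\in\mathbb R^{N\times N}_s:\ \Xi:P\ge0\ \forall P\in\Lambda\cap\mathbb R^{N\times N}_+\}$. Then $\mathbf F(\mathbb R^n)\subset\mathbb R^{N\times N}_\Lambda$, and, with $\pi_\Lambda$ the orthogonal projection onto $\Lambda$, $|\pi_\Lambda\partial_l\mathbf F(v)|\le C(|\nabla\mathbf K(v)|+1)$ for all $v\in\mathbb R^n$, $l=1,\dots,n$. 4. (Conservativity) $(\mathbf F(v),L^*(v^{\#}))=0$ whenever $v^{\#}:\Omega\to\mathbb R^n$ is smooth and $v=\nabla\mathbf K^*(v^{\#})$. **Weight.** $\mathfrak h$ is a fixed positive scalar function on $[0,T]$ bounded away from $0$ and $\infty$; $\mathfrak H(t)=\int_t^T\mathfrak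 h(s)\,ds$. (The notion of strong solution below does not depend on the choice of $\mathfrak h$; one may take $\mathfrak h\equiv1$.) **Constraint (C)** on $(E,B)\in L_{\mathbf K^*}((0,T)\times\Omega;\mathbb R^n)\times L^\infty((0,T)\times\Omega;\mathbb R^{N\times N}_s)$: $\int_0^T[(B,\partial_t\Psi)+(E,L\Psi)]\,dt=0$ for all smooth $\Psi:[0,T]\times\Omega\to\mathbb R^{N\times N}_s$ with $\Psi(0)=0$. **Weak solution:** $v\in L_{\mathbf K}((0,T)\times\Omega;\mathbb R^n)$ with $\int_0^T[(v-v_0,E)+(\mathbf F(v),B)]\,dt=0$ for all $(E,B)\in L_{\mathbf K^*}((0,T)\times\Omega;\mathbb R^n)\times L^\infty((0,T)\times\Omega;\mathbb R^{N\times N}_s)$ satisfying (C). **Strong solution:** a weak solution $v$ such that $\partial_t(\mathfrak Hv^{\#})\in L_{\mathbf K^*}((0,T)\times\Omega;\mathbb R^n)$, $\mathfrak HL^*(v^{\#})\in L^\infty((0,T)\times\Omega;\mathbb R^{N\times N}_s)$, and $\partial_t(v^{\#})_l+L^*(v^{\#}):\partial_l\mathbf F(\nabla\mathbf K^*(v^{\#}))=0$ a.e. in $(0,T)\times\Omega$ for $l=1,\dots,n$, $v^{\#}(0,\cdot)=(v_0)^{\#}$ a.e. in $\Omega$. Then $v^{\#}$ has a representative in $C([0,T);L_{\mathbf K^*}(\Omega;\mathbb R^n))$, and $v(t,\cdot)=\nabla\mathbf K^*(v^{\#}(t,\cdot))$ is understood accordingly for every $t\in[0,T)$. *)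

(* Defs.v *)
From HB Require Import structures.
From mathcomp Require Import all_boot all_order all_algebra.
From mathcomp Require Import all_classical all_reals all_analysis.

Set Implicit Arguments.
Unset Strict Implicit.
Unset Printing Implicit Defensive.

Import Order.TTheory GRing.Theory Num.Theory.
Import numFieldNormedType.Exports.

Local Open Scope classical_set_scope.
Local Open Scope ring_scope.

(* Matrices over R carry the sigma-algebra generated by their entries. *)
Definition matrix_display : measure_display. Proof. exact: default_measure_display. Qed.

Section matrix_measurable.
Context {R : realType} (m n : nat).

Definition entry_cylinders : set (set 'M[R]_(m, n)) :=
  [set X | exists i j (Y : set R),
     measurable Y /\ X = (fun A : 'M[R]_(m, n) => A i j) @^-1` Y].

HB.instance Definition _ := @isMeasurable.Build matrix_display
  'M[R]_(m, n) <<s entry_cylinders >>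
  (@sigma_algebra0 _ _ _) (@sigma_algebraC _ _)
  (@sigma_algebra_bigcup _ _ _).

End matrix_measurable.

Lemma measurable_entry (R : realType) m n i j :
  measurable_fun [set: 'M[R]_(m, n)] (fun A : 'M[R]_(m, n) => A i j).
Proof.
move=> _ Y mY; rewrite setTI; apply: sub_sigma_algebra.
by exists i, j, Y.
Qed.

Lemma measurable_mxP d (T : measurableType d) (R : realType) m n
    (D : set T) (f : T -> 'M[R]_(m, n)) : measurable D ->
  measurable_fun D f <-> forall i j, measurable_fun D (fun x => f x i j).
Proof.
move=> mD; split=> [mf i j|mf].
  apply: (@measurable_comp _ _ _ _ _ _ setT (fun A : 'M[R]_(m, n) => A i j)) => //.
  exact: measurable_entry.
apply: (measurability (@entry_cylinders R m n)) => //.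
by move=> _ [_ [i [j [Y [mY ->]]]] <-]; exact: mf.
Qed.

(* Lebesgue measure on the torus T^d, realized on the unit cube of R^d: the
   d-fold product of Lebesgue measure on [0, 1], extended by zero to R^d.
   Functions on T^d are represented by functions on R^d; only their values on
   the unit cube matter to the measure, and smooth ones are required to be
   periodic. *)
Section torus.
Context {R : realType}.

Definition glue d (p : measurableTypeR R * 'rV[R]_d) : 'rV[R]_(d.+1) :=
  row_mx (const_mx p.1 : 'rV[R]_1) p.2.

Lemma measurable_glue d : measurable_fun setT (@glue d).
Proof.
apply/measurable_mxP => // i j.
rewrite /glue; case: (@split_ordP 1 d j) => k ->.
  rewrite [X in measurable_fun _ X](_ : _ = fst)//.
  by apply/funext => p; rewrite (@row_mxEl R 1 1 d) mxE.
rewrite [X in measurable_fun _ X](_ : _ = (fun A : 'rV[R]_d => A i k) \o snd).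
  apply: measurableT_comp => //; exact: measurable_entry.
by apply/funext => p; rewrite (@row_mxEr R 1 1 d).
Qed.

HB.instance Definition _ d :=
  isMeasurableFun.Build _ _ _ _ (@glue d) (@measurable_glue d).

Fixpoint torus (d : nat) : probability 'rV[R]_d R :=
  match d with
  | 0 => dirac (0 : 'rV[R]_0)
  | d'.+1 => distribution (uniform_prob (@ltr01 R) \x torus d')%E (@glue d')
  end.

End torus.

Section convex_analysis.
Context {R : realType}.

(* Euclidean product of row vectors, Frobenius product of square matrices. *)
Definition mxdot m n (A B : 'M[R]_(m, n)) : R := \sum_i \sum_j A i j * B i j.

Definition eucl m n (A : 'M[R]_(m, n)) : R := Num.sqrt (mxdot A A).

Definition symmetric_mx N (A : 'M[R]_N) : Prop := A^T = A.

Definition psd_mx N (A : 'M[R]_N) : Prop :=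
  symmetric_mx A /\ forall x : 'rV[R]_N, 0 <= (x *m A *m x^T) 0 0.

Definition Young_function (Phi : R -> R) : Prop :=
  [/\ convex_function setT (Phi : R^o -> R^o),
      (forall s, Phi (- s) = Phi s) /\ (forall s, 0 <= Phi s),
      forall s, Phi s = 0 <-> s = 0,
      Phi s / s @[s --> 0^'] --> 0 &
      Phi s / s @[s --> +oo] --> +oo].

Definition N_function n (K : 'rV[R]_n -> R) : Prop :=
  [/\ convex_function setT (K : _ -> R^o),
      (forall y, K (- y) = K y) /\ (forall y, 0 <= K y) &
      exists Phim Phip : R -> R, [/\ Young_function Phim, Young_function Phip &
        forall y, Phim (eucl y) <= K y <= Phip (eucl y)]].

Definition strictly_convex n (K : 'rV[R]_n -> R) : Prop :=
  forall (x y : 'rV[R]_n) (t : R), x != y -> 0 < t < 1 ->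
    K (t *: x + (1 - t) *: y) < t * K x + (1 - t) * K y.

Definition Delta2 n (K : 'rV[R]_n -> R) : Prop :=
  exists C : R, forall y, K (2 *: y) <= C * (K y + 1).

Definition Legendre n (K : 'rV[R]_n -> R) (z : 'rV[R]_n) : R :=
  sup (range (fun y => mxdot z y - K y)).

Definition basis_vec n (l : 'I_n) : 'rV[R]_n := delta_mx 0 l.

Definition grad n (K : 'rV[R]_n -> R) (v : 'rV[R]_n) : 'rV[R]_n :=
  \row_l 'D_(basis_vec l) K v.

End convex_analysis.

Section smoothness.
Context {R : realType} {V W : normedModType R}.

Definition iter_derive (s : seq V) (f : V -> W) : V -> W :=
  foldr (fun e g => 'D_e g) f s.

(* Iterated directional derivatives exist in all directions and are
   continuous, up to order k. *)
Definition C_k (k : nat) (f : V -> W) : Prop :=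
  forall s : seq V,
    ((size s < k)%N -> forall x e, derivable (iter_derive s f) x e) /\
    ((size s <= k)%N -> continuous (iter_derive s f)).

Definition smooth (f : V -> W) : Prop := forall k, C_k k f.

End smoothness.

Section differential_operator.
Context {R : realType} (d n N : nat).

(* A term (s, a) stands for Psi |-> (a_l : d^s Psi)_l, where d^s is the
   iterated partial derivative along the list of directions s.  Every linear
   map from symmetric matrices to R^n is Psi |-> (a_l : Psi)_l for unique
   symmetric a_l. *)
Definition diff_term : Type := seq 'I_d * {ffun 'I_n -> 'M[R]_N}.

Record diff_operator := DiffOperator {
  terms :> seq diff_term;
  _ : all (fun a : diff_term => [forall l, (a.2 l)^T == a.2 l]) terms }.

Definition partials (W : normedModType R) (s : seq 'I_d) :
    ('rV[R]_d -> W) -> 'rV[R]_d -> W :=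
  iter_derive (map (@basis_vec R d) s).

Definition apply_op (L : diff_operator) (Psi : 'rV[R]_d -> 'M[R]_N)
    (x : 'rV[R]_d) : 'rV[R]_n :=
  \row_l \sum_(a <- terms L) mxdot (a.2 l) (partials a.1 Psi x).

Definition apply_adjoint (L : diff_operator) (w : 'rV[R]_d -> 'rV[R]_n)
    (x : 'rV[R]_d) : 'M[R]_N :=
  \sum_(a <- terms L) (-1) ^+ size a.1 *:
    \sum_l (partials a.1 w x) 0 l *: a.2 l.

Definition periodic (W : Type) (f : 'rV[R]_d -> W) : Prop :=
  forall x i, f (x + basis_vec i) = f x.

End differential_operator.

Section standing_assumptions.
Context {R : realType} {d n N : nat}.
Variables (F : 'rV[R]_n -> 'M[R]_N) (L : @diff_operator R d n N).

Definition entropy (v : 'rV[R]_n) : R := \tr (F v - F 0) / 2.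

Definition entropy_dual : 'rV[R]_n -> R := Legendre entropy.

Definition Lambda : set 'M[R]_N := [set P | forall S : {vspace 'M[R]_N},
  1%:M \in S ->
  (forall u : 'rV[R]_d -> 'rV[R]_n, smooth u -> periodic u ->
     forall x, apply_adjoint L u x \in S) ->
  P \in S].

Definition Lambda_psd : set 'M[R]_N := [set P | Lambda P /\ psd_mx P].

Definition Lambda_nonneg : set 'M[R]_N := [set Xi | symmetric_mx Xi /\
  forall P, Lambda_psd P -> 0 <= mxdot Xi P].

Definition proj_Lambda (A : 'M[R]_N) : 'M[R]_N :=
  get [set Q | Lambda Q /\ forall P, Lambda P -> mxdot (A - Q) P = 0].

Definition entropy_assumption : Prop :=
  [/\ strictly_convex entropy, N_function entropy,
      Delta2 entropy & Delta2 entropy_dual].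

Definition Lambda_convexity : Prop :=
  forall P, Lambda_psd P ->
    convex_function setT ((fun v => mxdot (F v) P) : _ -> R^o).

Definition Lambda_order : Prop :=
  (forall v, Lambda_nonneg (F v)) /\
  exists C : R, forall (v : 'rV[R]_n) (l : 'I_n),
    eucl (proj_Lambda ('D_(basis_vec l) F v)) <= C * (eucl (grad entropy v) + 1).

Definition inner_torus m k (f g : 'rV[R]_d -> 'M[R]_(m, k)) : R :=
  \int[torus d]_x mxdot (f x) (g x).

Definition conservativity : Prop :=
  forall w : 'rV[R]_d -> 'rV[R]_n, smooth w -> periodic w ->
    inner_torus (fun x => F (grad entropy_dual (w x))) (apply_adjoint L w) = 0.

Definition standing_assumptions : Prop :=
  [/\ (forall v, symmetric_mx (F v)) /\ C_k 2 F,
      entropy_assumption, Lambda_convexity, Lambda_order & conservativity].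

End standing_assumptions.

Section function_spaces.
Context {R : realType}.

Definition in_Orlicz dsp (X : measurableType dsp)
    (mu : {measure set X -> \bar R}) (D : set X) n (K : 'rV[R]_n -> R)
    (f : X -> 'rV[R]_n) : Prop :=
  measurable_fun D f /\ (\int[mu]_(x in D) (K (f x))%:E < +oo)%E.

Definition Luxemburg dsp (X : measurableType dsp)
    (mu : {measure set X -> \bar R}) n (K : 'rV[R]_n -> R)
    (f : X -> 'rV[R]_n) : \bar R :=
  ereal_inf [set l%:E | l in [set l : R |
    0 < l /\ (\int[mu]_x (K (l^-1 *: f x))%:E <= 1)%E]].

Definition in_Linfty_sym dsp (X : measurableType dsp)
    (mu : {measure set X -> \bar R}) (D : set X) N
    (B : X -> 'M[R]_N) : Prop :=
  [/\ measurable_fun D B, forall x, D x -> symmetric_mx (B x) &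
      exists C : R, {ae mu, forall x, D x -> `|B x| <= C}].

End function_spaces.

Section solutions.
Context {R : realType} {d n N : nat}.
Variables (F : 'rV[R]_n -> 'M[R]_N) (L : @diff_operator R d n N) (T : R).

Local Notation leb := (@lebesgue_measure R).
Local Notation space := ('rV[R]_d).
Local Notation spacetime := (R * 'rV[R]_d)%type.
Local Notation K := (entropy F).
Local Notation Kstar := (entropy_dual F).

Definition cylinder (a b : R) : set spacetime := `]a, b[ `*` setT.

Definition spacetime_measure :
    {measure set (measurableTypeR R * 'rV[R]_d) -> \bar R} :=
  (leb \x torus d)%E.

Definition time_slice (W : Type) (f : spacetime -> W) (t : R) : space -> W :=
  fun x => f (t, x).

Definition time_derive (W : normedModType R) (f : spacetime -> W) :
    spacetime -> W :=
  fun z => derive1 (fun s => f (s, z.2)) z.1.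

Definition op_slice (Psi : spacetime -> 'M[R]_N) : spacetime -> 'rV[R]_n :=
  fun z => apply_op L (time_slice Psi z.1) z.2.

(* \int_0^T (f, g) dt *)
Definition pairing m k (f g : spacetime -> 'M[R]_(m, k)) : R :=
  \int[leb]_(t in `]0, T[) inner_torus (time_slice f t) (time_slice g t).

(* Smooth functions on [0, T] x T^d are the restrictions of smooth functions on
   R x T^d. *)
Definition smooth_spacetime (W : normedModType R) (f : spacetime -> W) : Prop :=
  smooth f /\ forall t, periodic (time_slice f t).

Definition test_function (W : normedModType R) (f : spacetime -> W) : Prop :=
  smooth_spacetime f /\ exists a b, [/\ 0 < a, b < T &
    forall t x, ~ (a <= t <= b) -> f (t, x) = 0].

Definition constraint (E : spacetime -> 'rV[R]_n) (B : spacetime -> 'M[R]_N) :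
    Prop :=
  forall Psi : spacetime -> 'M[R]_N,
    smooth_spacetime Psi -> (forall z, symmetric_mx (Psi z)) ->
    (forall x, Psi (0, x) = 0) ->
    \int[leb]_(t in `]0, T[)
      (inner_torus (time_slice B t) (time_slice (time_derive Psi) t) +
       inner_torus (time_slice E t) (time_slice (op_slice Psi) t)) = 0.

Definition weak_solution (v0 : space -> 'rV[R]_n) (v : spacetime -> 'rV[R]_n) :
    Prop :=
  in_Orlicz spacetime_measure (cylinder 0 T) K v /\
  forall (E : spacetime -> 'rV[R]_n) (B : spacetime -> 'M[R]_N),
    in_Orlicz spacetime_measure (cylinder 0 T) Kstar E ->
    in_Linfty_sym spacetime_measure (cylinder 0 T) B ->
    constraint E B ->
    \int[leb]_(t in `]0, T[)
      (inner_torus (fun x => v (t, x) - v0 x) (time_slice E t) +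
       inner_torus (fun x => F (v (t, x))) (time_slice B t)) = 0.

Definition locally_integrable_mx m k (f : spacetime -> 'M[R]_(m, k)) : Prop :=
  forall a b, 0 < a -> b < T -> forall i j,
    spacetime_measure.-integrable (cylinder a b) (fun z => (f z i j)%:E).

(* g = d_t f in the sense of distributions on (0, T) x T^d *)
Definition weak_time_derivative (f g : spacetime -> 'rV[R]_n) : Prop :=
  [/\ locally_integrable_mx f, locally_integrable_mx g &
      forall phi : spacetime -> 'rV[R]_n, test_function phi ->
        pairing f (time_derive phi) = - pairing g phi].

(* G = L^* f in the sense of distributions on (0, T) x T^d *)
Definition weak_adjoint (f : spacetime -> 'rV[R]_n)
    (G : spacetime -> 'M[R]_N) : Prop :=
  [/\ locally_integrable_mx f, locally_integrable_mx G &
      forall Psi : spacetime -> 'M[R]_N, test_function Psi ->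
        (forall z, symmetric_mx (Psi z)) ->
        pairing f (op_slice Psi) = pairing G Psi].

(* W is a representative of f in C([0, T); L_{K^*}(T^d)) *)
Definition continuous_representative (f : spacetime -> 'rV[R]_n)
    (W : R -> space -> 'rV[R]_n) : Prop :=
  [/\ forall t, 0 <= t < T -> in_Orlicz (torus d) setT Kstar (W t),
      forall t, 0 <= t < T ->
        Luxemburg (torus d) Kstar (W s \- W t)
          @[s --> within `[0, T[ (nbhs t)] --> 0%E &
      {ae leb, forall t, 0 < t < T ->
        {ae torus d, forall x, W t x = f (t, x)}}].

Definition weight (h : R -> R) : Prop :=
  measurable_fun `[0, T] h /\
  exists c C : R, 0 < c /\ forall t, 0 <= t <= T -> c <= h t <= C.

Definition cumulated_weight (h : R -> R) (t : R) : R :=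
  \int[leb]_(s in `[t, T]) h s.

Definition sharp (v : spacetime -> 'rV[R]_n) : spacetime -> 'rV[R]_n :=
  fun z => grad K (v z).

(* E, D and G stand for d_t(H v^#), d_t(v^#) and L^*(v^#); the value of v^# at
   time 0 is that of its continuous representative. *)
Definition strong_solution (h : R -> R) (v0 : space -> 'rV[R]_n)
    (v : spacetime -> 'rV[R]_n) : Prop :=
  let H := cumulated_weight h in
  let w := sharp v in
  [/\ weak_solution v0 v,
      exists E, weak_time_derivative (fun z => H z.1 *: w z) E /\
        in_Orlicz spacetime_measure (cylinder 0 T) Kstar E,
      exists D G,
        [/\ weak_time_derivative w D, weak_adjoint w G,
            in_Linfty_sym spacetime_measure (cylinder 0 T)
              (fun z => H z.1 *: G z) &
            forall l, {ae spacetime_measure, forall z, cylinder 0 T z ->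
              D z 0 l + mxdot (G z) ('D_(basis_vec l) F (grad Kstar (w z))) = 0}] &
      exists W, continuous_representative w W /\
        {ae torus d, forall x, W 0 x = grad K (v0 x)}].

End solutions.

(* Main.v *)
(** Write [w = grad K(u)] and [G = L^*(w)] for a strong solution [u], and fix
    [T' < T], so that [G] is bounded on [(0, T')].  Take a smooth weight [chi]
    vanishing from [T'] on, with [- chi' >= lam chi] and [lam] large, and put
    [B = chi G], [E = chi (d_t w) + chi' w].  The pair [(E, B)] satisfies the
    constraint, and the equation for [w] says [E = - grad (F : P)(u)] with
    [P = B + (- chi' / 2) I], where [P], and even [P - (- chi' / 4) I], is a
    nonnegative element of [Lambda].  Convexity of [F : P] hence bounds
    [(y - u) . E + (F(y) - F(u)) : B + (- chi') (K(y) - K(u))] below by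
    [(- chi' / 2)] times the Bregman distance of [K] from [u] to [y].  For a
    second strong solution [y = v] the first two terms integrate to 0, because
    [u] and [v] are weak solutions with the same datum; adding the inequality
    with [u] and [v] exchanged cancels the third.  So both Bregman distances
    vanish before [T'], and [u = v] by strict convexity.

    That [E] lies in the Orlicz space of [K^*] follows from [0 <= F : P <=
    c (K + 1)], which passes to gradients by duality; that [G] takes its values
    in [Lambda] follows by testing with [phi P] for [P] orthogonal to [Lambda]. *)

Require Import Defs.
From HB Require Import structures.
From mathcomp Require Import all_boot all_order all_algebra.
From mathcomp Require Import all_classical all_reals all_analysis.
From mathcomp Require Import measurable_realfun ring lra.

Import Order.TTheory GRing.Theory Num.Theory.
Import numFieldNormedType.Exports.

Local Open Scope classical_set_scope.
Local Open Scope ring_scope.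

Set Implicit Arguments.
Unset Strict Implicit.
Unset Printing Implicit Defensive.

(** * Directional derivatives *)

(** The weight [H] vanishes at T, so [G] is bounded only away from T; this is why everything happens
    on (0, T') with T' < T. Even there [G] has no sign, while convexity and positivity of F : P are
    available only for nonnegative P in [Lambda]. The identity matrix repairs this because K is half
    the trace of F up to a constant: chi' w is the flux field of (- chi' / 2) I, and [4 N M <= lam]
    gives N |B| <= - chi' / 4. One half of the identity part dominates B, the other half produces
    the Bregman term. The initial time is the delicate point of the constraint: its test functions
    reach t = 0, those defining the derivatives of w do not. A cutoff in time bridges the gap; its
    derivative is of order 1 / t at worst, and L Psi = O(t) because Psi vanishes at 0. Equality
    almost everywhere on (0, T') becomes equality at every t by comparing the continuous
    representatives at times s slightly larger than t; the Luxemburg norm of the dual space controls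
    the L^1 norm of each entry. *)

Section mxdot_theory.
Context {R : realType} {m n : nat}.
Implicit Types A B C : 'M[R]_(m, n).

Lemma mxdotC A B : mxdot A B = mxdot B A.
Proof. by apply: eq_bigr => i _; apply: eq_bigr => j _; rewrite mulrC. Qed.

Lemma mxdotDl A B C : mxdot (A + B) C = mxdot A C + mxdot B C.
Proof.
rewrite /mxdot -big_split/=; apply: eq_bigr => i _.
by rewrite -big_split/=; apply: eq_bigr => j _; rewrite mxE mulrDl.
Qed.

Lemma mxdotDr A B C : mxdot C (A + B) = mxdot C A + mxdot C B.
Proof. by rewrite !(mxdotC C) mxdotDl. Qed.

Lemma mxdotZl c A B : mxdot (c *: A) B = c * mxdot A B.
Proof.
rewrite /mxdot mulr_sumr; apply: eq_bigr => i _.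
by rewrite mulr_sumr; apply: eq_bigr => j _; rewrite mxE mulrA.
Qed.

Lemma mxdotZr c A B : mxdot A (c *: B) = c * mxdot A B.
Proof. by rewrite mxdotC mxdotZl mxdotC. Qed.

Lemma mxdotNl A B : mxdot (- A) B = - mxdot A B.
Proof. by rewrite -scaleN1r mxdotZl mulN1r. Qed.

Lemma mxdotNr A B : mxdot A (- B) = - mxdot A B.
Proof. by rewrite mxdotC mxdotNl mxdotC. Qed.

Lemma mxdotBl A B C : mxdot (A - B) C = mxdot A C - mxdot B C.
Proof. by rewrite mxdotDl mxdotNl. Qed.

Lemma mxdotBr A B C : mxdot C (A - B) = mxdot C A - mxdot C B.
Proof. by rewrite mxdotDr mxdotNr. Qed.

Lemma mxdot0l A : mxdot 0 A = 0.
Proof. by rewrite -(scale0r A) mxdotZl mul0r. Qed.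

Lemma mxdot0r A : mxdot A 0 = 0.
Proof. by rewrite mxdotC mxdot0l. Qed.

Lemma mxdot_suml (I : Type) (r : seq I) (P : pred I) (F : I -> 'M[R]_(m, n)) A :
  mxdot (\sum_(i <- r | P i) F i) A = \sum_(i <- r | P i) mxdot (F i) A.
Proof.
elim/big_rec2 : _ => [|i y1 y2 _ <-]; first exact: mxdot0l.
by rewrite mxdotDl.
Qed.

Lemma mx_entry_le_norm A i j : `|A i j| <= `|A|.
Proof.
by rewrite [leRHS]/Num.Def.normr/= mx_normrE (le_bigmax _ _ (i, j)).
Qed.

Lemma mx_norm_le A (M : R) : 0 <= M -> (forall i j, `|A i j| <= M) -> `|A| <= M.
Proof.
by move=> M0 AM; rewrite [leLHS]/Num.Def.normr/= mx_normrE bigmax_le.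
Qed.

Lemma mxdot_norm_le A B : `|mxdot A B| <= (m * n)%:R * `|A| * `|B|.
Proof.
rewrite /mxdot (le_trans (ler_norm_sum _ _ _))//.
apply: (@le_trans _ _ (\sum_(i < m) n%:R * (`|A| * `|B|))); last first.
  by rewrite sumr_const card_ord -[leLHS]mulr_natl natrM !mulrA.
apply: ler_sum => i _; rewrite (le_trans (ler_norm_sum _ _ _))//.
apply: (@le_trans _ _ (\sum_(j < n) (`|A| * `|B|))); last first.
  by rewrite sumr_const card_ord -[leLHS]mulr_natl.
by apply: ler_sum => j _; rewrite normrM ler_pM// mx_entry_le_norm.
Qed.

End mxdot_theory.

Lemma mxdot_tr {R : realType} m n (A B : 'M[R]_(m, n)) :
  mxdot A^T B^T = mxdot A B.
Proof.
rewrite /mxdot exchange_big; apply: eq_bigr => i _; apply: eq_bigr => j _.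
by rewrite !mxE.
Qed.

Lemma mxdot_scalar {R : realType} n (A : 'M[R]_n) a :
  mxdot A a%:M = a * \tr A.
Proof.
rewrite /mxdot /mxtrace mulr_sumr; apply: eq_bigr => i _.
rewrite (bigD1 i)//= big1 ?addr0 => [|j ji].
  by rewrite mxE eqxx mulr1n mulrC.
by rewrite mxE eq_sym (negbTE ji) mulr0n mulr0.
Qed.

Lemma mxdot_basis {R : realType} n (y : 'rV[R]_n) l :
  mxdot y (basis_vec l) = y 0 l.
Proof.
rewrite /mxdot big_ord1 (bigD1 l)//= big1 ?addr0 => [|j jl].
  by rewrite mxE !eqxx mulr1.
by rewrite mxE eqxx (negbTE jl) mulr0.
Qed.

Lemma row_basis {R : realType} n (y : 'rV[R]_n) :
  y = \sum_l y 0 l *: basis_vec l.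
Proof. exact: row_sum_delta. Qed.

Section directional_derivatives.
Context {R : realType} {V : normedModType R}.
Implicit Types (f : V -> R) (x e a b : V).

Lemma is_derive_line f x e (s : R) : derivable f (s *: e + x) e ->
  is_derive s 1 (fun s : R => f (s *: e + x)) ('D_e f (s *: e + x)).
Proof.
move=> df.
have E : (fun h : R => h^-1 *: (((fun s : R => f (s *: e + x)) \o shift s) (h *: 1)
    - f (s *: e + x))) =
    (fun h : R => h^-1 *: ((f \o shift (s *: e + x)) (h *: e) - f (s *: e + x))).
  by apply/funext => h /=; rewrite scalerDl addrA [h *: 1]mulr1.
by split; rewrite ?/derivable ?/derive E.
Qed.

Lemma continuous_line f x e (s : R) : derivable f (s *: e + x) e ->
  {for s, continuous (fun s : R => f (s *: e + x))}.
Proof.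
move=> df; have [+ _] := is_derive_line df.
by move=> /derivable1_diffP/differentiable_continuous.
Qed.

Lemma MVT_line f x e (h : R) : (forall y, derivable f y e) ->
  exists2 c : R, `|c| <= `|h| &
    f (h *: e + x) - f x = h * 'D_e f (c *: e + x).
Proof.
move=> df; pose g s := f (s *: e + x).
have dg (s : R) : is_derive s (1 : R) g ('D_e f (s *: e + x)) by exact: is_derive_line.
have cg : continuous g by move=> s; exact: continuous_line.
have g0 : g 0 = f x by rewrite /g scale0r add0r.
have [h0|h0] := leP 0 h.
  have [c] := MVT_segment h0 (fun s _ => dg s) (continuous_subspaceT cg).
  rewrite in_itv/= => /andP[c0 ch] gE; exists c.
    by rewrite !ger0_norm.
  by rewrite -g0 gE subr0 mulrC.
have [c] := MVT_segment (ltW h0) (fun s _ => dg s) (continuous_subspaceT cg).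
rewrite in_itv/= => /andP[ch c0] gE; exists c.
  by rewrite !ler0_norm ?lerN2// ltW.
by rewrite -g0 -[LHS]opprB -/(g h) gE sub0r mulrN opprK mulrC.
Qed.

Lemma continuous_at_combination (g : V -> R) x a b (eps : R) : continuous g ->
  0 < eps -> exists2 r : R, 0 < r & forall c d : R, `|c| <= r -> `|d| <= r ->
    `|g (c *: a + (d *: b + x)) - g x| < eps.
Proof.
move=> cg e0; have /cvgrPdist_lt/(_ _ e0)/nbhs_ballP[r /= r0 rg] := cg x.
pose M := `|a| + `|b| + 1; have M0 : 0 < M by rewrite ltr_wpDl// addr_ge0.
exists (r / 2 / M); first by rewrite !divr_gt0.
move=> c d cr dr; rewrite distrC; apply: rg.
rewrite -ball_normE/= distrC addrA addrK.
rewrite (le_lt_trans (ler_normD _ _))// !normrZ.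
apply: (@le_lt_trans _ _ (r / 2 / M * (`|a| + `|b|))).
  by rewrite mulrDr lerD// ler_wpM2r.
apply: (@le_lt_trans _ _ (r / 2)).
  by rewrite -mulrA ger_pMr ?divr_gt0// mulrC ler_pdivrMr// mul1r /M; lra.
by rewrite ltr_pdivrMr// ltr_pMr// ltr1n.
Qed.

(** Two mean-value steps write the second difference of f over the parallelogram with sides h a and
    h b as h^2 times a mixed derivative at a nearby point, in either order of a and b. Continuity at
    x then identifies the two limits. *)
Lemma schwarz_derive f a b x :
  (forall y, derivable f y a) -> (forall y, derivable f y b) ->
  (forall y, derivable ('D_a f) y b) -> (forall y, derivable ('D_b f) y a) ->
  continuous ('D_b ('D_a f)) -> continuous ('D_a ('D_b f)) ->
  'D_b ('D_a f) x = 'D_a ('D_b f) x.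
Proof.
have step a' b' (h : R) : h != 0 -> (forall y, derivable f y a') ->
    (forall y, derivable ('D_a' f) y b') ->
    exists c d : R, [/\ `|c| <= `|h|, `|d| <= `|h| &
      f (h *: a' + (h *: b' + x)) - f (h *: b' + x) - (f (h *: a' + x) - f x) =
      h * h * 'D_b' ('D_a' f) (c *: a' + (d *: b' + x))].
  move=> h0 dfa dfab.
  pose g y := f (h *: b' + y) - f y.
  have Q y : (fun k : R => k^-1 *: (((fun y => f (h *: b' + y)) \o shift y) (k *: a')
      - f (h *: b' + y))) = (fun k : R => k^-1 *: ((f \o shift (h *: b' + y)) (k *: a')
      - f (h *: b' + y))).
    by apply/funext => k /=; rewrite !(addrCA _ (h *: b')).
  have dfs y : derivable (fun y => f (h *: b' + y)) y a'.
    by rewrite /derivable Q; exact: dfa.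
  have Dfs y : 'D_a' (fun y => f (h *: b' + y)) y = 'D_a' f (h *: b' + y).
    by rewrite /derive Q.
  have dg y : derivable g y a' by apply: derivableB.
  have Dg y : 'D_a' g y = 'D_a' f (h *: b' + y) - 'D_a' f y.
    by rewrite -Dfs; apply: deriveB.
  have [c ch gE] := MVT_line x h dg.
  have [d dh DE] := MVT_line (c *: a' + x) h dfab.
  exists c, d; split; [exact: ch|exact: dh|].
  have -> : f (h *: a' + (h *: b' + x)) - f (h *: b' + x) - (f (h *: a' + x) - f x)
      = g (h *: a' + x) - g x by rewrite /g (addrCA (h *: b') (h *: a') x); ring.
  rewrite gE Dg DE (addrCA (d *: b')); ring.
move=> dfa dfb dfab dfba cab cba; apply/eqP; rewrite -subr_eq0 -normr_le0.
apply/ler_addgt0Pl => eps e0; rewrite addr0.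
have e2 : 0 < eps / 2 by rewrite divr_gt0.
have [r1 r10 H1] := continuous_at_combination x a b cab e2.
have [r2 r20 H2] := continuous_at_combination x b a cba e2.
have [h [hh h0 hr1 hr2]] :
    exists h : R, [/\ h * h != 0, h != 0, `|h| <= r1 & `|h| <= r2].
  exists (Num.min r1 r2); have h0 : 0 < Num.min r1 r2 by rewrite lt_min r10.
  rewrite mulf_neq0 ?gt_eqF// gtr0_norm//.
  by split => //; rewrite ge_min lexx ?orbT.
have alg (p q s : R) : q - s = (p - s) - (p - q) by ring.
have alg' (p q r s : R) : p - q - (r - s) = p - r - (q - s) by ring.
have concl (p q s : R) : `|p - q| < eps / 2 -> `|p - s| < eps / 2 ->
    `|q - s| <= eps.
  move=> P1 P2; rewrite [in leLHS](alg p q s) (le_trans (ler_normB _ _))//.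
  by rewrite (splitr eps) addrC lerD// ltW.
have [c [d [ch dh E1]]] := step a b h h0 dfa dfab.
have [c' [d' [ch' dh' E2]]] := step b a h h0 dfb dfba.
apply: (concl _ _ _ (H1 c d (le_trans ch hr1) (le_trans dh hr1))).
have -> : 'D_b ('D_a f) (c *: a + (d *: b + x)) =
          'D_a ('D_b f) (c' *: b + (d' *: a + x)).
  apply: (mulfI hh); apply: etrans (esym E1) _; apply: etrans E2.
  have -> : f (h *: b + (h *: a + x)) = f (h *: a + (h *: b + x)).
    by congr f; exact: addrCA.
  exact: alg'.
exact: H2 c' d' (le_trans ch' hr2) (le_trans dh' hr2).
Qed.

(** The difference quotient along a + b splits into one along b at x and one along a at the moving
    point h b + x. The mean value theorem and continuity of D_a f handle the moving one. *)
Lemma derive_dirD f a b x : (forall y, derivable f y a) ->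
  continuous ('D_a f) -> derivable f x b ->
  'D_(a + b) f x = 'D_a f x + 'D_b f x.
Proof.
move=> dfa cfa dfb; apply/cvg_lim => //.
have Hb : (h^-1 *: (f (h *: b + x) - f x)) @[h --> 0^'] --> 'D_b f x by [].
have Ha : (h^-1 *: (f (h *: a + (h *: b + x)) - f (h *: b + x))) @[h --> 0^'] -->
    'D_a f x.
  apply/cvgrPdist_lt => eps e0.
  have [r r0 H] := continuous_at_combination x a b cfa e0.
  near=> h.
  have h0 : h != 0 by near: h; exact: nbhs_dnbhs_neq.
  have hr : `|h| <= r by near: h; apply: dnbhs0_le.
  have [c ch ->] := MVT_line (h *: b + x) h dfa.
  by rewrite [_ *: _]mulKf// distrC; apply: H => //; exact: le_trans ch hr.
have -> : (fun h => h^-1 *: ((f \o shift x) (h *: (a + b)) - f x)) =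
   (fun h : R => h^-1 *: (f (h *: a + (h *: b + x)) - f (h *: b + x)) +
      h^-1 *: (f (h *: b + x) - f x)).
  apply/funext => h /=; rewrite -scalerDr addrA subrK; congr (_ *: (f _ - _)).
  by rewrite [in RHS]addrA -scalerDr.
exact: cvgD Ha Hb.
Unshelve. all: by end_near. Qed.

Lemma derive_dirZ f e x (c : R) : derivable f x e -> 'D_(c *: e) f x = c * 'D_e f x.
Proof.
move=> df; have df0 : derivable f (0 *: e + x) e by rewrite scale0r add0r.
have := is_derive_line df0; rewrite scale0r add0r => H.
pose m (t : R) := c * t.
have dm : is_derive (0 : R) (1 : R) m c.
  by apply: is_derive_eq; rewrite [LHS]mulr1.
have H' : is_derive (m 0) 1 (fun s : R => f (s *: e + x)) ('D_e f x).
  by rewrite /m mulr0.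
have [_] := is_derive1_comp H' dm.
rewrite [X in _ = X -> _]mulrC => <-.
apply: (congr1 (fun g : R -> R => lim (g @ 0^'))); apply/funext => h /=.
by rewrite /m mulr0 scale0r add0r addr0 scalerA [h *: 1]mulr1 mulrC.
Qed.

End directional_derivatives.

Lemma derive_basis {R : realType} n (f : 'rV[R]_n -> R) x y :
  (forall z e, derivable f z e) -> (forall e, continuous ('D_e f)) ->
  'D_y f x = \sum_l y 0 l * 'D_(basis_vec l) f x.
Proof.
move=> df cf; rewrite {1}(row_basis y).
elim/big_rec2 : _ => [|i u v _ <-]; first by rewrite derive0.
by rewrite derive_dirD// derive_dirZ.
Qed.

Section continuous_real.
Context {R : realType} {S : topologicalType}.
Implicit Types f g : S -> R.

Lemma continuous_add f g : continuous f -> continuous g ->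
  continuous (fun x => f x + g x).
Proof. by move=> cf cg x; apply: cvgD; [exact: cf|exact: cg]. Qed.

Lemma continuous_sub f g : continuous f -> continuous g ->
  continuous (fun x => f x - g x).
Proof. by move=> cf cg x; apply: cvgB; [exact: cf|exact: cg]. Qed.

Lemma continuous_mul f g : continuous f -> continuous g ->
  continuous (fun x => f x * g x).
Proof. by move=> cf cg x; apply: cvgM; [exact: cf|exact: cg]. Qed.

Lemma continuous_bigsum (I : Type) (r : seq I) (f : I -> S -> R) :
  (forall i, continuous (f i)) -> continuous (fun x => \sum_(i <- r) f i x).
Proof.
move=> cf; elim: r => [|i r IH].
  by under eq_fun do rewrite big_nil; move=> x; exact: cvg_cst.
by under eq_fun do rewrite big_cons; exact: continuous_add.
Qed.

Lemma continuous_mxdot m n (f g : S -> 'M[R]_(m, n)) :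
  (forall i j, continuous (fun x => f x i j)) ->
  (forall i j, continuous (fun x => g x i j)) ->
  continuous (fun x => mxdot (f x) (g x)).
Proof.
move=> cf cg; apply: continuous_bigsum => i; apply: continuous_bigsum => j.
exact: continuous_mul.
Qed.

Lemma continuous_entry m n (f : S -> 'M[R]_(m, n)) i j : continuous f ->
  continuous (fun x => f x i j).
Proof.
move=> cf x; apply: (@continuous_comp _ _ _ f (fun A : 'M[R]_(m, n) => A i j)).
  exact: cf.
exact: coord_continuous.
Qed.

End continuous_real.

Lemma continuous_dist {R : realType} {V : normedModType R} (v : V) :
  continuous (fun y => `|y - v|).
Proof.
move=> y; apply: cvg_norm.
by apply: cvgB; [exact: cvg_id|exact: cvg_cst].
Qed.

(** * Convex functions and the Legendre transform *)

(** Phrased with directional derivatives, as [grad] and [C_k] are; linearity in the direction is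
    recovered by [derive_basis]. *)
Definition C1 {R : realType} n (f : 'rV[R]_n -> R) : Prop :=
  [/\ continuous f, forall x e, derivable f x e & forall e, continuous ('D_e f)].

Section convex_calculus.
Context {R : realType} {n : nat}.
Implicit Types (f K : 'rV[R]_n -> R) (x y z u v w : 'rV[R]_n).

Lemma convex_functionE f : convex_function setT (f : _ -> R^o) ->
  forall x y (t : R), 0 <= t <= 1 ->
    f (t *: x + (1 - t) *: y) <= t * f x + (1 - t) * f y.
Proof.
move=> cf x y t /andP[t0 t1].
pose p : {i01 R} := Itv01 t0 t1.
exact: (cf p x y (mem_setT _) (mem_setT _)).
Qed.

Lemma mxdot_grad f x y : C1 f -> mxdot (grad f x) y = 'D_y f x.
Proof.
move=> [_ df cf]; rewrite (derive_basis x y df cf) /mxdot big_ord1.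
by apply: eq_bigr => l _; rewrite mxE mulrC.
Qed.

(** If the slope at x towards y exceeded f y - f x, so would the difference quotient for a small
    step h <= 1, which convexity forbids. *)
Lemma convex_tangent f x y : convex_function setT (f : _ -> R^o) -> C1 f ->
  f x + mxdot (grad f x) (y - x) <= f y.
Proof.
move=> cvf C1f; rewrite mxdot_grad// -lerBrDl leNgt; apply/negP => lt.
have [_ df _] := C1f.
have /cvgr_gt/(_ _ lt)/nbhs_ballP[r /= r0 H] := df x (y - x).
pose h := Num.min (r / 2) 1; have h0 : 0 < h by rewrite lt_min divr_gt0//=.
have hr : h < r.
  by rewrite gt_min; apply/orP; left; rewrite ltr_pdivrMr// ltr_pMr// ltr1n.
have h1 : h <= 1 by rewrite ge_min lexx orbT.
have /H/(_ (lt0r_neq0 h0))/= : ball 0 r h.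
  by rewrite -ball_normE/= sub0r normrN gtr0_norm.
rewrite [_ *: _]mulrC ltr_pdivlMr// => /lt_geF/negbT/negP; apply.
have -> : h *: (y - x) + x = h *: y + (1 - h) *: x.
  by rewrite scalerBr scalerBl scale1r -addrA (addrC (- _)).
have := convex_functionE cvf y x (t := h); rewrite h1 (ltW h0) => /(_ isT).
by move=> H'; rewrite lerBlDr (le_trans H')//; lra.
Qed.

(** The tangent at u evaluated at 2 u. Combined with a Delta_2 bound it controls grad f(u) . u by
    f(u). *)
Lemma convex_grad_self_le f u : convex_function setT (f : _ -> R^o) -> C1 f ->
  mxdot (grad f u) u <= f (2 *: u) - f u.
Proof.
move=> cvf C1f; have := convex_tangent u (2 *: u) cvf C1f.
by rewrite -[X in 2 *: u - X]scale1r -scalerBl (_ : 2 - 1 = 1)// ?scale1r; lra.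
Qed.

(** Otherwise strict convexity would put the value of K at the midpoint of u and v strictly below
    the tangent at u. *)
Lemma strictly_convex_tangent K u v : strictly_convex K ->
  convex_function setT (K : _ -> R^o) -> C1 K ->
  K v <= K u + mxdot (grad K u) (v - u) -> v = u.
Proof.
move=> sK cK C1K Kv; apply/eqP/negPn/negP => vu.
have h : 0 < (2^-1 : R) < 1 by apply/andP; split; lra.
have := sK v u 2^-1 vu h.
have := convex_tangent u (2^-1 *: v + (1 - 2^-1) *: u) cK C1K.
have -> : 2^-1 *: v + (1 - 2^-1) *: u - u = 2^-1 *: (v - u).
  by rewrite scalerBl scale1r scalerBr addrCA addrAC subrr add0r.
by rewrite mxdotZr; lra.
Qed.

End convex_calculus.

Section eucl_theory.
Context {R : realType} {m n : nat}.
Implicit Types A : 'M[R]_(m, n).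

Lemma norm_le_eucl A : `|A| <= eucl A.
Proof.
apply: mx_norm_le => [|i j]; first exact: sqrtr_ge0.
rewrite -sqrtr_sqr ler_wsqrtr// /mxdot (bigD1 i)//= (bigD1 j)//= -expr2.
rewrite -addrA lerDl addr_ge0//; last first.
  by apply: sumr_ge0 => k _; apply: sumr_ge0 => l _; rewrite -expr2 sqr_ge0.
by apply: sumr_ge0 => k _; rewrite -expr2 sqr_ge0.
Qed.

End eucl_theory.

Section Legendre_theory.
Context {R : realType} {n : nat}.
Variable K : 'rV[R]_n -> R.
Hypothesis NK : N_function K.
Local Notation Ks := (Legendre K).
Implicit Types (y z u v w : 'rV[R]_n).

Lemma N_function0 : K 0 = 0.
Proof.
have [_ [_ K0] [Pm [Pp [_ [_ _ Pp0 _ _] H]]]] := NK.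
apply/eqP; rewrite eq_le K0 andbT; have /andP[_] := H 0.
by rewrite /eucl mxdot0l sqrtr0 (Pp0 0).2.
Qed.

(** Needed for [sup] in [Legendre] to be a true supremum. The lower Young function is superlinear,
    so beyond some radius [A1] it exceeds C |y| >= z . y and the difference is at most 0; inside, C
    [A1] bounds it. The factor n in C comes from using the maximum norm for z. *)
Lemma Legendre_has_ubound z : has_ubound (range (fun y => mxdot z y - K y)).
Proof.
have [_ _ [Pm [Pp [[_ [_ Pm0] _ _ /cvgryPge Pmoo] _ H]]]] := NK.
pose C := n%:R * `|z|; have C0 : 0 <= C by rewrite mulr_ge0.
have [A [_ AP]] := Pmoo C.
pose A1 := Num.max A 1; have A10 : 0 < A1 by rewrite lt_max ltr01 orbT.
exists (C * A1) => _ [y _ <-].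
have zy : mxdot z y <= C * eucl y.
  rewrite (le_trans (ler_norm _))// (le_trans (mxdot_norm_le _ _))// mul1n.
  by rewrite ler_wpM2l// norm_le_eucl.
have /andP[Ky _] := H y.
have [yA|yA] := leP (eucl y) A1.
  rewrite lerBlDr (le_trans zy)// ler_wpDr ?(le_trans (Pm0 _) Ky)//.
  by rewrite ler_wpM2l.
have y0 : 0 < eucl y by rewrite (lt_trans A10).
have := AP (eucl y); rewrite /= ler_pdivlMr// => /(_ _)/le_trans.
rewrite (le_lt_trans _ yA) ?le_max ?lexx// => /(_ _ isT Ky) CK.
by rewrite (@le_trans _ _ 0)// ?mulr_ge0 ?(ltW A10)// subr_le0 (le_trans zy).
Qed.

Lemma Legendre_young z y : mxdot z y <= K y + Ks z.
Proof.
rewrite -lerBlDl; apply: sup_ubound; first exact: Legendre_has_ubound.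
by exists y.
Qed.

Lemma Legendre_le z c : (forall y, mxdot z y - K y <= c) -> Ks z <= c.
Proof.
move=> H; apply: ge_sup; first by exists (mxdot z 0 - K 0), 0.
by move=> _ [y _ <-].
Qed.

Lemma Legendre_gt z c : c < Ks z -> exists y, c < mxdot z y - K y.
Proof.
move=> cK; apply: contrapT => H; move: cK; apply/negP; rewrite -leNgt.
by apply: Legendre_le => y; rewrite leNgt; apply/negP => cy; apply: H; exists y.
Qed.

Lemma Legendre_ge0 z : 0 <= Ks z.
Proof. by have := Legendre_young z 0; rewrite mxdot0r N_function0 add0r. Qed.

Lemma LegendreN z : Ks (- z) = Ks z.
Proof.
have [_ [Kev _] _] := NK.
have le w : Ks (- w) <= Ks w.
  apply: Legendre_le => y; rewrite mxdotNl -mxdotNr -(Kev y) lerBlDl.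
  exact: Legendre_young.
by apply/eqP; rewrite eq_le le/= -{1}(opprK z) le.
Qed.

(** The Young inequality against plus and minus a basis vector. It turns every bound in the dual
    Orlicz class into a bound on entries. *)
Lemma entry_le_Legendre z l : `|z 0 l| <= Ks z + K (basis_vec l).
Proof.
have [_ [Kev _] _] := NK.
rewrite addrC ler_norml -mxdot_basis Legendre_young andbT lerNl -mxdotNr.
by rewrite -(Kev (basis_vec l)) Legendre_young.
Qed.

Hypothesis C1K : C1 K.
Hypothesis sK : strictly_convex K.

Let cK : convex_function setT (K : _ -> R^o). Proof. by case: NK. Qed.

Lemma Legendre_grad v : Ks (grad K v) = mxdot (grad K v) v - K v.
Proof.
apply/eqP; rewrite eq_le; apply/andP; split; last first.
  by rewrite lerBlDl Legendre_young.
apply: Legendre_le => y; have := convex_tangent v y cK C1K.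
by rewrite mxdotBr; lra.
Qed.

(** The tangent at u, towards y and towards 2 u, gives grad f(u) . y <= f(y) + f(2 u) <= c (K(y) +
    1) + c (K(2 u) + 1). After division by c, the term K(y) cancels the one subtracted in the
    Legendre transform. *)
Lemma Legendre_grad_le (f : 'rV[R]_n -> R) (c : R) u : 0 < c ->
  convex_function setT (f : _ -> R^o) -> C1 f ->
  (forall y, 0 <= f y <= c * (K y + 1)) ->
  Ks (c^-1 *: grad f u) <= K (2 *: u) + 2.
Proof.
move=> c0 cf C1f fb; apply: Legendre_le => y; rewrite mxdotZl.
have h1 := convex_tangent u y cf C1f.
have h2 := convex_grad_self_le u cf C1f.
have /andP[h3 _] := fb u; have /andP[h4 h5] := fb y.
have /andP[_ h6] := fb (2 *: u).
move: h1; rewrite mxdotBr => h1.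
have : mxdot (grad f u) y <= c * (K y + 1) + c * (K (2 *: u) + 1) by lra.
rewrite -mulrDr mulrC -ler_pdivrMr// mulrC; lra.
Qed.

(* Outside a ball the Bregman distance grows at least linearly: it is bounded
   below on the sphere and convex along rays. *)
Lemma Bregman_linear_growth v (r : R) : 0 < r ->
  exists2 m : R, 0 < m & forall y, r <= `|y - v| ->
    m * `|y - v| <= K y - K v - mxdot (grad K v) (y - v).
Proof.
move=> r0; pose S := [set y : 'rV[R]_n | `|y - v| = r].
(* The sphere can be empty, as for n = 0. Then no y is at distance at least r from v, since
   rescaling y - v would give a point of the sphere. *)
have [[p0 Sp0]|S0] := pselect (S !=set0); last first.
  exists 1 => // y ry; exfalso; apply: S0; exists (r / `|y - v| *: (y - v) + v).
  have y0 : 0 < `|y - v| by rewrite (lt_le_trans r0).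
  rewrite /S/= addrK normrZ ger0_norm ?divr_ge0 ?(ltW r0)//.
  by rewrite divfK ?gt_eqF.
pose D y := K y - K v - mxdot (grad K v) (y - v).
have cD : continuous D.
  have [cK' _ _] := C1K.
  apply: continuous_sub; first by apply: continuous_sub => //; exact: cst_continuous.
  apply: continuous_mxdot => i j; first exact: cst_continuous.
  have -> : (fun x : 'rV[R]_n => (x - v) i j) = (fun x => x i j - v i j).
    by apply/funext => x; rewrite !mxE.
  apply: continuous_sub; last exact: cst_continuous.
  exact: coord_continuous.
have compS : compact S.
  apply: bounded_closed_compact.
    exists (r + `|v|); split => //; first exact: num_real.
    move=> M rM y /= Sy; rewrite (le_trans _ (ltW rM))// -(subrK v y).
    by rewrite (le_trans (ler_normD _ _))// Sy.
  have /continuous_closedP H := @continuous_dist _ 'rV[R]_n v.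
  have -> : S = (fun y : 'rV[R]_n => `|y - v|) @^-1` [set r].
    by apply/seteqP; split.
  by apply: H; exact: closed_eq.
have [c] := EVT_min_rV (ex_intro _ p0 Sp0) compS (continuous_subspaceT cD).
rewrite inE => Sc minc.
have Dc : 0 < D c.
  rewrite lt_neqAle eq_sym; apply/andP; split; last first.
    by rewrite /D -addrA -opprD subr_ge0 convex_tangent.
  apply/eqP => Dc; have cv : c = v.
    by apply: (strictly_convex_tangent sK cK C1K); rewrite /D in Dc; lra.
  by move: Sc; rewrite /S/= cv subrr normr0 => /esym/eqP; rewrite gt_eqF.
exists (D c / r); first by rewrite divr_gt0.
move=> y ry; set rho := `|y - v|.
have rho0 : 0 < rho by rewrite (lt_le_trans r0).
(* With this t the point [p] is where the segment from v to y meets the sphere; convexity gives D p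
   <= t D y. *)
pose t := r / rho; have t0 : 0 < t by rewrite divr_gt0.
have t1 : t <= 1 by rewrite ler_pdivrMr// mul1r.
pose p := t *: y + (1 - t) *: v.
have pv : p - v = t *: (y - v).
  by rewrite /p scalerBl scale1r scalerBr addrCA addrAC subrr add0r.
have Sp : S p.
  by rewrite /S/= pv normrZ gtr0_norm// -/rho divfK ?gt_eqF.
have := minc p; rewrite inE => /(_ Sp) Dcp.
have := convex_functionE cK y v (t := t); rewrite t1 (ltW t0) => /(_ isT) Kp.
have Dpt : D p <= t * D y.
  rewrite /D pv mxdotZr; move: Kp; rewrite -/p; lra.
rewrite -/(D y) mulrAC ler_pdivrMr// mulrC.
have : D c <= t * D y by exact: le_trans Dpt.
by rewrite /t mulrAC ler_pdivlMr// mulrC (mulrC r).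
Qed.

(** Set w = grad K(v). The lower bound for the dual at w + h e is the Young inequality with v. For
    the upper bound, each competitor y contributes an error of at most |h| M |y - v| minus its
    Bregman distance from v: within radius r = eps / M the error is at most |h| eps, and outside it
    the linear growth m |y - v| absorbs it as soon as |h| <= m / M. *)
Lemma derive_Legendre_grad v e : 'D_e Ks (grad K v) = mxdot e v.
Proof.
apply/cvg_lim => //; apply/cvgrPdist_le => eps e0.
set w := grad K v.
pose M := n%:R * `|e| + 1; have M0 : 0 < M by rewrite ltr_wpDl// mulr_ge0.
pose r := eps / M; have r0 : 0 < r by rewrite divr_gt0.
have [m m0 Hm] := Bregman_linear_growth v r0.
have mM : 0 < m / M by rewrite divr_gt0.
near=> h.
have h0 : h != 0 by near: h; exact: nbhs_dnbhs_neq.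
have hm : `|h| <= m / M by near: h; apply: dnbhs0_le.
have lo : Ks w + h * mxdot e v <= Ks (h *: e + w).
  have := Legendre_young (h *: e + w) v.
  by rewrite mxdotDl mxdotZl (Legendre_grad v) -/w; lra.
have hi : Ks (h *: e + w) <= Ks w + h * mxdot e v + `|h| * eps.
  apply: Legendre_le => y; rewrite mxdotDl mxdotZl (Legendre_grad v) -/w.
  have tang := convex_tangent v y cK C1K; rewrite -/w mxdotBr in tang.
  have ey : h * (mxdot e y - mxdot e v) <= `|h| * M * `|y - v|.
    rewrite -mxdotBr (le_trans (ler_norm _))// normrM -mulrA ler_wpM2l//.
    rewrite (le_trans (mxdot_norm_le _ _))// mul1n ler_wpM2r// /M; lra.
  have [yr|yr] := leP r `|y - v|.
    have := Hm y yr; rewrite -/w mxdotBr => Hy.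
    have : `|h| * M * `|y - v| <= m * `|y - v|.
      by rewrite ler_wpM2r// -ler_pdivlMr.
    have : 0 <= `|h| * eps by rewrite mulr_ge0// ltW.
    lra.
  have : `|h| * M * `|y - v| <= `|h| * eps.
    rewrite -mulrA ler_wpM2l// mulrC -ler_pdivlMr//; exact: ltW.
  lra.
rewrite /= -(mulKf h0 (mxdot e v)) -mulrBr normrM normfV.
rewrite ler_pdivrMl ?normr_gt0// ler_norml; apply/andP; split; lra.
Unshelve. all: by end_near. Qed.

Lemma grad_Legendre_grad v : grad Ks (grad K v) = v.
Proof.
apply/rowP => l; rewrite mxE derive_Legendre_grad mxdotC.
by rewrite mxdot_basis.
Qed.

End Legendre_theory.

(** * The flux and its pointwise estimates *)

Section derive_mxdot.
Context {R : realType} {V : normedModType R} {m n : nat}.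
Implicit Types (f : V -> 'M[R]_(m, n)) (P : 'M[R]_(m, n)).

Lemma is_derive_mxdot f P x e : derivable f x e ->
  is_derive x e (fun y => mxdot (f y) P) (mxdot ('D_e f x) P).
Proof.
move=> df; have cP : continuous (fun A : 'M[R]_(m, n) => mxdot A P).
  by apply: continuous_mxdot => i j; [exact: coord_continuous|exact: cst_continuous].
have E : (fun h : R => h^-1 *: (((fun y => mxdot (f y) P) \o shift x) (h *: e)
    - mxdot (f x) P)) =
    (fun A : 'M[R]_(m, n) => mxdot A P) \o
      (fun h : R => h^-1 *: ((f \o shift x) (h *: e) - f x)).
  by apply/funext => h /=; rewrite mxdotZl mxdotBl.
have H : ((fun A : 'M[R]_(m, n) => mxdot A P) \o
    (fun h : R => h^-1 *: ((f \o shift x) (h *: e) - f x))) h @[h --> 0^'] -->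
    mxdot ('D_e f x) P.
  have H0 : (fun h : R => h^-1 *: ((f \o shift x) (h *: e) - f x)) h
      @[h --> 0^'] --> 'D_e f x by exact: df.
  exact: (cvg_comp _ _ H0 (cP _)).
split; first by rewrite /derivable E; apply/cvg_ex; exists (mxdot ('D_e f x) P).
by rewrite /derive E; apply: cvg_lim.
Qed.

End derive_mxdot.

Lemma Delta2_pow {R : realType} n (K : 'rV[R]_n -> R) k : (forall y, 0 <= K y) ->
  Delta2 K -> exists2 C : R, 0 <= C & forall y, K (2 ^+ k *: y) <= C * (K y + 1).
Proof.
move=> K0 [C HC]; elim: k => [|k [C' C'0 IH]].
  by exists 1 => // y; rewrite expr0 scale1r mul1r lerDl.
have C0 : 0 <= C by have := HC 0; rewrite scaler0; have := K0 0; nra.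
exists (C * (C' + 1)) => [|y]; first by rewrite mulr_ge0// addr_ge0.
rewrite exprS -scalerA (le_trans (HC _))// -mulrA ler_wpM2l//.
by have := IH y; have := K0 y; lra.
Qed.

Section psd_theory.
Context {R : realType} {N : nat}.
Implicit Types A B : 'M[R]_N.

Lemma quadratic_formE A (x : 'rV[R]_N) :
  (x *m A *m x^T) 0 0 = \sum_i \sum_j x 0 i * A i j * x 0 j.
Proof.
rewrite mxE exchange_big/=; apply: eq_bigr => j _; rewrite mxE mulr_suml.
by apply: eq_bigr => i _; rewrite mxE.
Qed.

Lemma symmetric_scalar_mx (c : R) : symmetric_mx (c%:M : 'M[R]_N).
Proof. by rewrite /symmetric_mx tr_scalar_mx. Qed.

Lemma symmetric_mxD A B : symmetric_mx A -> symmetric_mx B -> symmetric_mx (A + B).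
Proof. by rewrite /symmetric_mx linearD/= => -> ->. Qed.

Lemma symmetric_mxZ (c : R) A : symmetric_mx A -> symmetric_mx (c *: A).
Proof. by rewrite /symmetric_mx linearZ/= => ->. Qed.

Lemma psd_scalar_mx (c : R) : 0 <= c -> psd_mx (c%:M : 'M[R]_N).
Proof.
move=> c0; split; first exact: symmetric_scalar_mx.
move=> x; rewrite mul_mx_scalar -scalemxAl mxE mulr_ge0// mxE.
by apply: sumr_ge0 => i _; rewrite mxE -expr2 sqr_ge0.
Qed.

(** The norm of A is its largest entry in absolute value, so 2 |x_i x_j| <= x_i^2 + x_j^2 bounds the
    quadratic form of A by N M |x|^2. *)
Lemma psd_scalar_addmx A (M c : R) : symmetric_mx A -> `|A| <= M ->
  N%:R * M <= c -> psd_mx (c%:M + A).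
Proof.
move=> sA AM Mc; split; first exact/symmetric_mxD/sA/symmetric_scalar_mx.
move=> x; rewrite mulmxDr mulmxDl mxE.
pose s := \sum_i x 0 i ^+ 2.
have s0 : 0 <= s by apply: sumr_ge0 => i _; exact: sqr_ge0.
have -> : (x *m c%:M *m x^T) 0 0 = c * s.
  rewrite mul_mx_scalar -scalemxAl mxE; congr (_ * _); rewrite mxE.
  by apply: eq_bigr => i _; rewrite mxE -expr2.
have M0 : 0 <= M by exact: le_trans AM.
have : `|(x *m A *m x^T) 0 0| <= N%:R * M * s.
  rewrite quadratic_formE (le_trans (ler_norm_sum _ _ _))//.
  apply: (@le_trans _ _ (\sum_(i < N) \sum_(j < N)
      (M / 2 * (x 0 i ^+ 2 + x 0 j ^+ 2)))).
    apply: ler_sum => i _; rewrite (le_trans (ler_norm_sum _ _ _))//.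
    apply: ler_sum => j _; rewrite !normrM.
    have Aij : `|A i j| <= M by exact: le_trans (mx_entry_le_norm _ _ _) AM.
    apply: (@le_trans _ _ (M * (`|x 0 i| * `|x 0 j|))).
      by rewrite mulrAC mulrC ler_wpM2r// mulr_ge0.
    rewrite -(real_normK (num_real (x 0 i))) -(real_normK (num_real (x 0 j))).
    rewrite -mulrA ler_wpM2l//.
    have := sqr_ge0 (`|x 0 i| - `|x 0 j|); lra.
  have -> : N%:R * M * s = M / 2 * (N%:R * s + N%:R * s) by lra.
  under eq_bigr do rewrite -mulr_sumr.
  rewrite -mulr_sumr ler_wpM2l ?divr_ge0//.
  under eq_bigr do rewrite big_split/= sumr_const card_ord -[_ *+ N]mulr_natl.
  rewrite big_split/= -mulr_sumr -/s sumr_const card_ord -[s *+ N]mulr_natl.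
  exact: lexx.
have : N%:R * M * s <= c * s by rewrite ler_wpM2r.
by rewrite ler_norml => H /andP[]; lra.
Qed.

End psd_theory.

Section flux.
Context {R : realType} {d n N : nat}.
Variables (F : 'rV[R]_n -> 'M[R]_N) (L : @diff_operator R d n N).
Hypothesis SA : standing_assumptions F L.
Local Notation K := (entropy F).
Local Notation Ks := (entropy_dual F).
Implicit Types (u v y : 'rV[R]_n) (P A : 'M[R]_N).

Let C2F : C_k 2 F. Proof. by case: SA => -[]. Qed.

Lemma flux_derivable x e : derivable F x e.
Proof. exact: (C2F [::]).1. Qed.

Lemma flux_continuous : continuous F.
Proof. exact: (C2F [::]).2. Qed.

Lemma flux_derive_continuous e : continuous ('D_e F).
Proof. exact: (C2F [:: e]).2. Qed.

Lemma derive_flux_mxdot P e x :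
  'D_e (fun y => mxdot (F y) P) x = mxdot ('D_e F x) P.
Proof. by have [_ ->] := is_derive_mxdot P (@flux_derivable x e). Qed.

Lemma C1_flux_mxdot P : C1 (fun v => mxdot (F v) P).
Proof.
split.
- apply: continuous_mxdot => i j; last exact: cst_continuous.
  exact/continuous_entry/flux_continuous.
- by move=> x e; have [] := is_derive_mxdot P (@flux_derivable x e).
- move=> e; have -> : 'D_e (fun y => mxdot (F y) P) = fun x => mxdot ('D_e F x) P.
    by apply/funext => x; exact: derive_flux_mxdot.
  apply: continuous_mxdot => i j; last exact: cst_continuous.
  exact/continuous_entry/flux_derive_continuous.
Qed.

Lemma entropyE v : K v = mxdot (F v) (2^-1)%:M - mxdot (F 0) (2^-1)%:M.
Proof. by rewrite /entropy -mxdotBl mxdot_scalar mulrC. Qed.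

Lemma C1_entropy : C1 K.
Proof.
have [cK dK cdK] := C1_flux_mxdot (2^-1)%:M.
have E : K = (fun v => mxdot (F v) (2^-1)%:M) \- cst (mxdot (F 0) (2^-1)%:M).
  by apply/funext => v; exact: entropyE.
split.
- by rewrite E; apply: continuous_sub => //; exact: cst_continuous.
- by move=> x e; rewrite E; apply: derivableB.
- move=> e; suff -> : 'D_e K = 'D_e (fun v => mxdot (F v) (2^-1)%:M) by [].
  apply/funext => x; rewrite E deriveB//.
  by rewrite (_ : 'D_e (cst _) x = 0) ?subr0//; exact: derive_cst.
Qed.

Lemma derive_entropy u e : 'D_e K u = 2^-1 * \tr ('D_e F u).
Proof.
rewrite -mxdot_scalar; have [_ dK _] := C1_flux_mxdot (2^-1)%:M.
have E : K = (fun v => mxdot (F v) (2^-1)%:M) \- cst (mxdot (F 0) (2^-1)%:M).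
  by apply/funext => y; exact: entropyE.
rewrite E deriveB// (_ : 'D_e (cst _) u = 0); last exact: derive_cst.
by rewrite subr0 derive_flux_mxdot.
Qed.

Lemma N_entropy : N_function K. Proof. by case: SA => _ []. Qed.

Lemma entropy_strictly_convex : strictly_convex K. Proof. by case: SA => _ []. Qed.

Lemma entropy_ge0 v : 0 <= K v. Proof. by case: N_entropy => _ [_]. Qed.

Lemma entropy_convex : convex_function setT (K : _ -> R^o).
Proof. by case: N_entropy. Qed.

Lemma grad_sharp v : grad Ks (grad K v) = v.
Proof.
exact: (grad_Legendre_grad N_entropy C1_entropy entropy_strictly_convex).
Qed.

Lemma Lambda1 c : Lambda L c%:M.
Proof. by move=> S S1 _; rewrite -scalemx1 memvZ. Qed.

Lemma LambdaD P A : Lambda L P -> Lambda L A -> Lambda L (P + A).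
Proof. by move=> LP LA S S1 SL; rewrite memvD ?LP ?LA. Qed.

Lemma LambdaZ c P : Lambda L P -> Lambda L (c *: P).
Proof. by move=> LP S S1 SL; rewrite memvZ// LP. Qed.

Lemma flux_mxdot_ge0 v P : Lambda_psd L P -> 0 <= mxdot (F v) P.
Proof. by case: SA => _ _ _ [+ _] _; move=> /(_ v)[_]; exact. Qed.

Lemma trace_flux_ge0 v : 0 <= \tr (F v).
Proof.
have := @flux_mxdot_ge0 v 1%:M; rewrite mxdot_scalar mul1r; apply.
by split; [exact: Lambda1|exact: psd_scalar_mx].
Qed.

(** Both c I + A and c I - A are nonnegative for c = N M, whence |F : A| <= c Tr F = c (2 K + Tr
    F(0)). The constant is rounded up to a power of two so that Delta_2 can be iterated k times to
    remove it. *)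
Lemma flux_mxdot_bound (M : R) : 0 <= M -> exists2 k : nat,
  0 < (2 ^+ k : R) & forall A v, Lambda L A -> symmetric_mx A -> `|A| <= M ->
    `|mxdot (F v) A| <= 2 ^+ k * (K v + 1).
Proof.
move=> M0; pose c := N%:R * M; have c0 : 0 <= c by rewrite mulr_ge0.
have tF0 := trace_flux_ge0 0.
have [k Hk] : exists k, c * 2 + c * \tr (F 0) <= 2 ^+ k.
  exists (Num.bound (c * 2 + c * \tr (F 0))).
  have x0 : 0 <= c * 2 + c * \tr (F 0) by rewrite addr_ge0// mulr_ge0.
  rewrite (le_trans (ltW (archi_boundP x0)))//.
  by rewrite -natrX ler_nat ltnW// ltn_expl.
exists k => [|A v LA sA AM]; first by rewrite exprn_gt0.
have Kv0 := entropy_ge0 v.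
have KvE : \tr (F v) = 2 * K v + \tr (F 0).
  by rewrite /entropy raddfB/=; lra.
have h1 := @flux_mxdot_ge0 v (c%:M + A).
have h2 := @flux_mxdot_ge0 v (c%:M + -1 *: A).
have {}h1 : 0 <= mxdot (F v) (c%:M + A).
  apply: h1; split; first exact/LambdaD/LA/Lambda1.
  exact: psd_scalar_addmx sA AM (lexx _).
have {}h2 : 0 <= mxdot (F v) (c%:M + -1 *: A).
  apply: h2; split; first exact/LambdaD/LambdaZ/LA/Lambda1.
  apply: (psd_scalar_addmx (M := M)) => //; first exact: symmetric_mxZ.
  by rewrite scaleN1r normrN.
move: h1 h2; rewrite !mxdotDr mxdotZr mxdot_scalar => h1 h2.
have : `|mxdot (F v) A| <= c * \tr (F v).
  by rewrite ler_norml; apply/andP; split; lra.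
move=> /le_trans; apply; rewrite KvE.
have : c * \tr (F 0) * 1 <= c * \tr (F 0) * (K v + 1).
  by rewrite ler_wpM2l ?mulr_ge0// lerDr.
have : (c * 2 + c * \tr (F 0)) * (K v + 1) <= 2 ^+ k * (K v + 1).
  by rewrite ler_wpM2r// addr_ge0.
lra.
Qed.

(** With P = L^* (v^#), this is the value that the evolution equation prescribes for the time
    derivative of v^#. *)
Definition flux_field P u : 'rV[R]_n := \row_l - mxdot ('D_(basis_vec l) F u) P.

Lemma flux_fieldE P u : flux_field P u = - grad (fun v => mxdot (F v) P) u.
Proof. by apply/rowP => l; rewrite !mxE derive_flux_mxdot. Qed.

Lemma mxdot_flux_field P u y :
  mxdot (flux_field P u) y = - mxdot ('D_y F u) P.
Proof.
by rewrite flux_fieldE mxdotNl mxdot_grad ?derive_flux_mxdot//; exact: C1_flux_mxdot.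
Qed.

Lemma Lambda_flux_convex P : Lambda_psd L P ->
  convex_function setT ((fun v => mxdot (F v) P) : _ -> R^o).
Proof. by case: SA => _ _ + _ _; exact. Qed.

Lemma entropy_Delta2 k : exists2 C : R, 0 <= C &
  forall y, K (2 ^+ k *: y) <= C * (K y + 1).
Proof. by apply: Delta2_pow; [exact: entropy_ge0|case: SA => _ []]. Qed.

Lemma entropy_dual_Delta2 k : exists2 C : R, 0 <= C &
  forall y, Ks (2 ^+ k *: y) <= C * (Ks y + 1).
Proof.
by apply: Delta2_pow; [exact: (Legendre_ge0 N_entropy)|case: SA => _ []].
Qed.

(** [Legendre_grad_le] with c = 2^k bounds the dual at the gradient divided by 2^k. Delta_2 of the
    dual restores the factor 2^k, and Delta_2 of K replaces K(2 u) by K(u). *)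
Lemma flux_field_bound (M : R) : 0 <= M -> exists2 C : R, 0 <= C &
  forall P u, Lambda_psd L P -> `|P| <= M -> Ks (flux_field P u) <= C * (K u + 1).
Proof.
move=> M0; have [k c0 Hk] := flux_mxdot_bound M0.
have [C C0 HC] := entropy_dual_Delta2 k.
have [C' C'0 HC'] := entropy_Delta2 1.
exists (C * (C' + 3)) => [|P u LP PM]; first by rewrite mulr_ge0// addr_ge0.
rewrite flux_fieldE /entropy_dual (LegendreN N_entropy) -/(entropy_dual F).
have [LP1 [sP _]] := LP.
have H := Legendre_grad_le (K := K) u c0 (Lambda_flux_convex LP) (C1_flux_mxdot P).
have {}H : Ks ((2 ^+ k)^-1 *: grad (fun v => mxdot (F v) P) u) <= K (2 *: u) + 2.
  apply: H => y; rewrite flux_mxdot_ge0//=.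
  by rewrite (le_trans (ler_norm _))// Hk.
have := HC ((2 ^+ k)^-1 *: grad (fun v => mxdot (F v) P) u).
rewrite scalerA divff ?gt_eqF// scale1r => /le_trans; apply.
rewrite -mulrA ler_wpM2l//.
have := HC' u; rewrite expr1 => H'; have := entropy_ge0 u.
have : 0 <= C' * K u by rewrite mulr_ge0// entropy_ge0.
lra.
Qed.

(** Equality in the Young inequality gives the value grad K(u) . u - K(u), which is at most K(2 u);
    then Delta_2 applies. *)
Lemma sharp_bound : exists2 C : R, 0 <= C &
  forall u, Ks (grad K u) <= C * (K u + 1).
Proof.
have [C C0 HC] := entropy_Delta2 1; exists C => // u.
rewrite (le_trans _ (HC u))// expr1 /entropy_dual.
rewrite (Legendre_grad N_entropy C1_entropy).
have := convex_grad_self_le u entropy_convex C1_entropy.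
by have := entropy_ge0 u; lra.
Qed.

(* Half of the coercive term [hh (K v - K u)] is kept to make the convexity gap
   strict; the other half absorbs the indefinite matrix [B]. *)
Lemma relative_entropy_inequality B (hh : R) u v :
  Lambda_psd L ((hh / 4)%:M + B) ->
  hh / 2 * (K v - K u - mxdot (grad K u) (v - u)) <=
  mxdot (flux_field ((hh / 2)%:M + B) u) (v - u) + mxdot (F v - F u) B
    + hh * (K v - K u).
Proof.
move=> LQ; set Q := (hh / 4)%:M + B in LQ.
have := convex_tangent u v (Lambda_flux_convex LQ) (C1_flux_mxdot Q).
rewrite mxdot_grad; last exact: C1_flux_mxdot.
rewrite derive_flux_mxdot mxdot_flux_field.
rewrite mxdot_grad; last exact: C1_entropy.
rewrite derive_entropy.
have -> : K v - K u = 2^-1 * \tr (F v) - 2^-1 * \tr (F u).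
  by rewrite !entropyE !mxdot_scalar; lra.
rewrite /Q !mxdotDr !mxdot_scalar !mxdotBl; lra.
Qed.

End flux.

(** * Measurability and the torus *)

Section open_measurable_matrix.
Context {R : realType} {n : nat}.

(** The sigma-algebra on row vectors is generated by the entries, so open sets have to be shown
    measurable. The label of the dyadic cube of side 2^-k containing x takes countably many
    values. *)
Definition dyadic_cell (k : nat) (x : 'rV[R]_n) : {ffun 'I_n -> int} :=
  [ffun i => Num.floor (2 ^+ k * x 0 i)].

Lemma measurable_dyadic_cell k (Y : set {ffun 'I_n -> int}) :
  measurable (dyadic_cell k @^-1` Y).
Proof.
have -> : dyadic_cell k @^-1` Y =
    \bigcup_c (dyadic_cell k @^-1` (Y `&` [set c])).
  apply/seteqP; split => [x Yx|x [c _ [? _]]//].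
  by exists (dyadic_cell k x).
apply: countable_bigcupT_measurable => [|c]; first exact: countableP.
have [Yc|nYc] := pselect (Y c); last first.
  rewrite (_ : _ @^-1` _ = set0)//; apply/seteqP; split => // x [Yx /= xc].
  by apply: nYc; rewrite -xc.
have -> : dyadic_cell k @^-1` (Y `&` [set c]) =
    \bigcap_(i in [set: 'I_n]) ((fun x : 'rV[R]_n => x 0 i) @^-1`
      `[2 ^- k * (c i)%:~R, 2 ^- k * (c i + 1)%:~R[).
  have p0 : 0 < (2 ^- k : R) by rewrite invr_gt0 exprn_gt0.
  have E (x : 'rV[R]_n) i : (x 0 i \in `[2 ^- k * (c i)%:~R, 2 ^- k * (c i + 1)%:~R[)
      = (Num.floor (2 ^+ k * x 0 i) == c i).
    rewrite in_itv/= !ler_pdivrMl ?ltr_pdivlMl ?exprn_gt0//.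
    by apply/idP/eqP => [H|<-]; [exact: floor_def|exact: floor_itv].
  apply/seteqP; split => [x [_ /= xc] i _|x H].
    by rewrite /= E -xc ffunE.
  have xc : dyadic_cell k x = c.
    apply/ffunP => i; rewrite ffunE; apply/eqP; rewrite -E; exact: H.
  by split; rewrite /= xc.
apply: fin_bigcap_measurable => // i _.
by rewrite -[X in measurable X]setTI; exact: measurable_entry.
Qed.

(** Each point of U has a ball inside U, hence, for k large, its whole dyadic cube. So U is the
    countable union over k of the sets of points whose cube of side 2^-k lies in U. *)
Lemma open_measurable_rV (U : set 'rV[R]_n) : open U -> measurable U.
Proof.
move=> oU.
have -> : U = \bigcup_k (dyadic_cell k @^-1`
    [set c | forall y, dyadic_cell k y = c -> U y]).
  apply/seteqP; split => [x Ux|x [k _]]; last by apply.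
  have /nbhs_ballP[r /= r0 rU] : nbhs x U by exact: open_nbhs_nbhs.
  have [k kr] : exists k, 2 ^- k < r.
    have ri : 0 <= r^-1 by rewrite invr_ge0 ltW.
    exists (Num.bound r^-1); rewrite invf_plt ?posrE ?exprn_gt0//.
    rewrite (lt_le_trans (archi_boundP ri))//.
    by rewrite -natrX ler_nat ltnW// ltn_expl.
  exists k => // y yx; apply: rU; rewrite -ball_normE/=.
  have p0 : 0 < (2 ^+ k : R) by rewrite exprn_gt0.
  apply: le_lt_trans kr; apply: mx_norm_le => [|i j]; first by rewrite invr_ge0 ltW.
  rewrite ord1 !mxE; have /ffunP/(_ j) := yx; rewrite !ffunE => fl.
  have /andP[h1 h2] := floor_itv (2 ^+ k * x 0 j).
  have /andP[h3 h4] := floor_itv (2 ^+ k * y 0 j).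
  rewrite fl in h3 h4; rewrite intrD in h2 h4.
  rewrite -[X in _ <= X]mulr1 ler_pdivlMl// -[X in X * _](gtr0_norm p0) -normrM.
  by rewrite mulrBr ler_norml; apply/andP; split; lra.
apply: bigcupT_measurable => k; exact: measurable_dyadic_cell.
Qed.

Lemma lower_semicontinuous_measurable (f : 'rV[R]_n -> R) :
  (forall a, open [set x | a < f x]) -> measurable_fun setT f.
Proof.
move=> of_; apply: (measurability _ (RGenOInfty.measurableE R)).
move=> _ [_ [a ->] <-]; rewrite setTI; apply: open_measurable_rV.
rewrite (_ : _ @^-1` _ = [set x | a < f x])//.
by apply/seteqP; split => x /=; rewrite in_itv/= andbT.
Qed.

Lemma continuous_measurable_rV (f : 'rV[R]_n -> R) : continuous f ->
  measurable_fun setT f.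
Proof.
move=> /continuousP cf; apply: lower_semicontinuous_measurable => a.
rewrite (_ : [set x | _] = f @^-1` `]a, +oo[); first exact/cf/interval_open.
by apply/seteqP; split => x /=; rewrite in_itv/= andbT.
Qed.

(** As a supremum of affine functions, the Legendre transform is lower semicontinuous. *)
Lemma measurable_Legendre (K : 'rV[R]_n -> R) : N_function K ->
  measurable_fun setT (Legendre K).
Proof.
move=> NK; apply: lower_semicontinuous_measurable => a.
have -> : [set z | a < Legendre K z] =
    \bigcup_y ((fun z => mxdot z y - K y) @^-1` `]a, +oo[).
  apply/seteqP; split => [z /= /Legendre_gt[y ay]|z [y _] /=].
    by exists y => //=; rewrite in_itv/= ay.
  rewrite in_itv/= andbT => /lt_le_trans; apply.
  by rewrite lerBlDl; exact: Legendre_young.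
apply: bigcup_open => y _.
have /continuousP H : continuous (fun z : 'rV[R]_n => mxdot z y - K y).
  apply: continuous_sub; last exact: cst_continuous.
  by apply: continuous_mxdot => i j; [exact: coord_continuous|exact: cst_continuous].
exact/H/interval_open.
Qed.

End open_measurable_matrix.

Section continuous_compose.
Context {R : realType}.

Lemma continuous_rowP (S : topologicalType) n (f : S -> 'rV[R]_n) :
  (forall i, continuous (fun x => f x 0 i)) -> continuous f.
Proof.
move=> cf x; apply/cvgrPdist_le => e e0; near=> y.
apply: mx_norm_le => [|i j]; first exact: ltW.
rewrite ord1 !mxE; move: j; near: y; apply: filter_forall => j.
by have /cvgrPdist_le/(_ e e0) := cf j x.
Unshelve. all: by end_near. Qed.

(** Identifies space-time with R^(d+1), which reduces measurability of continuous functions for the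
    product sigma-algebra to the case of row vectors. *)
Definition unglue d (y : 'rV[R]_d.+1) : R * 'rV[R]_d :=
  (y 0 0, \row_i y 0 (lift ord0 i)).

Lemma glueK d : cancel (@Defs.glue R d) (@unglue d).
Proof.
move=> [t x]; rewrite /unglue /Defs.glue; congr pair.
  have -> : (0 : 'I_d.+1) = lshift d (0 : 'I_1) by apply/val_inj.
  by rewrite (@row_mxEl R 1 1 d) mxE.
apply/rowP => i; rewrite mxE.
have -> : lift ord0 i = rshift 1 i by apply/val_inj.
by rewrite (@row_mxEr R 1 1 d).
Qed.

Lemma continuous_pair (S T1 T2 : topologicalType) (f : S -> T1) (g : S -> T2) :
  continuous f -> continuous g -> continuous (fun x => (f x, g x)).
Proof. by move=> cf cg x; apply: cvg_pair; [exact: cf|exact: cg]. Qed.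

Lemma continuous_unglue d : continuous (@unglue d).
Proof.
apply: continuous_pair; first exact: coord_continuous.
apply: continuous_rowP => i.
under eq_fun do rewrite mxE.
exact: coord_continuous.
Qed.

Lemma continuous_measurable_spacetime d (f : R * 'rV[R]_d -> R) : continuous f ->
  measurable_fun setT (f : measurableTypeR R * 'rV[R]_d -> R).
Proof.
move=> cf; have -> : f = (f \o @unglue d) \o @Defs.glue R d.
  by apply/funext => z /=; rewrite glueK.
apply: measurableT_comp; last exact: measurable_glue.
apply: continuous_measurable_rV => y; apply: continuous_comp; last exact: cf.
exact: continuous_unglue.
Qed.

Lemma measurable_continuous_comp dsp (X : measurableType dsp) (D : set X) n
    (g : 'rV[R]_n -> R) (f : X -> 'rV[R]_n) : continuous g ->
  measurable_fun D f -> measurable_fun D (fun x => g (f x)).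
Proof.
by move=> cg mf; apply: measurableT_comp => //; exact: continuous_measurable_rV.
Qed.

Lemma measurable_fun_mxdot dsp (X : measurableType dsp) (D : set X) m k
    (f g : X -> 'M[R]_(m, k)) : measurable D -> measurable_fun D f ->
  measurable_fun D g -> measurable_fun D (fun x => mxdot (f x) (g x)).
Proof.
move=> mD /(measurable_mxP _ mD) mf /(measurable_mxP _ mD) mg.
apply: measurable_sum => i; apply: measurable_sum => j.
exact: measurable_funM.
Qed.

End continuous_compose.

Section torus_theory.
Context {R : realType}.

(** A set of full measure with compact closure: continuous functions are bounded on it, and periodic
    bumps can be compared with boxes there. *)
Definition unit_cube d : set 'rV[R]_d := [set x | forall i, 0 < x 0 i < 1].

Lemma measurable_unit_cube d : measurable (@unit_cube d).
Proof.
have -> : @unit_cube d = \bigcap_(i in [set: 'I_d])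
    ((fun x : 'rV[R]_d => x 0 i) @^-1` `]0, 1[).
  apply/seteqP; split => x H i; first by move=> _; rewrite /= in_itv/= H.
  by have := H i I; rewrite /= in_itv.
apply: fin_bigcap_measurable => // i _.
by rewrite -[X in measurable X]setTI; exact: measurable_entry.
Qed.

Lemma torus_unit_cube d : torus d (@unit_cube d) = 1%E.
Proof.
elim: d => [|d IH].
  rewrite /= diracE mem_set// => -[].
  by [].
rewrite /= /distribution /pushforward.
have -> : (@Defs.glue R d) @^-1` (@unit_cube d.+1) = `]0, 1[ `*` @unit_cube d.
  apply/seteqP; split => [[t x] H|[t x] [/= t01 H]].
    split => /=.
      have := H (lshift d (0 : 'I_1)); rewrite /Defs.glue (@row_mxEl R 1 1 d) mxE/=.
      by rewrite in_itv.
    by move=> i; have := H (rshift 1 i); rewrite /Defs.glue (@row_mxEr R 1 1 d).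
  move=> i; rewrite /Defs.glue; case: (@split_ordP 1 d i) => k ->.
    by rewrite (@row_mxEl R 1 1 d) mxE/=; rewrite in_itv/= in t01.
  by rewrite (@row_mxEr R 1 1 d).
rewrite product_measure1E//; last exact: measurable_unit_cube.
rewrite [X in (_ * X)%E]IH mule1.
rewrite [LHS](_ : _ =
  \int[lebesgue_measure]_(x in `]0%R, 1%R[) (uniform_pdf 0 1 x)%:E)%E//.
rewrite integral_uniform_pdf.
have -> : `]0, 1[%classic `&` `[0, 1]%classic = `]0, 1[%classic :> set R.
  by apply/seteqP; split => x /= => [[]//|]; rewrite !in_itv/= => /andP[? ?];
    split; rewrite ?in_itv//=; apply/andP; split => //; exact: ltW.
rewrite (eq_integral (fun=> 1%:E)); last first.
  move=> x; rewrite inE/= in_itv/= => /andP[? ?].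
  by rewrite /uniform_pdf !ltW// subr0 invr1.
by rewrite integral_cst//= mul1e lebesgue_measure_itv/= lte_fin ltr01 oppr0 adde0.
Qed.

Lemma ae_unit_cube d : {ae torus d, forall x, @unit_cube d x}.
Proof.
have mC := @measurable_unit_cube d.
apply/negligibleP; first exact: measurableC.
apply: etrans (probability_setC (torus d) mC) _.
by rewrite torus_unit_cube subee.
Qed.

End torus_theory.

(** * Smooth functions and the differential operator *)

Section smooth_theory.
Context {R : realType} {V : normedModType R}.

Lemma smoothP (W : normedModType R) (f : V -> W) :
  smooth f <-> forall s, (forall x e, derivable (iter_derive s f) x e) /\
    continuous (iter_derive s f).
Proof.
split=> [sf s|H k s]; last by have [H1 H2] := H s; split.
by have [H1 H2] := sf (size s).+1 s; split; [exact: H1|exact: H2].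
Qed.

Lemma smooth_derivable (W : normedModType R) (f : V -> W) : smooth f ->
  forall x e, derivable f x e.
Proof. by move=> /smoothP/(_ [::])[]. Qed.

Lemma smooth_continuous (W : normedModType R) (f : V -> W) : smooth f ->
  continuous f.
Proof. by move=> /smoothP/(_ [::])[]. Qed.

Lemma smooth_derive (W : normedModType R) (f : V -> W) e : smooth f ->
  smooth ('D_e f).
Proof.
move=> /smoothP sf; apply/smoothP => s.
suff -> : iter_derive s ('D_e f) = iter_derive (rcons s e) f by exact: sf.
by rewrite /iter_derive foldr_rcons.
Qed.

Lemma smooth_iter_derive (W : normedModType R) (f : V -> W) s : smooth f ->
  smooth (iter_derive s f).
Proof. by move=> sf; elim: s => //= e s; exact: smooth_derive. Qed.

(** Coinduction for smoothness: exhibiting a class stable under differentiation replaces explicit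
    formulas for iterated derivatives. *)
Lemma smooth_coind (W : normedModType R) (S : set (V -> W)) :
  (forall f, S f -> [/\ continuous f, forall x e, derivable f x e &
     forall e, S ('D_e f)]) ->
  forall f, S f -> smooth f.
Proof.
move=> HS f Sf; apply/smoothP => s.
have /HS[? ? _] : S (iter_derive s f); last by split.
by elim: s => //= e s /HS[_ _].
Qed.

Lemma affine_smooth (f : V -> R) (c : V -> R) : continuous f ->
  (forall x e (h : R), f (h *: e + x) = h * c e + f x) -> smooth f.
Proof.
move=> cf fc.
pose S (g : V -> R) := continuous g /\
  exists c' : V -> R, forall x e (h : R), g (h *: e + x) = h * c' e + g x.
apply: (@smooth_coind _ S); last by split => //; exists c.
move=> g [cg [c' gc]].
have Dg x e : is_derive x e g (c' e).
  have H : (h^-1 *: ((g \o shift x) (h *: e) - g x)) @[h --> 0^'] --> c' e.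
    apply: cvg_near_cst; near=> h; rewrite /= gc addrK [_ *: _]mulKf//.
    by near: h; exact: nbhs_dnbhs_neq.
  split; first by apply/cvg_ex; exists (c' e).
  exact: cvg_lim H.
split => // e.
have -> : 'D_e g = cst (c' e) by apply/funext => x; have [_ ->] := Dg x e.
split; first exact: cst_continuous.
by exists (fun=> 0) => x e' h; rewrite mulr0 add0r.
Unshelve. all: by end_near. Qed.

Lemma smooth_cst (c : R) : smooth (fun _ : V => c).
Proof.
apply: (@affine_smooth _ (fun=> 0)); first exact: cst_continuous.
by move=> x e h; rewrite mulr0 add0r.
Qed.

Lemma derivable_line (f : V -> R) x e : derivable f x e ->
  is_derive (0 : R) (1 : R) (fun s : R => f (s *: e + x)) ('D_e f x).
Proof.
move=> df; have H : derivable f (0 *: e + x) e by rewrite scale0r add0r.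
by have := is_derive_line H; rewrite scale0r add0r.
Qed.

Lemma is_derive_comp_dir (g : R -> R) (f : V -> R) x e :
  derivable g (f x) 1 -> derivable f x e ->
  is_derive x e (g \o f) ('D_1 g (f x) * 'D_e f x).
Proof.
move=> dg df; have Hf := derivable_line df.
have Hg : is_derive (f (0 *: e + x)) 1 g ('D_1 g (f x)).
  by rewrite scale0r add0r; apply: derivableP; exact: dg.
have [H1 H2] := is_derive1_comp Hg Hf.
have E : (fun h : R => h^-1 *:
      (((g \o (fun s : R => f (s *: e + x))) \o shift 0) (h *: 1) -
       (g \o (fun s : R => f (s *: e + x))) 0)) =
    (fun h : R => h^-1 *: (((g \o f) \o shift x) (h *: e) - (g \o f) x)).
  by apply/funext => h /=; rewrite scale0r add0r addr0 [h *: 1]mulr1.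
split; first by move: H1; rewrite /derivable E.
by move: H2; rewrite /derive E => ->; rewrite mulrC.
Qed.

End smooth_theory.
Arguments smooth_derivable {R V W f} _ x e.

Section smooth_algebra.
Context {R : realType} {V : normedModType R}.

(** The class fed to [smooth_coind]. Sums and products must be in it together with compositions,
    since the chain and Leibniz rules produce them. *)
Inductive smooth_alg : (V -> R) -> Prop :=
| smooth_alg_base f : smooth f -> smooth_alg f
| smooth_alg_comp g f : smooth (g : R -> R) -> smooth f -> smooth_alg (g \o f)
| smooth_alg_add f g : smooth_alg f -> smooth_alg g -> smooth_alg (f + g)
| smooth_alg_mul f g : smooth_alg f -> smooth_alg g -> smooth_alg (f * g).

Lemma smooth_algP f : smooth_alg f -> smooth f.
Proof.
apply: smooth_coind => {}f; elim=> {f}.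
- move=> f sf; split; [exact: smooth_continuous|exact: smooth_derivable|].
  by move=> e; apply: smooth_alg_base; exact: smooth_derive.
- move=> g f sg sf.
  have H x e := is_derive_comp_dir (smooth_derivable sg (f x) 1)
    (smooth_derivable sf x e).
  split=> [x|x e|e].
  - apply: continuous_comp; first exact: smooth_continuous.
    exact: smooth_continuous.
  - by have [] := H x e.
  - have -> : 'D_e (g \o f) = ('D_1 g \o f) * 'D_e f.
      by apply/funext => x; have [_ ->] := H x e.
    by apply: smooth_alg_mul; [apply: smooth_alg_comp|apply: smooth_alg_base];
      rewrite //; exact: smooth_derive.
- move=> f g Hf [cf df Df] Hg [cg dg Dg]; split=> [|x e|e].
  - exact: continuous_add.
  - exact: derivableD.
  - have -> : 'D_e (f + g) = 'D_e f + 'D_e g.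
      by apply/funext => x; exact: deriveD.
    exact: smooth_alg_add.
- move=> f g Hf [cf df Df] Hg [cg dg Dg]; split=> [|x e|e].
  - exact: continuous_mul.
  - exact: derivableM.
  - have -> : 'D_e (f * g) = f * 'D_e g + g * 'D_e f.
      by apply/funext => x; exact: deriveM.
    by apply: smooth_alg_add; exact: smooth_alg_mul.
Qed.

Lemma smooth_comp (g : R -> R) (f : V -> R) : smooth g -> smooth f ->
  smooth (fun x => g (f x)).
Proof. by move=> sg sf; exact/smooth_algP/smooth_alg_comp. Qed.

Lemma smooth_add (f g : V -> R) : smooth f -> smooth g ->
  smooth (fun x => f x + g x).
Proof. by move=> sf sg; apply/smooth_algP/smooth_alg_add; exact: smooth_alg_base. Qed.

Lemma smooth_mul (f g : V -> R) : smooth f -> smooth g ->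
  smooth (fun x => f x * g x).
Proof. by move=> sf sg; apply/smooth_algP/smooth_alg_mul; exact: smooth_alg_base. Qed.

Lemma smooth_sum (I : Type) (r : seq I) (f : I -> V -> R) :
  (forall i, smooth (f i)) -> smooth (fun x => \sum_(i <- r) f i x).
Proof.
move=> sf; elim: r => [|i r IH].
  by under eq_fun do rewrite big_nil; exact: smooth_cst.
by under eq_fun do rewrite big_cons; exact: smooth_add.
Qed.

Lemma smooth_prod (I : Type) (r : seq I) (f : I -> V -> R) :
  (forall i, smooth (f i)) -> smooth (fun x => \prod_(i <- r) f i x).
Proof.
move=> sf; elim: r => [|i r IH].
  by under eq_fun do rewrite big_nil; exact: smooth_cst.
by under eq_fun do rewrite big_cons; exact: smooth_mul.
Qed.

Lemma iter_derive_entry m n (f : V -> 'M[R]_(m, n)) s i j : smooth f ->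
  iter_derive s (fun x => f x i j) = fun x => iter_derive s f x i j.
Proof.
move=> sf; elim: s => //= e s ->; apply/funext => x.
rewrite [in RHS]derive_mx ?mxE//.
exact/smooth_derivable/smooth_iter_derive.
Qed.

Lemma derive_entry m n (f : V -> 'M[R]_(m, n)) e x i j : smooth f ->
  'D_e (fun y => f y i j) x = 'D_e f x i j.
Proof. by move=> sf; exact: (congr1 (@^~ x) (iter_derive_entry [:: e] i j sf)). Qed.

Lemma smooth_entry m n (f : V -> 'M[R]_(m, n)) i j : smooth f ->
  smooth (fun x => f x i j).
Proof.
move=> sf; apply/smoothP => s; rewrite iter_derive_entry//; split.
  move=> x e; move: i j; apply/derivable_mxP.
  exact/smooth_derivable/smooth_iter_derive.
exact/continuous_entry/smooth_continuous/smooth_iter_derive.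
Qed.

Lemma continuous_mx m n (f : V -> 'M[R]_(m, n)) :
  (forall i j, continuous (fun x => f x i j)) -> continuous f.
Proof.
move=> cf x; apply/cvgrPdist_le => e e0; near=> y.
apply: mx_norm_le => [|i j]; first exact: ltW.
rewrite !mxE; move: i j; near: y; apply: filter_forall => i.
apply: filter_forall => j.
by have /cvgrPdist_le/(_ e e0) := cf i j x.
Unshelve. all: by end_near. Qed.

Lemma smooth_mx m n (f : V -> 'M[R]_(m, n)) :
  (forall i j, smooth (fun x => f x i j)) -> smooth f.
Proof.
pose S (f : V -> 'M[R]_(m, n)) := forall i j, smooth (fun x => f x i j).
apply: (@smooth_coind _ _ _ S) => {}f Sf.
have df x e : derivable f x e.
  by apply/derivable_mxP => i j; exact: smooth_derivable.
split => //; first by apply: continuous_mx => i j; exact: smooth_continuous.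
move=> e i j.
have -> : (fun x => 'D_e f x i j) = 'D_e (fun x => f x i j).
  by apply/funext => x; rewrite derive_mx// mxE.
exact: smooth_derive.
Qed.

Lemma derive_comm (f : V -> R) a b : smooth f -> 'D_a ('D_b f) = 'D_b ('D_a f).
Proof.
move=> sf; apply/funext => x; have sa := smooth_derive a sf.
have sb := smooth_derive b sf.
have saa := smooth_continuous (smooth_derive b sa).
have sbb := smooth_continuous (smooth_derive a sb).
exact: (@schwarz_derive _ _ f b a x (fun y => smooth_derivable sf y b)
  (fun y => smooth_derivable sf y a) (fun y => smooth_derivable sb y a)
  (fun y => smooth_derivable sa y b) sbb saa).
Qed.

Lemma iter_derive_comm (f : V -> R) e s : smooth f ->
  iter_derive s ('D_e f) = 'D_e (iter_derive s f).
Proof.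
move=> sf; elim: s => //= a s ->.
exact/derive_comm/smooth_iter_derive.
Qed.

End smooth_algebra.

(** * Space-time functions and their time slices *)

Section slices.
Context {R : realType} {d : nat}.
Local Notation space := ('rV[R]_d).
Local Notation spacetime := (R * 'rV[R]_d)%type.

Definition space_dir (e : space) : spacetime := (0, e).
Definition time_dir : spacetime := (1, 0).

Lemma derive_time_slice (W : normedModType R) (f : spacetime -> W) t e :
  'D_e (time_slice f t) = time_slice ('D_(space_dir e) f) t.
Proof.
apply/funext => x; rewrite /time_slice /derive.
apply: (congr1 (fun g : R -> W => lim (g @ 0^'))); apply/funext => h /=.
by congr (_ *: (f _ - _)); congr pair; rewrite /= scaler0 add0r.
Qed.

Lemma iter_derive_time_slice (W : normedModType R) (f : spacetime -> W) t s :
  iter_derive s (time_slice f t) = time_slice (iter_derive (map space_dir s) f) t.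
Proof. by elim: s => //= e s ->; exact: derive_time_slice. Qed.

Lemma time_deriveE (W : normedModType R) (f : spacetime -> W) :
  time_derive f = 'D_time_dir f.
Proof.
apply/funext => -[t x]; rewrite /time_derive derive1E /derive.
apply: (congr1 (fun g : R -> W => lim (g @ 0^'))); apply/funext => h /=.
by congr (_ *: (f _ - _)); congr pair; rewrite /= scaler0 add0r.
Qed.

Lemma smooth_fst : smooth (fst : spacetime -> R).
Proof.
apply: (@affine_smooth _ _ _ fst) => //.
by move=> z; exact: cvg_fst.
Qed.

Lemma smooth_coord i : smooth (fun z : spacetime => z.2 0 i).
Proof.
apply: (@affine_smooth _ _ _ (fun z : spacetime => z.2 0 i)).
  apply: continuous_entry => z; exact: cvg_snd.
by move=> [t x] [s y] h /=; rewrite !mxE.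
Qed.

Lemma derive_shift_fun (V W : normedModType R) (f : V -> W) a e :
  'D_e (fun x => f (x + a)) = fun x => 'D_e f (x + a).
Proof.
apply/funext => x; rewrite /derive.
apply: (congr1 (fun g : R -> W => lim (g @ 0^'))); apply/funext => h /=.
by rewrite addrA.
Qed.

Lemma periodic_derive (W : normedModType R) (f : spacetime -> W) e :
  (forall t, Defs.periodic (time_slice f t)) ->
  forall t, Defs.periodic (time_slice ('D_e f) t).
Proof.
move=> pf t x i; rewrite /time_slice.
have E : f = (fun z => f (z + space_dir (basis_vec i))).
  apply/funext => -[s y]; have := pf s y i; rewrite /time_slice => <-.
  by congr f; congr pair; rewrite /= addr0.
have := congr1 (@^~ (t, x)) (derive_shift_fun f (space_dir (basis_vec i)) e).
rewrite /= -E => ->; congr ('D_e f _).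
by congr pair; rewrite /= addr0.
Qed.

Lemma smooth_spacetime_derive (W : normedModType R) (f : spacetime -> W) e :
  smooth_spacetime f -> smooth_spacetime ('D_e f).
Proof.
by move=> [sf pf]; split; [exact: smooth_derive|exact: periodic_derive].
Qed.

Lemma smooth_spacetime_iter_derive (W : normedModType R) (f : spacetime -> W) s :
  smooth_spacetime f -> smooth_spacetime (iter_derive s f).
Proof.
by move=> sf; elim: s => //= e s; exact: smooth_spacetime_derive.
Qed.

End slices.

Section operator.
Context {R : realType} {d n N : nat}.
Variable L : @diff_operator R d n N.
Local Notation spacetime := (R * 'rV[R]_d)%type.
Implicit Types Psi : spacetime -> 'M[R]_N.

Lemma op_sliceE Psi z l : op_slice L Psi z 0 l = \sum_(a <- terms L)
  mxdot (a.2 l) (iter_derive (map (@space_dir R d \o @basis_vec R d) a.1) Psi z).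
Proof.
rewrite /op_slice /apply_op mxE; apply: eq_bigr => a _.
rewrite /partials iter_derive_time_slice -map_comp.
by case: z.
Qed.

Lemma op_slice_entryE Psi : smooth Psi -> op_slice L Psi = fun z =>
  \row_l \sum_(a <- terms L) \sum_i \sum_j a.2 l i j *
    iter_derive (map (@space_dir R d \o @basis_vec R d) a.1)
      (fun z => Psi z i j) z.
Proof.
move=> sP; apply/funext => z; apply/rowP => l; rewrite op_sliceE mxE.
apply: eq_bigr => a _; apply: eq_bigr => i _; apply: eq_bigr => j _.
by rewrite iter_derive_entry.
Qed.

Lemma smooth_op_slice Psi : smooth_spacetime Psi -> smooth_spacetime (op_slice L Psi).
Proof.
move=> sP; split.
  rewrite op_slice_entryE; last by case: sP.
  apply: smooth_mx => k l.
  under eq_fun do rewrite mxE.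
  apply: smooth_sum => a; apply: smooth_sum => i; apply: smooth_sum => j.
  apply: smooth_mul; first exact: smooth_cst.
  by apply/smooth_iter_derive/smooth_entry; case: sP.
move=> t x i; apply/rowP => l; rewrite /time_slice !op_sliceE.
apply: eq_bigr => a _; congr mxdot.
have [_ ] := smooth_spacetime_iter_derive
  (map (@space_dir R d \o @basis_vec R d) a.1) sP.
exact.
Qed.

(** Symmetry of second derivatives, applied to each entry of Psi and moved through the list of space
    derivatives. *)
Lemma op_slice_time_derive Psi : smooth Psi ->
  op_slice L (time_derive Psi) = time_derive (op_slice L Psi).
Proof.
move=> sP; rewrite !time_deriveE.
rewrite (op_slice_entryE sP) (op_slice_entryE (smooth_derive time_dir sP)).
apply/funext => z.
rewrite derive_mx; last first.
  apply: smooth_derivable; apply: smooth_mx => k l.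
  under eq_fun do rewrite mxE.
  apply: smooth_sum => a; apply: smooth_sum => i; apply: smooth_sum => j.
  apply: smooth_mul; first exact: smooth_cst.
  exact/smooth_iter_derive/smooth_entry.
apply/rowP => l; rewrite !mxE.
under [in RHS]eq_fun do rewrite mxE.
have Dsum (I : Type) (r : seq I) (f : I -> spacetime -> R) :
    (forall i, smooth (f i)) ->
    'D_time_dir (fun z => \sum_(i <- r) f i z) z = \sum_(i <- r) 'D_time_dir (f i) z.
  move=> sf; elim: r => [|i r IH].
    under eq_fun do rewrite big_nil; rewrite big_nil; exact: derive_cst.
  under eq_fun do rewrite big_cons; rewrite big_cons -IH.
  by apply: deriveD; apply: smooth_derivable => //; exact: smooth_sum.
have sm (a : @diff_term R d n N) i j : smooth (fun z => a.2 l i j *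
    iter_derive (map (@space_dir R d \o @basis_vec R d) a.1)
      (fun z => Psi z i j) z).
  by apply: smooth_mul; [exact: smooth_cst|exact/smooth_iter_derive/smooth_entry].
rewrite Dsum; last by move=> a; do 2 apply: smooth_sum => ?.
apply: eq_bigr => a _.
rewrite Dsum; last by move=> i; apply: smooth_sum => ?.
apply: eq_bigr => i _.
rewrite Dsum//; apply: eq_bigr => j _.
have -> : (fun z => 'D_time_dir Psi z i j) = 'D_time_dir (fun z => Psi z i j).
  apply/funext => y; rewrite derive_mx ?mxE//; exact: smooth_derivable.
have sPij := smooth_entry i j sP.
rewrite iter_derive_comm//.
pose g := iter_derive (map (@space_dir R d \o @basis_vec R d) a.1) (fun z => Psi z i j).
have dg : derivable g z time_dir.
  by apply: smooth_derivable; exact: smooth_iter_derive.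
by have := deriveZ (a.2 l i j) dg => ->.
Qed.

(** On each time slice [th] is a constant, so this is linearity of the space derivatives. *)
Lemma op_slice_time_scale (th : R -> R) Psi : smooth Psi ->
  op_slice L (fun z => th z.1 *: Psi z) = fun z => th z.1 *: op_slice L Psi z.
Proof.
move=> sP; apply/funext => -[t x]; apply/rowP => l.
rewrite /op_slice /apply_op !mxE mulr_sumr; apply: eq_bigr => a _.
rewrite -mxdotZr; congr mxdot.
have -> : time_slice (fun z : spacetime => th z.1 *: Psi z) t =
   fun x => th t *: time_slice Psi t x by [].
rewrite /partials /=; elim: (map _ _) x => //= e s IH x.
rewrite (_ : iter_derive s (fun x => th t *: time_slice Psi t x) =
   th t \*: iter_derive s (time_slice Psi t)); last exact/funext.
apply: deriveZ; rewrite iter_derive_time_slice.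
have H := smooth_derivable (smooth_iter_derive (map space_dir s) sP) (t, x)
  (space_dir e).
apply/derivable_mxP => i j; move/derivable_mxP : H => /(_ i j).
rewrite /derivable; set g1 := (X in cvg (X @ _) -> _).
set g2 := (X in _ -> cvg (X @ _)); suff -> : g1 = g2 by [].
apply/funext => h; rewrite /g1 /g2 /= /time_slice.
have E : h *: space_dir e + (t, x) = (t, h *: e + x).
  by congr pair; rewrite /= scaler0 add0r.
by rewrite E.
Qed.

Lemma op_slice0 Psi t : (forall x, Psi (t, x) = 0) ->
  forall x, op_slice L Psi (t, x) = 0.
Proof.
move=> P0 x; apply/rowP => l; rewrite mxE /apply_op mxE big1// => a _.
have -> : time_slice Psi t = cst 0 by apply/funext.
rewrite /partials.
have -> : iter_derive (map (@basis_vec R d) a.1) (cst (0 : 'M[R]_N)) = cst 0.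
  elim: (map _ _) => //= e s ->; apply/funext => y; exact: derive_cst.
exact: mxdot0r.
Qed.

End operator.

(** * One-variable cutoffs *)

Section smooth_real_functions.
Context {R : realType}.
Implicit Types (f g : R -> R) (x c t lam T : R).

Lemma is_derive1_dir f (df x e : R) : is_derive x 1 f df ->
  derivable f x e /\ 'D_e f x = e * df.
Proof.
move=> [d1 d2]; have dd := (derivable1_diffP _ _).1 d1.
split; first exact: diff_derivable.
rewrite deriveE// -[X in 'd f x X](mulr1 e) [_ * 1](_ : _ = e *: 1)//.
by rewrite linearZ/= -deriveE// d2.
Qed.

(** [smooth] tests every direction e of the line, and D_e f = e f'; this is why the class must also
    be stable under scalar multiples. *)
Lemma smooth1_coind (S : set (R -> R)) :
  (forall f, S f -> exists2 g, S g & forall x, is_derive x 1 f (g x)) ->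
  (forall f c, S f -> S (fun x => c * f x)) ->
  forall f, S f -> smooth f.
Proof.
move=> HS Sc; apply: smooth_coind => f /HS[g Sg fg]; split.
- move=> x; have [d1 _] := fg x.
  exact/differentiable_continuous/derivable1_diffP.
- by move=> x e; have [] := is_derive1_dir e (fg x).
- move=> e; rewrite (_ : 'D_e f = fun x => e * g x); first exact: Sc.
  by apply/funext => x; have [] := is_derive1_dir e (fg x).
Qed.

Lemma smooth_affine (a b : R) : smooth (fun x => a * x + b).
Proof.
apply: (@affine_smooth _ _ _ (fun x => a * x)).
  apply: continuous_add; last exact: cst_continuous.
  by apply: continuous_mul; [exact: cst_continuous|move=> x; exact: cvg_id].
by move=> x e h; rewrite mulrDr -addrA; congr (_ + _); exact: mulrCA.
Qed.

Lemma is_derive_affine (a b x : R) : is_derive x 1 (fun x => a * x + b) a.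
Proof. by apply: is_derive_eq; rewrite addr0 [a *: _]mulr1. Qed.

Lemma is_derive_expR_scale (b x : R) :
  is_derive x 1 (fun x => expR (b * x)) (b * expR (b * x)).
Proof.
have Haff : is_derive x 1 (fun x => b * x) b.
  by apply: is_derive_eq; rewrite [b *: _]mulr1.
have [H1 H2] := is_derive1_comp (is_derive_expR (b * x)) Haff.
by split; [exact: H1|apply: etrans H2 _; exact: mulrC].
Qed.

Lemma smooth_expR (b : R) : smooth (fun x => expR (b * x)).
Proof.
pose S (f : R -> R) := exists a, f = fun x => a * expR (b * x).
apply: (@smooth1_coind S); last by exists 1; apply/funext => x; rewrite mul1r.
- move=> _ [a ->]; exists (fun x => a * b * expR (b * x)); first by exists (a * b).
  move=> x; have [H1 H2] := is_deriveZ a (is_derive_expR_scale b x).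
  by split; [exact: H1|apply: etrans H2 _; exact: mulrA].
- by move=> _ c [a ->]; exists (c * a); apply/funext => x; rewrite mulrA.
Qed.

Lemma smooth_cos (b c : R) : smooth (fun x => cos (b * x + c)).
Proof.
pose S (f : R -> R) := exists a a',
  f = fun x => a * cos (b * x + c) + a' * sin (b * x + c).
apply: (@smooth1_coind S); last first.
    by exists 1, 0; apply/funext => x; rewrite mul1r mul0r addr0.
- by move=> _ e [a [a' ->]]; exists (e * a), (e * a'); apply/funext => x; ring.
- move=> _ [a [a' ->]]; exists (fun x => a' * b * cos (b * x + c) +
    (- (a * b)) * sin (b * x + c)); first by exists (a' * b), (- (a * b)).
  move=> x; have Haff := is_derive_affine b c x.
  have Hc := @is_derive1_comp _ cos (fun x => b * x + c) x _ _
    (is_derive_cos (b * x + c)) Haff.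
  have Hs := @is_derive1_comp _ sin (fun x => b * x + c) x _ _
    (is_derive_sin (b * x + c)) Haff.
  have H1 := is_deriveZ a Hc; have H2 := is_deriveZ a' Hs.
  have [H3 H4] := is_deriveD H1 H2; split; first exact: H3.
  by apply: etrans H4 _; rewrite -![_ *: _]/(_ * _); ring.
Qed.

(** For k > 0, raise x / k <= exp(x / k) to the power k. *)
Lemma expr_le_expR (k : nat) x : 0 <= x -> x ^+ k <= k%:R ^+ k * expR x.
Proof.
case: k => [|k] x0; first by rewrite !expr0 mul1r -[leLHS]expR0 ler_expR.
have k0 : 0 < (k.+1%:R : R) by [].
have -> : x ^+ k.+1 = k.+1%:R ^+ k.+1 * (x / k.+1%:R) ^+ k.+1.
  by rewrite -exprMn mulrCA divff ?mulr1// gt_eqF.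
rewrite ler_wpM2l ?exprn_ge0//.
have -> : expR x = expR (x / k.+1%:R) ^+ k.+1.
  by rewrite -expRM_natr divfK// gt_eqF.
rewrite lerXn2r ?nnegrE ?divr_ge0 ?expR_ge0//.
by rewrite (le_trans _ (expR_ge1Dx _))// lerDr.
Qed.

(** The functions p(1/x) exp(-1/x), extended by 0, form a class stable under differentiation that
    contains the standard flat function exp(-1/x). *)
Definition flat (p : {poly R}) (x : R) : R :=
  if 0 < x then p.[x^-1] * expR (- x^-1) else 0.

(** Put y = 1/x >= 1 and let m be the size of p: |p(y)| <= A y^m, and y^(m+2) exp(-y) is bounded,
    which leaves a factor y^-2 = x^2. Quadratic decay makes the derivative at 0 vanish. *)
Lemma flat_quadratic (p : {poly R}) : exists2 C, 0 <= C &
  forall x, x <= 1 -> `|flat p x| <= C * x ^+ 2.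
Proof.
pose m := size p; pose A := \sum_(i < m) `|p`_i|.
have A0 : 0 <= A by exact: sumr_ge0.
exists (A * (m + 2)%:R ^+ (m + 2)) => [|x x1]; first by rewrite mulr_ge0// exprn_ge0.
rewrite /flat; case: ltP => x0; last first.
  by rewrite normr0 mulr_ge0 ?sqr_ge0// mulr_ge0// exprn_ge0.
set y := x^-1; have y1 : 1 <= y by rewrite -invr1 lef_pV2 ?posrE.
have y0 : 0 < y by rewrite (lt_le_trans _ y1).
have py : `|p.[y]| <= A * y ^+ m.
  rewrite horner_coef (le_trans (ler_norm_sum _ _ _))// mulr_suml ler_sum// => i _.
  rewrite normrM ler_wpM2l// ger0_norm ?exprn_ge0 ?(ltW y0)//.
  by rewrite ler_weXn2l// ltnW.
rewrite normrM (gtr0_norm (expR_gt0 _)).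
apply: (@le_trans _ _ (A * y ^+ m * expR (- y))).
  by rewrite ler_wpM2r// expR_ge0.
rewrite -!mulrA ler_wpM2l//.
rewrite -(ler_pM2r (expR_gt0 y)) -mulrA -expRD addNr expR0 mulr1.
have -> : y ^+ m = y ^+ (m + 2) * x ^+ 2.
  by rewrite exprD -mulrA -exprMn /y mulVf ?gt_eqF// expr1n mulr1.
by rewrite mulrAC ler_wpM2r ?sqr_ge0// expr_le_expR// ltW.
Qed.

(** With y = 1/x one has dy/dx = - y^2, and the derivative of p(y) exp(-y) in y is (p' - p)(y)
    exp(-y). *)
Definition dflat (p : {poly R}) : {poly R} := (p - p^`()) * 'X^2.

Lemma is_derive_flat p x : is_derive x 1 (flat p) (flat (dflat p) x).
Proof.
have [x0|x0|->] := ltgtP x 0.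
- apply: (near_eq_is_derive (f := cst 0)).
    near=> y; rewrite /flat ltNge ltW//; near: y; exact: lt_nbhsl.
  by rewrite /flat ltNge ltW//; exact: is_derive_cst.
- apply: (@near_eq_is_derive _ _ _ (fun y : R => p.[y^-1] * expR (- y^-1))).
    near=> y; rewrite /flat (_ : 0 < y)//; near: y; exact: lt_nbhsr.
  rewrite /flat x0 /dflat.
  have Hinv : is_derive x 1 (fun y : R => y^-1) (- x ^- 2).
    have [H1 H2] := is_deriveV (lt0r_neq0 x0) (is_derive_id x (1 : R)).
    by split; [exact: H1|apply: etrans H2 _; exact: mulr1].
  have Hp : is_derive x^-1 1 (horner p) (p^`()).[x^-1].
    split; first exact: derivable_horner.
    by rewrite -derive1E derivE.
  have Hpi := @is_derive1_comp _ (horner p) (fun y => y^-1) x _ _ Hp Hinv.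
  have Hn := is_deriveN Hinv.
  have He := @is_derive1_comp _ expR (fun y => - y^-1) x _ _
    (is_derive_expR _) Hn.
  have [H1 H2] := is_deriveM Hpi He; split; first exact: H1.
  apply: etrans H2 _.
  rewrite hornerM hornerXn hornerD hornerN -![_ *: _]/(_ * _) /= exprVn.
  by ring.
- have [C C0 HC] := flat_quadratic p.
  have f0 q : flat q 0 = 0 by rewrite /flat ltxx.
  have H : (h^-1 *: ((flat p \o shift 0) (h *: 1) - flat p 0)) @[h --> 0^'] --> (0 : R).
    apply/cvgr0Pnorm_le => e e0; near=> h.
    have h0 : h != 0 by near: h; exact: nbhs_dnbhs_neq.
    have h1 : `|h| <= 1 by near: h; apply: dnbhs0_le.
    have he : `|h| <= e / (C + 1).
      by near: h; apply: dnbhs0_le; rewrite divr_gt0// ltr_wpDl.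
    rewrite /= f0 subr0 addr0 [h *: 1]mulr1 normrM normfV.
    rewrite ler_pdivrMl ?normr_gt0// (le_trans (HC _ _))//.
      exact: le_trans (ler_norm _) h1.
    rewrite -real_normK ?num_real// expr2 mulrCA ler_wpM2l//.
    rewrite ler_pdivlMr ?ltr_wpDl// in he; rewrite (le_trans _ he)// mulrC.
    by rewrite ler_wpM2l// lerDl.
  rewrite f0; split; first by apply/cvg_ex; exists 0.
  exact: cvg_lim H.
Unshelve. all: by end_near. Qed.

Lemma flat_smooth p : smooth (flat p).
Proof.
pose S (f : R -> R) := exists p, f = flat p.
apply: (@smooth1_coind S); last by exists p.
- move=> _ [q ->]; exists (flat (dflat q)); first by exists (dflat q).
  exact: is_derive_flat.
- move=> _ c [q ->]; exists (c *: q); apply/funext => x; rewrite /flat.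
  by case: ifP; rewrite ?mulr0// hornerZ mulrA.
Qed.

Definition rho : R -> R := flat 1.

Definition drho : R -> R := flat 'X^2.

Lemma rhoE x : rho x = if 0 < x then expR (- x^-1) else 0.
Proof. by rewrite /rho /flat; case: ifP; rewrite ?hornerC ?mul1r. Qed.

Lemma drhoE x : drho x = if 0 < x then x ^- 2 * expR (- x^-1) else 0.
Proof. by rewrite /drho /flat; case: ifP; rewrite ?hornerXn ?exprVn. Qed.

Lemma rho_smooth : smooth rho. Proof. exact: flat_smooth. Qed.

Lemma is_derive_rho x : is_derive x 1 rho (drho x).
Proof.
have := is_derive_flat 1 x; rewrite /dflat /drho.
by rewrite (_ : (1 : {poly R})^`() = 0) ?derivC// subr0 mul1r.
Qed.

Lemma rho_ge0 x : 0 <= rho x.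
Proof. by rewrite rhoE; case: ifP; rewrite ?expR_ge0. Qed.

Lemma rho_gt0 x : 0 < x -> 0 < rho x.
Proof. by rewrite rhoE => ->; exact: expR_gt0. Qed.

Lemma rho_le1 x : rho x <= 1.
Proof.
rewrite rhoE; case: ifP => // x0.
by rewrite -[leRHS]expR0 ler_expR oppr_le0 invr_ge0 ltW.
Qed.

Lemma rho_eq0 x : x <= 0 -> rho x = 0.
Proof. by rewrite rhoE leNgt => /negbTE ->. Qed.

Lemma drho_ge0 x : 0 <= drho x.
Proof.
by rewrite drhoE; case: ifP => // _; rewrite mulr_ge0 ?expR_ge0// invr_ge0 sqr_ge0.
Qed.

Lemma drho_eq0 x : x <= 0 -> drho x = 0.
Proof. by rewrite drhoE leNgt => /negbTE ->. Qed.

(** The constant is 2^2, from y^2 <= 2^2 exp(y) at y = 1/x. *)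
Lemma drho_le x : drho x <= 4.
Proof.
rewrite drhoE; case: ifP => // x0.
rewrite -(ler_pM2r (expR_gt0 x^-1)) -mulrA -expRD addNr expR0 mulr1 -exprVn.
have x1 : 0 <= x^-1 by rewrite invr_ge0 ltW.
by have := expr_le_expR 2 x1; rewrite -natrX.
Qed.

Lemma cvg_rho_scale x : rho (k.+1%:R * x) @[k --> \oo] --> ((0 < x)%R%:R : R).
Proof.
have [x0|x0] := ltP 0 x; last first.
  by apply: cvg_near_cst; near=> k; rewrite rho_eq0// mulr_ge0_le0.
have -> : (fun k : nat => rho (k.+1%:R * x)) =
    (fun k : nat => expR (- (k.+1%:R^-1 * x^-1))).
  by apply/funext => k; rewrite rhoE mulr_gt0// invfM.
rewrite /= mulr1n -[X in _ --> X]expR0.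
have H : - (k.+1%:R^-1 * x^-1) @[k --> \oo] --> (0 : R); last first.
  exact: (cvg_comp _ _ H (@continuous_expR R 0)).
rewrite -[X in _ --> X]oppr0; apply: cvgN.
rewrite -[X in _ --> X](mul0r x^-1); apply: cvgM; last exact: cvg_cst.
exact: cvg_harmonic.
Unshelve. all: by end_near. Qed.

Lemma nbhs_infty_ger_S (r : R) : \forall k \near \oo, r <= k.+1%:R.
Proof.
near=> k; apply: (@le_trans _ _ k%:R); last by rewrite ler_nat.
by near: k; exact: nbhs_infty_ger.
Unshelve. all: by end_near. Qed.

(** When s is the argument of [drho] in [deta k t], the factor s + 1 is (k + 1) t, so the left side
    is t times [deta k t]. *)
Lemma mulS_drho_le (s : R) : 0 < s -> (s + 1) * drho s <= s^-1 + s^-1 ^+ 2.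
Proof.
move=> s0; rewrite drhoE s0 mulrA -exprVn.
have -> : (s + 1) * s^-1 ^+ 2 = s^-1 + s^-1 ^+ 2.
  by rewrite mulrDl mul1r expr2 mulrA divff ?mul1r// gt_eqF.
rewrite ger_pMr; last by rewrite addr_gt0 ?exprn_gt0 ?invr_gt0.
by rewrite -[leRHS]expR0 ler_expR oppr_le0 invr_ge0 ltW.
Qed.

(* A cutoff near the initial time: it vanishes for [t <= 1 / (k + 1)], tends to
   1 for [t > 0], and [t * deta k t] stays bounded. *)
Definition eta (k : nat) (t : R) : R := rho (k.+1%:R * t + -1).

Definition deta (k : nat) (t : R) : R := k.+1%:R * drho (k.+1%:R * t + -1).

Lemma eta_smooth k : smooth (eta k).
Proof. by apply: smooth_comp; [exact: rho_smooth|exact: smooth_affine]. Qed.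

Lemma is_derive_eta k (t : R) : is_derive t (1 : R) (eta k) (deta k t).
Proof.
have [H1 H2] := @is_derive1_comp _ rho (fun t => k.+1%:R * t + -1) t _ _
  (is_derive_rho _) (is_derive_affine k.+1%:R (-1) t).
by split; [exact: H1|apply: etrans H2 _; exact: mulrC].
Qed.

Lemma eta_arg_le0 k t : t <= k.+1%:R^-1 -> k.+1%:R * t + -1 <= 0.
Proof. by move=> tk; rewrite subr_le0 -ler_pdivlMl// mulr1. Qed.

Lemma eta_eq0 k t : t <= k.+1%:R^-1 -> eta k t = 0.
Proof. by move=> /eta_arg_le0; exact: rho_eq0. Qed.

Lemma deta_eq0 k t : t <= k.+1%:R^-1 -> deta k t = 0.
Proof. by move=> /eta_arg_le0 tk; rewrite /deta drho_eq0// mulr0. Qed.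

Lemma eta_bound k t : `|eta k t| <= 1.
Proof. by rewrite ger0_norm ?rho_le1// rho_ge0. Qed.

(** Where it is nonzero, the product equals (y + y^2) exp(-y) with y = 1/s and s = (k + 1) t - 1;
    then y <= exp(y) and y^2 <= 4 exp(y) give 1 + 4. *)
Lemma deta_bound k t : `|t * deta k t| <= 5.
Proof.
have [s0|s0] := ltP 0 (k.+1%:R * t + -1); last first.
  by rewrite /deta drho_eq0// !mulr0 normr0.
have t0 : 0 < t by rewrite -(pmulr_rgt0 _ (ltr0Sn R k)) (lt_trans ltr01)// -subr_gt0.
rewrite ger0_norm ?mulr_ge0 ?drho_ge0 ?(ltW t0)//.
rewrite /deta mulrCA mulrA; set s := _ + -1 in s0 *.
have -> : k.+1%:R * t = s + 1 by rewrite /s subrK.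
rewrite drhoE s0 mulrA -exprVn.
have -> : (s + 1) * s^-1 ^+ 2 = s^-1 + s^-1 ^+ 2.
  by rewrite mulrDl mul1r expr2 mulrA divff ?mul1r// gt_eqF.
rewrite -(ler_pM2r (expR_gt0 s^-1)) -mulrA -expRD addNr expR0 mulr1.
have y0 : 0 <= s^-1 by rewrite invr_ge0 ltW.
have := expr_le_expR 2 y0; have := expr_le_expR 1 y0.
rewrite !expr1 mul1r -natrX (_ : (2 ^ 2)%N = 4%N)//; lra.
Qed.

Lemma cvg_eta t : 0 < t -> eta k t @[k --> \oo] --> (1 : R).
Proof.
move=> t0; rewrite /eta; apply/cvgrPdist_le => e e0.
have := @cvg_rho_scale (t / 2); rewrite divr_gt0//= => /cvgrPdist_le/(_ e e0) H.
(* Once (k + 1) t >= 2, the argument (k + 1) t - 1 is at least (k + 1) t / 2, so [eta k t] lies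
   between [rho] at the latter point and 1. *)
near=> k.
have k2 : 2 <= k.+1%:R * t.
  rewrite -ler_pdivrMr//; near: k; exact: nbhs_infty_ger_S.
have h : `|1 - rho (k.+1%:R * (t / 2))| <= e by near: k; exact: H.
rewrite ger0_norm ?subr_ge0 ?rho_le1//.
rewrite ger0_norm ?subr_ge0 ?rho_le1// in h.
apply: le_trans h; rewrite lerD2l lerN2 !rhoE mulr_gt0 ?divr_gt0//.
have s0 : 0 < k.+1%:R * t + -1 by rewrite subr_gt0 (lt_le_trans _ k2)// ltr1n.
rewrite s0 ler_expR lerN2 lef_pV2 ?posrE ?mulr_gt0 ?divr_gt0//.
by rewrite mulrA; lra.
Unshelve. all: by end_near. Qed.

(** Let s = (k + 1) t - 1. Once (k + 1) t >= 2 one has s >= 1 and s >= (k + 1) t / 2, so t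
    [deta k t] <= 1/s + 1/s^2 <= 2/s <= 4 / ((k + 1) t). *)
Lemma cvg_deta t : 0 < t -> deta k t @[k --> \oo] --> (0 : R).
Proof.
move=> t0; apply: (@squeeze_cvgr _ _ _ _ (fun=> 0)
    (fun k => (4 / t / t) * k.+1%:R^-1)).
- near=> k; apply/andP; split; first by rewrite mulr_ge0 ?drho_ge0.
  have k2 : 2 <= k.+1%:R * t.
    rewrite -ler_pdivrMr//; near: k; exact: nbhs_infty_ger_S.
  rewrite /deta; set s := _ + -1.
  have s1 : 1 <= s by rewrite /s; lra.
  have s0 : 0 < s by rewrite (lt_le_trans _ s1).
  have := mulS_drho_le s0; have -> : s + 1 = k.+1%:R * t by rewrite /s subrK.
  have y1 : s^-1 <= 1 by rewrite invf_le1.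
  have y0 : 0 < s^-1 by rewrite invr_gt0.
  have y2 : s^-1 ^+ 2 <= s^-1 by rewrite expr2 ger_pMr.
  have y3 : s^-1 <= 2 / t * k.+1%:R^-1.
    rewrite -mulrA -invfM -[2]invrK -invfM lef_pV2 ?posrE//.
      by rewrite /s (mulrC t); lra.
    by rewrite mulr_gt0// ?mulr_gt0.
  rewrite mulrAC -ler_pdivlMr// => /le_trans; apply.
  rewrite mulrAC ler_pM2r ?invr_gt0//.
  have : 4 / t * k.+1%:R^-1 = 2 * (2 / t * k.+1%:R^-1).
    by rewrite !mulrA -natrM.
  set a := 4 / t * _; set b := 2 / t * _ in y3 *; lra.
- exact: cvg_cst.
- rewrite -[X in _ --> X](mulr0 (4 / t / t)); apply: cvgM; first exact: cvg_cst.
  exact: cvg_harmonic.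
Unshelve. all: by end_near. Qed.

(* The time weight of the relative-entropy argument: [- dchi] dominates
   [lam * chi], and both vanish from the time [T] on. *)
Definition chi (lam T t : R) : R := expR (- lam * t) * rho (-1 * t + T).

Definition dchi (lam T t : R) : R :=
  - (lam * chi lam T t + expR (- lam * t) * drho (-1 * t + T)).

Lemma chi_smooth lam T : smooth (chi lam T).
Proof.
apply: smooth_mul; first exact: smooth_expR.
by apply: smooth_comp; [exact: rho_smooth|exact: smooth_affine].
Qed.

Lemma is_derive_chi lam T (t : R) : is_derive t (1 : R) (chi lam T) (dchi lam T t).
Proof.
have Hr := @is_derive1_comp _ rho (fun t => -1 * t + T) t _ _
  (is_derive_rho _) (is_derive_affine (-1) T t).
have [H1 H2] := is_deriveM (is_derive_expR_scale (- lam) t) Hr.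
split; first exact: H1.
by apply: etrans H2 _; rewrite /dchi /chi -![_ *: _]/(_ * _) /=; ring.
Qed.

Lemma chi_eq0 lam T t : T <= t -> chi lam T t = 0.
Proof. by move=> Tt; rewrite /chi rho_eq0 ?mulr0// mulN1r addrC subr_le0. Qed.

Lemma dchi_eq0 lam T t : T <= t -> dchi lam T t = 0.
Proof.
move=> Tt; rewrite /dchi chi_eq0// drho_eq0 ?mulr0 ?addr0 ?oppr0//.
by rewrite mulN1r addrC subr_le0.
Qed.

Lemma chi_ge0 lam T t : 0 <= chi lam T t.
Proof. by rewrite mulr_ge0 ?expR_ge0 ?rho_ge0. Qed.

Lemma chi_le1 lam T t : 0 <= lam -> 0 <= t -> chi lam T t <= 1.
Proof.
move=> l0 t0; rewrite /chi -[leRHS]mulr1 ler_pM ?expR_ge0 ?rho_ge0 ?rho_le1//.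
by rewrite -[leRHS]expR0 ler_expR mulNr oppr_le0 mulr_ge0.
Qed.

Lemma lam_chi_le lam T t : lam * chi lam T t <= - dchi lam T t.
Proof. by rewrite opprK lerDl mulr_ge0 ?expR_ge0 ?drho_ge0. Qed.

Lemma dchi_le0 lam T t : 0 <= lam -> dchi lam T t <= 0.
Proof.
by move=> l0; rewrite -oppr_ge0 (le_trans _ (lam_chi_le _ _ _))// mulr_ge0 ?chi_ge0.
Qed.

Lemma dchi_lt0 lam T t : 0 < lam -> t < T -> dchi lam T t < 0.
Proof.
move=> l0 tT; rewrite -oppr_gt0 (lt_le_trans _ (lam_chi_le _ _ _))//.
by rewrite !mulr_gt0 ?expR_gt0// rho_gt0// mulN1r addrC subr_gt0.
Qed.

Lemma dchi_bound lam T t : 0 <= lam -> 0 <= t -> `|dchi lam T t| <= lam + 4.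
Proof.
move=> l0 t0; rewrite normrN ger0_norm; last first.
  by rewrite addr_ge0// mulr_ge0 ?chi_ge0 ?expR_ge0 ?drho_ge0.
rewrite lerD ?ler_piMr ?chi_le1// -[leRHS]mul1r ler_pM ?expR_ge0 ?drho_ge0 ?drho_le//.
by rewrite -[leRHS]expR0 ler_expR mulNr oppr_le0 mulr_ge0.
Qed.

End smooth_real_functions.

(** * Integration on space-time *)

Section almost_everywhere_theory.
Context {R : realType} dsp {X : measurableType dsp}.
Variable mu : {measure set X -> \bar R}.
Implicit Types P Q S : X -> Prop.

Lemma ae_imply P Q : {ae mu, forall x, P x} -> (forall x, P x -> Q x) ->
  {ae mu, forall x, Q x}.
Proof. by move=> aeP PQ; apply: filterS aeP. Qed.

Lemma ae_imply2 P Q S : {ae mu, forall x, P x} -> {ae mu, forall x, Q x} ->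
  (forall x, P x -> Q x -> S x) -> {ae mu, forall x, S x}.
Proof. by move=> aeP aeQ PQS; apply: filterS2 aeP aeQ. Qed.

Lemma ae_forall (I : finType) (P : I -> X -> Prop) :
  (forall i, {ae mu, forall x, P i x}) -> {ae mu, forall x, forall i, P i x}.
Proof. by move=> aeP; apply: filter_forall. Qed.

End almost_everywhere_theory.

Section real_integration.
Context {R : realType} dsp {X : measurableType dsp}.
Variables (mu : {measure set X -> \bar R}) (D : set X).
Hypothesis mD : measurable D.
Implicit Types f g : X -> R.

Lemma dominated_convergence_R (f_ : nat -> X -> R) f g :
  (forall k, measurable_fun D (f_ k)) -> measurable_fun D f ->
  {ae mu, forall x, D x -> f_ k x @[k --> \oo] --> f x} ->
  mu.-integrable D (EFin \o g) ->
  {ae mu, forall x, D x -> forall k, `|f_ k x| <= g x} ->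
  mu.-integrable D (EFin \o f) /\
  \int[mu]_(x in D) f_ k x @[k --> \oo] --> \int[mu]_(x in D) f x.
Proof.
move=> mf_ mf ff ig fg.
have mf_' k : measurable_fun D (EFin \o f_ k) by exact/measurable_EFinP.
have mf' : measurable_fun D (EFin \o f) by exact/measurable_EFinP.
have ff' : {ae mu, forall x, D x -> (EFin \o f_ k) x @[k --> \oo] --> (EFin \o f) x}.
  apply: filterS ff => x H Dx; apply: cvg_EFin; first exact: nearW.
  exact: H.
have fg' : {ae mu, forall x k, D x -> `|(EFin \o f_ k) x| <= (EFin \o g) x}%E.
  by apply: filterS fg => x H k Dx; rewrite /= lee_fin H.
have [H1 _ H2] := dominated_convergence mD mf_' mf' ff' ig fg'.
split; first exact: H1.
apply: fine_cvg; rewrite fineK; first exact: H2.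
exact: integrable_fin_num.
Qed.

(** Dominated convergence for a constant sequence, which lets the bound hold only almost
    everywhere. *)
Lemma integrable_dominated f g : measurable_fun D f ->
  mu.-integrable D (EFin \o g) -> {ae mu, forall x, D x -> `|f x| <= g x} ->
  mu.-integrable D (EFin \o f).
Proof.
move=> mf ig fg.
have ff : {ae mu, forall x, D x -> f x @[_ --> \oo] --> f x}.
  by apply/aeW => x Dx; exact: cvg_cst.
have fg' : {ae mu, forall x, D x -> forall _ : nat, `|f x| <= g x}.
  by apply: filterS fg => x H Dx _; exact: H.
by have [] := @dominated_convergence_R (fun=> f) f g (fun=> mf) mf ff ig fg'.
Qed.

Lemma integrableD_R f g : mu.-integrable D (EFin \o f) ->
  mu.-integrable D (EFin \o g) -> mu.-integrable D (EFin \o (fun x => f x + g x)).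
Proof.
move=> fi gi; have := integrableD mD fi gi.
by apply: eq_integrable.
Qed.

Lemma integrableB_R f g : mu.-integrable D (EFin \o f) ->
  mu.-integrable D (EFin \o g) -> mu.-integrable D (EFin \o (fun x => f x - g x)).
Proof.
move=> fi gi; have := integrableB mD fi gi.
by apply: eq_integrable.
Qed.

Lemma integrableZ_R (c : R) f : mu.-integrable D (EFin \o f) ->
  mu.-integrable D (EFin \o (fun x => c * f x)).
Proof. by move=> fi; have := integrableZl mD c fi; apply: eq_integrable. Qed.

Lemma integrable_sum_R (I : Type) (s : seq I) (f : I -> X -> R) :
  (forall i, mu.-integrable D (EFin \o f i)) ->
  mu.-integrable D (EFin \o (fun x => \sum_(i <- s) f i x)).
Proof.
move=> fi; elim: s => [|i s IH].
  apply: (eq_integrable mD (cst 0%E)); last exact: integrable0.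
  by move=> x _; rewrite /= big_nil.
apply: (eq_integrable mD (EFin \o (fun x => f i x + \sum_(i <- s) f i x))).
  by move=> x _; rewrite /= big_cons.
exact: integrableD_R.
Qed.

Lemma ae_eq_Rintegral f g : measurable_fun D f -> measurable_fun D g ->
  {ae mu, forall x, D x -> f x = g x} ->
  \int[mu]_(x in D) f x = \int[mu]_(x in D) g x.
Proof.
move=> mf mg fg; congr fine; apply: ae_eq_integral => //.
- exact/measurable_EFinP.
- exact/measurable_EFinP.
- by apply: filterS fg => x H Dx /=; rewrite H.
Qed.

Lemma Rintegral_le0_ae f : mu.-integrable D (EFin \o f) ->
  {ae mu, forall x, D x -> 0 <= f x} -> \int[mu]_(x in D) f x <= 0 ->
  {ae mu, forall x, D x -> f x = 0}.
Proof.
move=> fi f0 If.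
have mf : measurable_fun D (EFin \o f) by exact: measurable_int fi.
have : ae_eq mu D (EFin \o f) (cst 0%E).
  apply/ae_eq_integral_abs => //.
  rewrite [LHS](_ : _ = \int[mu]_(x in D) (f x)%:E)%E; last first.
    apply: ae_eq_integral => //; first exact: measurableT_comp.
    by apply: filterS f0 => x H Dx /=; rewrite ger0_norm// H.
  have Ifin : (\int[mu]_(x in D) (f x)%:E)%E \is a fin_num.
    exact: integrable_fin_num.
  have I0 : (0 <= \int[mu]_(x in D) (f x)%:E)%E.
    rewrite [leRHS](_ : _ = \int[mu]_(x in D) `|(f x)%:E|)%E; last first.
      apply: ae_eq_integral => //; first exact: measurableT_comp.
      by apply: filterS f0 => x H Dx /=; rewrite ger0_norm// H.
    by apply: integral_ge0.
  apply/eqP; rewrite eq_le I0 andbT -(fineK Ifin) lee_fin; exact: If.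
by apply: filterS => x H Dx; have := H Dx => -[].
Qed.

Lemma ge0_integrable_R f : measurable_fun D f -> (forall x, D x -> 0 <= f x) ->
  (\int[mu]_(x in D) (f x)%:E < +oo)%E -> mu.-integrable D (EFin \o f).
Proof.
move=> mf f0 If; apply/integrableP; split; first exact/measurable_EFinP.
rewrite (eq_integral (fun x => (f x)%:E))// => x; rewrite inE => Dx /=.
by rewrite ger0_norm// f0.
Qed.

End real_integration.

Section spacetime_integration.
Context {R : realType} {d : nat}.
Local Notation leb := (@lebesgue_measure R).
Local Notation mu := (@spacetime_measure R d).
Local Notation spacetime := (measurableTypeR R * 'rV[R]_d)%type.
Local Notation cyl := (@cylinder R d).

Lemma measurable_cylinder a b : measurable (cyl a b : set spacetime).
Proof. by apply: measurableX => //; exact: measurable_itv. Qed.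

Lemma cylinder_measure a b : a <= b -> mu (cyl a b) = (b - a)%:E.
Proof.
move=> ab; have -> : mu (cyl a b) = (leb `]a, b[ * torus d setT)%E.
  by apply: product_measure1E.
rewrite probability_setT mule1.
by rewrite [LHS]lebesgue_measure_itv/= lte_fin; case: ltgtP ab => // ->; rewrite subrr.
Qed.

Lemma integrable_cst_cylinder a b (c : R) : mu.-integrable (cyl a b) (EFin \o cst c).
Proof.
have [ab|ba] := leP a b; last first.
  rewrite (_ : cyl a b = set0); first exact: integrable_set0.
  apply/seteqP; split => // -[t x] [/=]; rewrite in_itv/= => /andP[at_ tb] _.
  by have := lt_trans at_ tb; rewrite ltNge (ltW ba).
apply/integrableP; split; first by apply/measurable_EFinP; exact: measurable_cst.
rewrite [ltLHS](_ : _ = \int[mu]_(z in cyl a b) (`|c|)%:E)%E//.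
rewrite integral_cst; last exact: measurable_cylinder.
by rewrite [mu _]cylinder_measure//= -EFinM ltry.
Qed.

(** The notions of solution are written with iterated real integrals; this form of Fubini moves them
    to space-time, where all estimates are made. *)
Lemma integral_slices a b (f : R * 'rV[R]_d -> R) :
  mu.-integrable (cyl a b) (EFin \o f) ->
  leb.-integrable `]a, b[ (EFin \o (fun t => \int[torus d]_x f (t, x))) /\
  \int[leb]_(t in `]a, b[) \int[torus d]_x f (t, x) =
    \int[mu]_(z in cyl a b) f z.
Proof.
move=> fi; have mC := measurable_cylinder a b.
pose g : spacetime -> \bar R := (EFin \o f) \_ (cyl a b).
have ig : (leb \x torus d)%E.-integrable setT g.
  exact: ((integrable_mkcond _ mC).1 fi).
have iF := integrable_fubini_F ig.
have gE (t : R) : `]a, b[%classic t -> forall x, g (t, x) = (f (t, x))%:E.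
  by move=> tab x; rewrite /g patchE mem_set.
have FE (t : R) : `]a, b[%classic t ->
    \int[torus d]_x f (t, x) = fine (fubini_F (torus d) g t).
  move=> tab; rewrite /Rintegral /fubini_F; congr fine; apply: eq_integral => x _.
  by rewrite gE.
have F0 (t : R) : ~ `]a, b[%classic t -> fubini_F (torus d) g t = 0%E.
  move=> tab; rewrite /fubini_F; apply: integral0_eq => x _.
  by rewrite /g patchE memNset// => -[].
have mab : measurable (`]a, b[%classic : set (measurableTypeR R)) by [].
have iFab : leb.-integrable `]a, b[ (fubini_F (torus d) g).
  exact: integrableS iF.
have mfine : measurable_fun `]a, b[ (EFin \o (fun t => \int[torus d]_x f (t, x))).
  apply: (eq_measurable_fun (EFin \o (fine \o fubini_F (torus d) g))).
    by move=> t; rewrite inE => tab /=; rewrite FE.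
  apply/measurable_EFinP; apply: measurableT_comp => //.
  exact: measurable_int iFab.
split.
  apply: le_integrable iFab => // t tab /=; rewrite FE//.
  by case: (fubini_F _ _ _) => [r| |]; rewrite ?lexx//= normr0 ?leey// lee_fin.
rewrite /Rintegral [in RHS]integral_mkcond -/g.
have <- := integral12_prod_meas1 ig; congr fine.
rewrite [RHS](_ : _ = \int[leb]_(t in `]a, b[) fubini_F (torus d) g t)%E.
  apply: ae_eq_integral => //; first exact: measurable_int iFab.
  (* The inner integral is finite for almost every t, and there [fine] loses nothing. *)
  have := integrable_ae mab iFab; apply: filterS => t H tab.
  rewrite -[LHS]/((\int[torus d]_x f (t, x))%:E) FE// fineK//; exact: H.
rewrite [RHS]integral_mkcond; apply: eq_integral => t _; rewrite patchE.
by case: ifPn => //; rewrite notin_setE => /F0.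
Qed.

Lemma ae_slices (P : R * 'rV[R]_d -> Prop) :
  {ae mu, forall z, P z} -> {ae leb, forall t, {ae torus d, forall x, P (t, x)}}.
Proof.
move=> [A [mA A0 PA]].
have : ae_eq leb setT (fun t => torus d (xsection A t)) (cst 0%E).
  apply/ae_eq_integral_abs => //; first exact: measurable_fun_xsection.
  rewrite -[RHS]A0; apply: eq_integral => t _ /=.
  by rewrite gee0_abs.
apply: filterS => t /(_ I) H; exists (xsection A t); split => //.
  exact: measurable_xsection.
by move=> x Px; rewrite /xsection/= inE; apply: PA.
Qed.

Lemma ae_space (P : 'rV[R]_d -> Prop) :
  {ae torus d, forall x, P x} -> {ae mu, forall z, P z.2}.
Proof.
move=> [A [mA A0 PA]]; exists (setT `*` A); split.
- exact: measurableX.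
- have -> : mu (setT `*` A) = (leb setT * torus d A)%E.
    by apply: product_measure1E.
  by rewrite A0 mule0.
- by move=> z Pz; split => //; apply: PA.
Qed.

Lemma ae_spacetime_cube : {ae mu, forall z, @unit_cube R d z.2}.
Proof. exact/ae_space/ae_unit_cube. Qed.

Lemma continuous_bounded_cube (f : R * 'rV[R]_d -> R) (a b : R) : continuous f ->
  exists2 M : R, 0 <= M & forall z, a <= z.1 <= b -> @unit_cube R d z.2 -> `|f z| <= M.
Proof.
move=> cf.
have cpt : compact (`[a, b]%classic `*`
    [set x : 'rV[R]_d | forall i, `[0%R, 1%R]%classic (x 0 i)]).
  apply: compact_setX; first exact: segment_compact.
  apply: (@rV_compact R d (fun=> `[0%R, 1%R]%classic)) => i.
  exact: segment_compact.
have /compact_bounded[M [_ HM]] :=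
  continuous_compact (continuous_subspaceT cf) cpt.
exists (`|M| + 1) => [|[t x] /= tab xc]; first by rewrite addr_ge0.
apply: (HM (`|M| + 1)); first by rewrite (le_lt_trans (ler_norm _))// ltrDl.
exists (t, x) => //; split => //= i.
by have /andP[? ?] := xc i; rewrite in_itv/= !ltW.
Qed.

End spacetime_integration.

(** * The fundamental lemma of the calculus of variations *)

Section boxes.
Context {R : realType} {d : nat}.
Local Notation spacetime := (measurableTypeR R * 'rV[R]_d)%type.

Definition box (p q : R) (a b : 'rV[R]_d) : set spacetime :=
  [set z : R * 'rV[R]_d | p < z.1 < q /\ forall i, a 0 i < z.2 0 i < b 0 i].

Definition boxes : set (set spacetime) :=
  [set A | exists p q a b, A = box p q a b].

Lemma measurable_box p q a b : measurable (box p q a b).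
Proof.
have -> : box p q a b = `]p, q[%classic `*`
    \bigcap_(i in [set: 'I_d]) ((fun x : 'rV[R]_d => x 0 i) @^-1` `]a 0 i, b 0 i[).
  apply/seteqP; split => [[t x] [/= tpq H]|[t x] [/= tpq H]].
    by split; [rewrite /= in_itv|move=> i _; rewrite /= in_itv/=; exact: H].
  by split=> [|i]; [move: tpq; rewrite /= in_itv|move: (H i I); rewrite /= in_itv].
apply: measurableX => //; apply: fin_bigcap_measurable => // i _.
by rewrite -[X in measurable X]setTI; exact: measurable_entry.
Qed.

Lemma boxes_setI_closed : setI_closed boxes.
Proof.
move=> _ _ [p [q [a [b ->]]]] [p' [q' [a' [b' ->]]]].
exists (Num.max p p'), (Num.min q q').
exists (\row_i Num.max (a 0 i) (a' 0 i)), (\row_i Num.min (b 0 i) (b' 0 i)).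
apply/seteqP; split => [[t x] [[/= H1 H2] [/= H3 H4]]|[t x] [/=]].
  split => [|i] /=; first by rewrite gt_max lt_min; case/andP: H1 H3 => -> -> /andP[-> ->].
  by rewrite !mxE gt_max lt_min; case/andP: (H2 i) (H4 i) => -> -> /andP[-> ->].
rewrite gt_max lt_min => /andP[/andP[h1 h2] /andP[h3 h4]] H; split.
  split=> /=; first by rewrite h1.
  move=> i; have := H i; rewrite !mxE gt_max lt_min.
  by move=> /andP[/andP[-> ?] /andP[-> ?]].
split=> /=; first by rewrite h2.
move=> i; have := H i; rewrite !mxE gt_max lt_min.
by move=> /andP[/andP[? ->] /andP[? ->]].
Qed.

Lemma big_box_exists (z : R * 'rV[R]_d) : exists k : nat, forall m : nat,
  (k <= m)%N -> `|z.1| < m%:R /\ forall i, `|z.2 0 i| < m%:R.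
Proof.
exists (Num.bound `|z|) => m km.
have zm : `|z| < m%:R by rewrite (lt_le_trans (archi_boundP _))// ler_nat.
have z12 : `|z.1| <= `|z| /\ `|z.2| <= `|z|.
  by rewrite [`|z|]prod_normE/= !le_max !lexx orbT.
split; first exact: le_lt_trans z12.1 zm.
move=> i; apply: le_lt_trans zm; apply: le_trans z12.2.
exact: mx_entry_le_norm.
Qed.

(** Half-spaces in one coordinate are countable unions of growing boxes, so both projections are
    measurable for the sigma-algebra of boxes. *)
Lemma measurable_spacetime_boxes : @measurable _ spacetime = <<s boxes >>.
Proof.
apply/seteqP; split; last first.
  apply: smallest_sub; first exact: sigma_algebra_measurable.
  by move=> _ [p [q [a [b ->]]]]; exact: measurable_box.
pose GT := g_sigma_algebraType boxes.
pose big (m : nat) := const_mx (m%:R : R) : 'rV[R]_d.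
have mbox p q a b : measurable (box p q a b : set GT).
  by apply: sub_sigma_algebra; exists p, q, a, b.
have mfst : measurable_fun setT (fst : GT -> measurableTypeR R).
  apply: (measurability _ (RGenOInfty.measurableE R)) => _ [_ [x ->] <-].
  rewrite setTI (_ : _ @^-1` _ = \bigcup_m box x m%:R (- big m) (big m)).
    by apply: bigcupT_measurable => m; exact: mbox.
  apply/seteqP; split => [z /=|z [m _] [/= /andP[? ?] _]]; rewrite in_itv/= andbT//.
  move=> xz; have [k /(_ k (leqnn k))[z1 z2]] := big_box_exists z.
  exists k => //; split; first by rewrite xz/= (le_lt_trans (ler_norm _) z1).
  by move=> i; rewrite !mxE -ltr_norml; exact: z2.
have msnd : measurable_fun setT (snd : GT -> 'rV[R]_d).
  apply/measurable_mxP => // i0 i.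
  apply: (measurability _ (RGenOInfty.measurableE R)) => _ [_ [x ->] <-].
  rewrite setTI (_ : _ @^-1` _ = \bigcup_m box (- m%:R) m%:R
      (\row_j if j == i then x else - m%:R) (big m)).
    by apply: bigcupT_measurable => m; exact: mbox.
  rewrite ord1; apply/seteqP; split => [z /=|z [m _] [/= _ H]]; rewrite in_itv/= andbT//.
    move=> xz; have [k /(_ k (leqnn k))[z1 z2]] := big_box_exists z.
    exists k => //; split; first by rewrite -ltr_norml.
    move=> j; rewrite !mxE; have := z2 j; rewrite ltr_norml => /andP[h1 h2].
    by rewrite h2 andbT; case: eqP => [->|_].
  by have := H i; rewrite !mxE eqxx => /andP[].
have mid : measurable_fun setT (fun z : GT => (z.1, z.2) : spacetime).
  exact: measurable_fun_pair mfst msnd.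
move=> A mA; have := mid measurableT A mA; rewrite setTI.
by rewrite (_ : _ @^-1` A = A)//; apply/seteqP; split => -[].
Qed.

End boxes.

Section box_tests.
Context {R : realType} {d : nat}.
Local Notation spacetime := (R * 'rV[R]_d)%type.

(* On [0 < x < 1] the 1-periodic function [arc a b] is positive exactly on the
   interval between [a] and [b]. *)
Definition arc (a b x : R) : R :=
  cos (pi *+ 2 * x + - (pi *+ 2 * ((a + b) / 2))) - cos (pi * (b - a)).

Lemma cos_mirror (y : R) : cos (pi *+ 2 * y) = cos (pi *+ 2 * (1 - y)).
Proof.
have -> : pi *+ 2 * (1 - y) = - (pi *+ 2 * y) + pi *+ 2 :> R by ring.
by rewrite cosD2pi cosN.
Qed.

(** With centre c, half-length r and y = |x - c|, [arc] is cos(2 pi y) - cos(2 pi r), and cos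
    decreases on [0, pi]. *)
Lemma arc_gt0 (a b x : R) : 0 <= a -> a < b -> b <= 1 -> 0 < x < 1 ->
  (0 < arc a b x) = (a < x < b).
Proof.
move=> a0 ab b1 /andP[x0 x1].
pose c := (a + b) / 2; pose r := (b - a) / 2.
have pi0 : 0 < (pi : R) by exact: pi_gt0.
have r0 : 0 <= r by rewrite divr_ge0// subr_ge0 ltW.
have r1 : r <= 1 / 2 by rewrite /r; lra.
pose y : R := `|x - c|.
have y0 : 0 <= y by exact: normr_ge0.
have yr : y < 1 - r by rewrite /y /r /c ltr_norml; apply/andP; split; lra.
have -> : arc a b x = cos (pi *+ 2 * y) - cos (pi *+ 2 * r).
  rewrite /arc; congr (_ - _); last by congr cos; rewrite /r; lra.
  rewrite -/c /y; have [xc|xc] := leP 0 (x - c).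
    by rewrite ger0_norm//; congr cos; ring.
  by rewrite ler0_norm ?(ltW xc)// -cosN; congr cos; ring.
have -> : (a < x < b) = (y < r).
  by rewrite /y ltr_norml /c /r; apply/andP/andP => -[? ?]; split; lra.
have mem (s : R) : 0 <= s -> s <= 1 / 2 -> pi *+ 2 * s \in `[0, pi].
  move=> s0 s1; rewrite in_itv/=; apply/andP; split.
    by apply: mulr_ge0 => //; apply: mulrn_wge0; exact: ltW.
  rewrite -[leRHS]mulr1 mulr2n mulrDl -mulrDr ler_pM2l//; lra.
have pi20 : 0 < pi *+ 2 :> R by rewrite mulrn_wgt0.
rewrite subr_gt0; have [y1|y1] := leP y (1 / 2).
  by rewrite ltr_cos ?mem// ltr_pM2l.
(* For y > 1/2 the angle is reflected to 1 - y, which still exceeds r; both sides of the equivalence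
   are false. *)
rewrite (cos_mirror y) ltr_cos ?mem//; [|lra|lra].
by rewrite ltr_pM2l//; apply/idP/idP => ?; lra.
Qed.

(** A smooth substitute for the indicator of a box: the two [eta] factors give compact support
    inside (p, q), while in space periodicity is enough. *)
Definition box_test (k : nat) (p q : R) (a b : 'rV[R]_d) (z : spacetime) : R :=
  eta k (1 * z.1 + - p) * eta k (-1 * z.1 + q) *
  \prod_i rho (k.+1%:R * arc (a 0 i) (b 0 i) (z.2 0 i)).

Lemma box_test_function k p q a b T : 0 <= p -> q <= T ->
  test_function T (box_test k p q a b).
Proof.
move=> p0 qT; split; last first.
  have k0 : 0 < k.+1%:R^-1 :> R by rewrite invr_gt0.
  exists (p + k.+1%:R^-1), (q - k.+1%:R^-1); split.
  - by rewrite ltr_wpDl.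
  - by rewrite ltrBlDr (le_lt_trans qT)// ltrDl.
  - move=> t x /negP; rewrite negb_and -!ltNge /box_test => /orP[tp|tq] /=.
      by rewrite eta_eq0 ?mul0r// mul1r lerBlDr addrC ltW.
    by rewrite [X in _ * X * _]eta_eq0 ?mulr0 ?mul0r// mulN1r addrC lerBlDr addrC -lerBlDr ltW.
split.
  apply: smooth_mul; first apply: smooth_mul.
  - apply: (@smooth_comp _ _ (fun t => eta k (1 * t + - p)) fst); last exact: smooth_fst.
    by apply: smooth_comp; [exact: eta_smooth|exact: smooth_affine].
  - apply: (@smooth_comp _ _ (fun t => eta k (-1 * t + q)) fst); last exact: smooth_fst.
    by apply: smooth_comp; [exact: eta_smooth|exact: smooth_affine].
  - apply: smooth_prod => i; apply: smooth_comp; first exact: rho_smooth.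
    apply: smooth_mul; first exact: smooth_cst.
    apply: smooth_add; last exact: smooth_cst.
    apply: (@smooth_comp _ _ (fun x => cos (pi *+ 2 * x +
      - (pi *+ 2 * ((a 0 i + b 0 i) / 2)))) (fun z : spacetime => z.2 0 i)).
      exact: smooth_cos.
    exact: smooth_coord.
move=> t x i; rewrite /time_slice /box_test /=; congr (_ * _).
apply: eq_bigr => j _; congr (rho (_ * (_ - _))).
rewrite !mxE eqxx /=; case: eqP => [_|_]; last by rewrite addr0.
by rewrite mulr1n mulrDr mulr1 addrAC cosD2pi.
Qed.

Lemma box_test_bound k p q a b z : `|box_test k p q a b z| <= 1.
Proof.
rewrite /box_test !normrM -[leRHS]mulr1; apply: ler_pM => //.
  by rewrite -[leRHS]mulr1 ler_pM// eta_bound.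
rewrite normr_prod; elim: (index_enum _) => [|i s IH]; first by rewrite big_nil.
rewrite big_cons -[leRHS]mulr1 ler_pM//; first exact: prodr_ge0.
by rewrite ger0_norm ?rho_le1// rho_ge0.
Qed.

Lemma cvg_prod_seq (I : Type) (s : seq I) (f : I -> nat -> R) (l : I -> R) :
  (forall i, f i k @[k --> \oo] --> l i) ->
  (\prod_(i <- s) f i k) @[k --> \oo] --> \prod_(i <- s) l i.
Proof.
move=> fl; elim: s => [|i s IH].
  by under eq_fun do rewrite big_nil; rewrite big_nil; exact: cvg_cst.
by under eq_fun do rewrite big_cons; rewrite big_cons; apply: cvgM.
Qed.

Lemma cvg_eta_sign (t : R) : eta k t @[k --> \oo] --> ((0 < t)%R%:R : R).
Proof.
have [t0|t0] := ltP 0 t; first exact: cvg_eta.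
have -> : (fun k => eta k t) = fun=> 0; last exact: cvg_cst.
by apply/funext => k; rewrite eta_eq0// (le_trans t0).
Qed.

Lemma cvg_box_test (p q : R) (a b : 'rV[R]_d) (z : spacetime) : (forall i, 0 <= a 0 i < b 0 i) ->
  (forall i, b 0 i <= 1) -> unit_cube z.2 ->
  box_test k p q a b z @[k --> \oo] --> (\1_(box p q a b) z : R).
Proof.
move=> a0 b1 cz; rewrite /box_test.
have -> : \1_(box p q a b) z = (p < z.1)%R%:R * (z.1 < q)%R%:R *
    \prod_i (0 < arc (a 0 i) (b 0 i) (z.2 0 i))%R%:R :> R.
  have E i : (0 < arc (a 0 i) (b 0 i) (z.2 0 i)) = (a 0 i < z.2 0 i < b 0 i).
    by have /andP[? ?] := a0 i; apply: arc_gt0 => //; exact: cz.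
  rewrite indicE; case: (boolP (z \in box p q a b)).
    rewrite inE => -[/andP[-> ->] H]; rewrite !mul1r big1// => i _.
    by rewrite E H.
  rewrite notin_setE => nz; case: (boolP (p < z.1)) => h1; last by rewrite !mul0r.
  case: (boolP (z.1 < q)) => h2; last by rewrite mulr0 mul0r.
  have [i ni] : exists i, ~~ (a 0 i < z.2 0 i < b 0 i).
    apply: contrapT => H; apply: nz; split; first by rewrite h1.
    by move=> i; apply: contrapT => Hi; apply: H; exists i; exact/negP.
  by rewrite (bigD1 i)//= E (negbTE ni) !mul0r mulr0.
apply: cvgM; first apply: cvgM.
- have -> : (p < z.1) = (0 < 1 * z.1 + - p) by rewrite mul1r subr_gt0.
  exact: cvg_eta_sign.
- have -> : (z.1 < q) = (0 < -1 * z.1 + q) by rewrite mulN1r addrC subr_gt0.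
  exact: cvg_eta_sign.
- by apply: cvg_prod_seq => i; exact: cvg_rho_scale.
Qed.

End box_tests.

Section fundamental_lemma.
Context {R : realType} {d : nat}.
Local Notation mu := (@spacetime_measure R d).
Local Notation cyl := (@cylinder R d).

(** Dominated convergence along [box_test] shows that f integrates to 0 over boxes. These are stable
    under intersection and generate the measurable sets, so Dynkin induction extends this to all
    measurable sets. *)
Lemma fundamental_lemma (T : R) (f : R * 'rV[R]_d -> R) :
  mu.-integrable (cyl 0 T) (EFin \o f) ->
  (forall phi : R * 'rV[R]_d -> R, test_function T phi ->
     \int[mu]_(z in cyl 0 T) (f z * phi z) = 0) ->
  {ae mu, forall z, cyl 0 T z -> f z = 0}.
Proof.
move=> fi Hf; have mC := @measurable_cylinder R d 0 T.
have mf : measurable_fun (cyl 0 T) f.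
  by apply/measurable_EFinP; exact: measurable_int fi.
have mindic p q (a b : 'rV[R]_d) : measurable_fun (cyl 0 T)
    (fun z => f z * (\1_(box p q a b) z : R)).
  apply: measurable_funM => //; apply: measurable_indic; exact: measurable_box.
have small p q (a b : 'rV[R]_d) : 0 <= p -> q <= T ->
    (forall i, 0 <= a 0 i < b 0 i) -> (forall i, b 0 i <= 1) ->
    \int[mu]_(z in cyl 0 T) (f z * (\1_(box p q a b) z : R)) = 0.
  move=> p0 qT a0 b1.
  have mtest k : measurable_fun (cyl 0 T) (fun z => f z * box_test k p q a b z).
    apply: measurable_funM => //; apply: measurable_funTS.
    apply: continuous_measurable_spacetime.
    by apply: smooth_continuous; case: (box_test_function k a b p0 qT) => -[].
  have lim : {ae mu, forall z, cyl 0 T z -> f z * box_test k p q a b z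
      @[k --> \oo] --> f z * (\1_(box p q a b) z : R)}.
    apply: filterS ae_spacetime_cube => z cz _; apply: cvgM; first exact: cvg_cst.
    exact: cvg_box_test.
  have bd : {ae mu, forall z, cyl 0 T z -> forall k,
      `|f z * box_test k p q a b z| <= `|f z|}.
    by apply/aeW => z _ k; rewrite normrM ler_piMr// box_test_bound.
  have [_ H] := dominated_convergence_R mC mtest (mindic p q a b) lim
    (integrable_norm fi) bd.
  apply: (cvg_unique _ H); first exact: Rhausdorff.
  have -> : (fun k => \int[mu]_(z in cyl 0 T) (f z * box_test k p q a b z)) =
      fun=> 0.
    by apply/funext => k; apply: Hf; exact: box_test_function.
  exact: cvg_cst.
(* An arbitrary box is clipped to (0, T) and the unit cube, which changes its trace on the cylinder
   by a null set; the clipped box may be empty. *)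
have all_boxes p q (a b : 'rV[R]_d) :
    \int[mu]_(z in cyl 0 T) (f z * (\1_(box p q a b) z : R)) = 0.
  pose a' : 'rV[R]_d := \row_i Num.max (a 0 i) 0.
  pose b' : 'rV[R]_d := \row_i Num.min (b 0 i) 1.
  have inE' z : cyl 0 T z -> unit_cube z.2 -> (box p q a b z <->
      box (Num.max p 0) (Num.min q T) a' b' z).
    move=> [/= zT _] cz; rewrite in_itv/= in zT; case/andP: zT => z0 zT.
    rewrite /box/= gt_max lt_min z0 zT !andbT; split=> -[h1 h2]; split=> // i.
      have /andP[c0 c1] := cz i.
      by rewrite !mxE gt_max lt_min c0 c1 !andbT h2.
    by have := h2 i; rewrite !mxE gt_max lt_min => /andP[/andP[-> _] /andP[-> _]].
  have [ab|nab] := pselect (forall i, a' 0 i < b' 0 i).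
    rewrite -[RHS](small (Num.max p 0) (Num.min q T) a' b').
    - apply: (ae_eq_Rintegral mC); [exact: mindic|exact: mindic|].
      apply: filterS ae_spacetime_cube => z cz zT.
      rewrite !indicE; congr (_ * (nat_of_bool _)%:R); apply/idP/idP; rewrite !inE.
        by move/(inE' z zT cz).
      by move/(inE' z zT cz).
    - by rewrite le_max lexx orbT.
    - by rewrite ge_min lexx orbT.
    - by move=> i; rewrite ab andbT mxE le_max lexx orbT.
    - by move=> i; rewrite mxE ge_min lexx orbT.
  rewrite -[RHS](_ : \int[mu]_(z in cyl 0 T) 0 = 0); last first.
    by rewrite /Rintegral integral0.
  apply: (ae_eq_Rintegral mC); [exact: mindic|exact: measurable_cst|].
  apply: filterS ae_spacetime_cube => z cz zT.
  rewrite indicE memNset ?mulr0// => /(inE' z zT cz)[_ H].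
  by apply: nab => i; have /andP[h1 h2] := H i; exact: lt_trans h2.
pose g := (EFin \o f) \_ (cyl 0 T).
have ig : mu.-integrable setT g by exact: ((integrable_mkcond _ mC).1 fi).
have gint (A : set (measurableTypeR R * 'rV[R]_d)) : measurable A ->
    (\int[mu]_(z in A) g z)%E = (\int[mu]_(z in cyl 0 T) (f z * (\1_A z : R))%:E)%E.
  move=> mA; rewrite [LHS]integral_mkcond [RHS]integral_mkcond.
  apply: eq_integral => z _; rewrite /g !patchE indicE.
  by case: ifPn => zA; case: ifPn => zC; rewrite ?mulr1 ?mulr0.
have gfin (A : set (measurableTypeR R * 'rV[R]_d)) : measurable A ->
    \int[mu]_(z in cyl 0 T) (f z * (\1_A z : R)) = 0 -> (\int[mu]_(z in A) g z)%E = 0%E.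
  move=> mA H; rewrite -[RHS]/(0%:E) -H /Rintegral -gint// fineK//.
  apply: integrable_fin_num => //; exact: integrableS ig.
(* The complement step of the induction needs the whole space, which agrees on the cylinder, up to a
   null set, with one large box. *)
have gT : (\int[mu]_(z in setT) g z)%E = 0%E.
  apply: gfin => //.
  rewrite -[RHS](all_boxes (-1) (T + 1) (const_mx (-1)) (const_mx 2)).
  apply: (ae_eq_Rintegral mC); [|exact: mindic|].
    by apply: measurable_funM => //; exact: measurable_indic.
  apply: filterS ae_spacetime_cube => z cz [/= zT _].
  rewrite in_itv/= in zT; case/andP: zT => z0 zT.
  rewrite !indicE !mem_set//; split.
    by rewrite (lt_trans _ z0) ?ltrN10//= (lt_trans zT)// ltrDl.
  move=> i; rewrite !mxE; have /andP[c0 c1] := cz i.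
  by rewrite (lt_trans _ c0) ?ltrN10//= (lt_trans c1)// ltr1n.
have g0 : forall A, <<s @boxes R d >> A -> (\int[mu]_(z in A) g z)%E = 0%E.
  apply: (dynkin_induction (@measurable_spacetime_boxes R d)) => //.
  - exact: boxes_setI_closed.
  - by move=> _ [p [q [a [b ->]]]]; apply: gfin => //; exact: measurable_box.
  - move=> A mA HA; have mg : measurable_fun setT g by exact: measurable_int ig.
    have := @integral_setU _ _ _ mu A (~` A) g mA (measurableC mA).
    rewrite setUv gT HA add0e => /(_ mg) <-//.
    by rewrite disj_set2E setICr.
  - move=> A mA tA HA; rewrite integral_bigcup//.
      by apply: eseries0 => k _ _; exact: HA.
    by apply: integrableS ig => //; exact: bigcupT_measurable.
have : ae_eq mu (cyl 0 T) (EFin \o f) (cst 0%E).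
  apply: integral_ae_eq => // E EC mE; rewrite integral_cst//= mul0e.
  rewrite -(g0 E); last by rewrite -measurable_spacetime_boxes.
  apply: eq_integral => z; rewrite inE => zE.
  by rewrite /g patchE mem_set//; exact: EC.
by apply: filterS => z H zC; have [] := H zC.
Qed.

End fundamental_lemma.

(** * Locally integrable fields *)

Section locally_integrable.
Context {R : realType} {d : nat}.
Local Notation mu := (@spacetime_measure R d).
Local Notation cyl := (@cylinder R d).
Local Notation spacetime := (R * 'rV[R]_d)%type.

Lemma cylinder_subset (a b a' b' : R) : a' <= a -> b <= b' ->
  cyl a b `<=` cyl a' b'.
Proof.
move=> aa bb [t x] [/= + _]; rewrite in_itv/= => /andP[at_ tb].
by split => //=; rewrite in_itv/= (le_lt_trans aa at_) (lt_le_trans tb bb).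
Qed.

Lemma locally_integrable_measurable (T : R) m k (f : spacetime -> 'M[R]_(m, k)) :
  locally_integrable_mx T f -> measurable_fun (cyl 0 T) f.
Proof.
move=> lf; apply/measurable_mxP; first exact: measurable_cylinder.
move=> i j.
have -> : cyl 0 T = \bigcup_k cyl (k.+1%:R^-1) (T - k.+1%:R^-1).
  apply/seteqP; split => [[t x] [/= + _]|z [l _]]; last first.
    apply: cylinder_subset; first by rewrite invr_ge0.
    by rewrite lerBlDr lerDl invr_ge0.
  rewrite in_itv/= => /andP[t0 tT].
  pose e := Num.min t (T - t); have e0 : 0 < e by rewrite lt_min t0 subr_gt0.
  exists (Num.bound e^-1) => //; split => //=; rewrite in_itv/=.
  have : (Num.bound e^-1).+1%:R^-1 < e.
    rewrite invf_plt ?posrE//.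
    rewrite (lt_le_trans (archi_boundP _)) ?invr_ge0 ?(ltW e0)//.
    by rewrite ler_nat.
  move: (_.+1%:R^-1) => r; rewrite lt_min => /andP[-> rT] /=.
  by rewrite ltrBrDl -ltrBrDr.
apply/measurable_fun_bigcup => [l|l]; first exact: measurable_cylinder.
apply/measurable_EFinP; apply: (@measurable_int _ _ _ mu).
apply: lf; first by rewrite invr_gt0.
by rewrite ltrBlDr ltrDl invr_gt0.
Qed.

Lemma integrable_mul_test (T a b : R) (f phi : spacetime -> R) :
  (forall a b, 0 < a -> b < T -> mu.-integrable (cyl a b) (EFin \o f)) ->
  measurable_fun (cyl 0 T) f -> continuous phi ->
  0 < a -> b < T -> (forall t x, ~ (a <= t <= b) -> phi (t, x) = 0) ->
  mu.-integrable (cyl 0 T) (EFin \o (fun z => f z * phi z)).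
Proof.
move=> lf mf cphi a0 bT phi0.
have mC a' b' := @measurable_cylinder R d a' b'.
have [M M0 HM] := continuous_bounded_cube 0 T cphi.
(* The support [a, b] is closed whereas cylinders are open, so the margins are widened while staying
   inside (0, T). *)
pose C := cyl (a / 2) ((b + T) / 2).
pose g := f \_ C.
have ig : mu.-integrable (cyl 0 T) (EFin \o (fun z => M * `|g z|)).
  have ig0 : mu.-integrable (cyl 0 T) (EFin \o g).
    apply: (@integrableS _ _ _ _ setT) => //.
    rewrite /g -restrict_EFin; apply: ((integrable_mkcond _ _).1 _) => //; last first.
      by apply: lf; lra.
    exact: mC.
  by apply: integrableZ_R => //; exact: (integrable_norm ig0).
apply: (integrable_dominated _ _ ig) => //.
  apply: measurable_funM => //; apply: measurable_funTS.
  exact: continuous_measurable_spacetime.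
apply: filterS ae_spacetime_cube => -[t x] cz [/= + _].
rewrite in_itv/= => /andP[t0 tT].
have [tab|ntab] := boolP (a <= t <= b); last first.
  by rewrite phi0 ?mulr0 ?normr0 ?mulr_ge0//; exact/negP.
have zC : C (t, x).
  by split => //=; rewrite in_itv/=; case/andP: tab => ? ?; apply/andP; split; lra.
rewrite /g patchE mem_set// normrM mulrC ler_wpM2r//.
by apply: HM => //=; rewrite !ltW.
Qed.

Lemma pairing_integral (T : R) m k (f phi : spacetime -> 'M[R]_(m, k)) :
  locally_integrable_mx T f -> continuous phi ->
  (exists a b, [/\ 0 < a, b < T &
    forall t x, ~ (a <= t <= b) -> phi (t, x) = 0]) ->
  mu.-integrable (cyl 0 T) (EFin \o (fun z => mxdot (f z) (phi z))) /\
  pairing T f phi = \int[mu]_(z in cyl 0 T) mxdot (f z) (phi z).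
Proof.
move=> lf cphi [a [b [a0 bT phi0]]].
have mC := @measurable_cylinder R d 0 T.
have H : mu.-integrable (cyl 0 T) (EFin \o (fun z => mxdot (f z) (phi z))).
  apply: integrable_sum_R => // i; apply: integrable_sum_R => // j.
  apply: (integrable_mul_test (T := T) _ _ _ a0 bT).
  - by move=> a' b' a'0 b'T; exact: lf.
  - by have /measurable_mxP := locally_integrable_measurable lf; exact.
  - exact: continuous_entry.
  - by move=> t x tx; rewrite phi0// mxE.
split=> //; rewrite /pairing /inner_torus /time_slice.
by have [_ <-] := integral_slices H.
Qed.

End locally_integrable.

(** * The cumulated weight *)

Section weight.
Context {R : realType}.

(** A lower bound on [H] before T' < T is what turns the bound on H L^* (v^#) into one on L^*
    (v^#). *)
Lemma cumulated_weight_ge (T : R) (h : R -> R) : weight T h ->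
  exists2 c : R, 0 < c & forall t, 0 <= t <= T -> c * (T - t) <= cumulated_weight T h t.
Proof.
move=> [mh [c [C [c0 hb]]]]; exists c => // t /andP[t0 tT].
have sub : `[t, T]%classic `<=` `[0%R, T]%classic.
  by move=> s; rewrite /= !in_itv/= => /andP[ts ->]; rewrite (le_trans t0).
have mt : measurable (`[t, T]%classic : set (measurableTypeR R)) by [].
have fin : (@lebesgue_measure R `[t, T] < +oo)%E.
  by rewrite lebesgue_measure_itv/=; case: ifP; rewrite ?ltry.
have hint : (@lebesgue_measure R).-integrable `[t, T] (EFin \o h).
  apply: measurable_bounded_integrable => //.
    exact: measurable_funS mh.
  exists (`|c| + `|C|); split; first exact: num_real.
  move=> M cM s /sub; rewrite /= in_itv/= => /hb/andP[h1 h2].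
  rewrite (le_trans _ (ltW cM))// ler_norml; apply/andP; split.
    by have := ler_norm (- c); have := normr_ge0 C; rewrite normrN; lra.
  by have := ler_norm C; have := normr_ge0 c; lra.
have cint : (@lebesgue_measure R).-integrable `[t, T] (EFin \o cst c).
  apply: measurable_bounded_integrable => //.
  exists `|c|; split; first exact: num_real.
  by move=> M cM s _; rewrite /= ltW.
apply: (@le_trans _ _ (\int[@lebesgue_measure R]_(s in `[t, T]) c)).
  rewrite Rintegral_cst// [X in fine X]lebesgue_measure_itv/= lte_fin.
  by case: ltgtP tT => // -> _; rewrite subrr.
apply: le_Rintegral => // s /sub; rewrite /= in_itv/= => /hb/andP[].
by [].
Qed.

End weight.

(** * Reflection in space and the signs of iterated derivatives *)

Section reflection.
Context {R : realType} {V : normedModType R}.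

Lemma derive_reflect (f : V -> R) e : smooth f ->
  'D_e (fun y => f (- y)) = fun y => - 'D_e f (- y).
Proof.
move=> sf; apply/funext => y.
rewrite -mulN1r -(derive_dirZ (-1) (smooth_derivable sf (- y) e)).
rewrite scaleN1r /derive.
apply: (congr1 (fun g : R -> R => lim (g @ 0^'))); apply/funext => k /=.
by rewrite opprD scalerN.
Qed.

Lemma smooth_reflect (f : V -> R) : smooth f -> smooth (fun y => f (- y)).
Proof.
pose S (g : V -> R) := exists2 f, smooth f & g = fun y => f (- y).
move=> sf; apply: (@smooth_coind _ _ _ S); last by exists f.
move=> _ [{sf}f sf ->]; split.
- have cN : continuous (-%R : V -> V) by exact: opp_continuous.
  move=> x; apply: (@continuous_comp _ _ _ (-%R) f); first exact: cN.
  exact: smooth_continuous.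
- move=> x e; have := smooth_derivable sf (- x) (- e).
  rewrite /derivable; set g1 := (X in cvg (X @ _) -> _).
  set g2 := (X in _ -> cvg (X @ _)); suff -> : g1 = g2 by [].
  by apply/funext => k; rewrite /g1 /g2 /= opprD scalerN.
- move=> e; rewrite derive_reflect//.
  exists (fun y => -1 * 'D_e f y); last by apply/funext => y; rewrite mulN1r.
  by apply: smooth_mul; [exact: smooth_cst|exact: smooth_derive].
Qed.

Lemma iter_derive_scale (f : V -> R) (c : R) s : smooth f ->
  iter_derive s (fun x => f x * c) = fun x => iter_derive s f x * c.
Proof.
move=> sf; elim: s => //= e s ->; apply/funext => x.
rewrite [X in _ = X]mulrC.
have -> : (fun x => iter_derive s f x * c) = c \*: iter_derive s f.
  by apply/funext => y; rewrite mulrC.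
exact/deriveZ/smooth_derivable/smooth_iter_derive.
Qed.

Lemma iter_derive_reflect (f : V -> R) s : smooth f ->
  iter_derive s (fun y => f (- y)) = fun y => (-1) ^+ size s * iter_derive s f (- y).
Proof.
move=> sf; elim: s => [|e s IH].
  by apply/funext => y; rewrite /= expr0 mul1r.
rewrite [LHS]/= -/(iter_derive s _) IH; apply/funext => y.
have := derive_reflect e (smooth_iter_derive s sf) => /(congr1 (@^~ y)) /= H.
have sr := smooth_reflect (smooth_iter_derive s sf).
have := deriveZ ((-1) ^+ size s) (smooth_derivable sr y e).
rewrite /= => -> ; rewrite H exprS mulN1r mulNr -[_ *: _]/(_ * _) mulrN.
by [].
Qed.

End reflection.

(** * The spatial derivative lies in Lambda *)

Section Lambda_membership.
Context {R : realType} {d n N : nat}.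
Variable L : @diff_operator R d n N.
Local Notation mu := (@spacetime_measure R d).
Local Notation cyl := (@cylinder R d).
Local Notation spacetime := (R * 'rV[R]_d)%type.

Lemma diff_operator_symmetric (a : @diff_term R d n N) l : a \in terms L ->
  symmetric_mx (a.2 l).
Proof. by case: L => t /= /allP H /H/forallP/(_ l)/eqP. Qed.

Lemma apply_adjoint_symmetric u x : symmetric_mx (apply_adjoint L u x).
Proof.
rewrite /symmetric_mx /apply_adjoint linear_sum/= !big_seq.
apply: eq_bigr => a aL; rewrite linearZ linear_sum/=; congr (_ *: _).
apply: eq_bigr => l _; rewrite linearZ/=; congr (_ *: _).
exact: diff_operator_symmetric.
Qed.

(* [Lambda] is an intersection of subspaces; it contains one of minimal
   dimension, with which it therefore coincides. *)
Lemma Lambda_subspace : exists S0 : {vspace 'M[R]_N},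
  [/\ 1%:M \in S0,
      forall u : 'rV[R]_d -> 'rV[R]_n, smooth u -> Defs.periodic u ->
        forall x, apply_adjoint L u x \in S0 &
      forall P, P \in S0 -> Lambda L P].
Proof.
pose adm (S : {vspace 'M[R]_N}) := 1%:M \in S /\
  forall u : 'rV[R]_d -> 'rV[R]_n, smooth u -> Defs.periodic u ->
    forall x, apply_adjoint L u x \in S.
have ex : exists k, `[< exists2 S, adm S & \dim S = k >].
  exists (\dim (fullv : {vspace 'M[R]_N})); apply/asboolP; exists fullv => //.
  by split => [|u _ _ x]; exact: memvf.
have [k /asboolP[S0 [S1 SL] dS] mink] := ex_minnP ex.
exists S0; split => // P PS0 S' S'1 S'L.
have /mink : `[< exists2 S, adm S & \dim S = \dim (S0 :&: S')%VS >].
  apply/asboolP; exists (S0 :&: S')%VS => //; split; first by rewrite memv_cap S1.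
  by move=> u su pu x; rewrite memv_cap SL ?S'L.
rewrite -dS => dle.
have /eqP E : (S0 :&: S')%VS == S0 by rewrite eqEdim capvSl.
by move: PS0; rewrite -{1}E memv_cap => /andP[].
Qed.

(* The adjoint is tested on [y |-> phi (t, - y) e_l]: the reflection undoes the
   signs [(-1) ^ |s|] of the adjoint. *)
Lemma op_slice_orthogonal (P : 'M[R]_N) (phi : spacetime -> R) :
  (forall u : 'rV[R]_d -> 'rV[R]_n, smooth u -> Defs.periodic u ->
    forall x, mxdot (apply_adjoint L u x) P = 0) ->
  smooth_spacetime phi -> op_slice L (fun z => phi z *: P) = fun=> 0.
Proof.
move=> HP [sphi pphi]; apply/funext => -[t x]; apply/rowP => l.
rewrite /op_slice /apply_op !mxE /=.
pose psi (y : 'rV[R]_d) := phi (t, y).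
have spsi : smooth psi.
  apply/smoothP => s; rewrite (_ : psi = time_slice phi t)// iter_derive_time_slice.
  have sI := smooth_iter_derive (map space_dir s) sphi.
  split.
    move=> y e; have := smooth_derivable sI (t, y) (space_dir e).
    rewrite /derivable; set g1 := (X in cvg (X @ _) -> _).
    set g2 := (X in _ -> cvg (X @ _)); suff -> : g1 = g2 by [].
    apply/funext => k; rewrite /g1 /g2 /= /time_slice.
    have E : k *: space_dir e + (t, y) = (t, k *: e + y).
      by congr pair; rewrite /= scaler0 add0r.
    by rewrite E.
  move=> y; apply: (@continuous_comp _ _ _ (fun y => (t, y))); last exact: smooth_continuous.
  have : continuous (fun y : 'rV[R]_d => (t, y)).
    by apply: continuous_pair => //; [exact: cst_continuous|move=> ?; exact: cvg_id].
  exact.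
pose u (y : 'rV[R]_d) : 'rV[R]_n := psi (- y) *: basis_vec l.
have su : smooth u.
  apply: smooth_mx => i j.
  have -> : (fun y => u y i j) = (fun y => psi (- y) * (basis_vec l : 'rV[R]_n) i j).
    by apply/funext => y; rewrite /u !mxE.
  by apply: smooth_mul; [exact: smooth_reflect|exact: smooth_cst].
have pu : Defs.periodic u.
  move=> y i; rewrite /u; congr (_ *: _); rewrite opprD /psi.
  have := pphi t (- y - basis_vec i) i; rewrite /time_slice subrK.
  by move=> <-.
(* The reflected field is evaluated at - x, which brings [psi] back to x. *)
rewrite -[RHS](HP u su pu (- x)) /apply_adjoint mxdot_suml.
apply: eq_bigr => a _; rewrite mxdotZl mxdot_suml /partials.
have -> : time_slice (fun z => phi z *: P) t = (fun y => psi y *: P) by [].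
set s := map _ _.
have E1 : iter_derive s (fun y => psi y *: P) x = iter_derive s psi x *: P.
  apply/matrixP => i j.
  have sP : smooth (fun y => psi y *: P).
    apply: smooth_mx => i' j'.
    have -> : (fun y => (psi y *: P) i' j') = (fun y => psi y * P i' j').
      by apply/funext => y; rewrite mxE.
    by apply: smooth_mul => //; exact: smooth_cst.
  have := congr1 (@^~ x) (iter_derive_entry s i j sP) => /= <-.
  rewrite mxE (_ : (fun y => (psi y *: P) i j) = (fun y => psi y * P i j)).
    by rewrite iter_derive_scale.
  by apply/funext => y; rewrite mxE.
have E2 i : iter_derive s u (- x) 0 i =
    (-1) ^+ size s * iter_derive s psi x * (basis_vec l : 'rV[R]_n) 0 i.
  have := congr1 (@^~ (- x)) (iter_derive_entry s 0 i su) => /= <-.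
  have -> : (fun y => u y 0 i) = (fun y => psi (- y) * (basis_vec l : 'rV[R]_n) 0 i).
    by apply/funext => y; rewrite /u !mxE.
  by rewrite iter_derive_scale ?iter_derive_reflect ?opprK//; exact: smooth_reflect.
rewrite E1 mxdotZr (bigD1 l)//= big1 ?addr0 => [|i il]; last first.
  by rewrite E2 mxE eqxx (negbTE il) !mulr0 scale0r mxdot0l.
rewrite E2 mxE !eqxx mulr1 mxdotZl /s size_map !mulrA -exprMn.
by rewrite mulrNN mulr1 expr1n mul1r.
Qed.

Lemma Rintegral_cylinder_restrict (T T' : R) (f : spacetime -> R) : T' <= T ->
  (forall z, T' <= z.1 -> f z = 0) ->
  \int[mu]_(z in cyl 0 T') f z = \int[mu]_(z in cyl 0 T) f z.
Proof.
move=> TT f0; rewrite Rintegral_mkcond [RHS]Rintegral_mkcond.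
congr fine; apply: eq_integral => z _; congr EFin; rewrite !patchE.
case: ifPn => [|]; rewrite ?inE ?notin_setE => zT'.
  by rewrite mem_set//; exact: cylinder_subset zT'.
case: ifPn => //; rewrite inE => -[zT _]; rewrite f0// leNgt.
apply/negP => zlt; apply: zT'; split => //=; move: zT.
by rewrite /= !in_itv/= zlt => /andP[-> _].
Qed.

Variables (T T' M : R) (w : spacetime -> 'rV[R]_n) (G : spacetime -> 'M[R]_N).
Hypotheses (T'T : T' < T) (wG : weak_adjoint L T w G).
Hypothesis sG : forall z, cyl 0 T z -> symmetric_mx (G z).
Hypothesis GM : {ae mu, forall z, cyl 0 T' z -> `|G z| <= M}.

Let mC : measurable (cyl 0 T' : set (measurableTypeR R * 'rV[R]_d)).
Proof. exact: measurable_cylinder. Qed.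

Let subC : cyl 0 T' `<=` cyl 0 T.
Proof. by apply: cylinder_subset => //; exact: ltW. Qed.

Lemma measurable_weak_adjoint : measurable_fun (cyl 0 T) G.
Proof. by case: wG => _ lG _; exact: locally_integrable_measurable. Qed.

(** Test functions phi Q are annihilated by L, so phi integrates to 0 against G : Q. The fundamental
    lemma is applied on (0, T'), where the bound on G makes G : Q integrable. *)
Lemma weak_adjoint_orthogonal (Q : 'M[R]_N) : symmetric_mx Q ->
  (forall u : 'rV[R]_d -> 'rV[R]_n, smooth u -> Defs.periodic u ->
    forall x, mxdot (apply_adjoint L u x) Q = 0) ->
  {ae mu, forall z, cyl 0 T' z -> mxdot (G z) Q = 0}.
Proof.
move=> sQ HQ; have [lw lG wGE] := wG.
apply: fundamental_lemma.
  apply: (integrable_dominated (g := cst ((N * N)%:R * `|M| * `|Q|)) mC).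
  - apply: (measurable_fun_mxdot (g := cst Q) mC); last exact: measurable_cst.
    apply: measurable_funS measurable_weak_adjoint => //.
    exact: measurable_cylinder.
  - exact: integrable_cst_cylinder.
  - apply: (ae_imply GM) => z H zC; rewrite (le_trans (mxdot_norm_le _ _))//.
    by rewrite ler_wpM2r// ler_wpM2l// (le_trans (H zC)) ?ler_norm.
move=> phi [sphi [a [b [a0 bT' phi0]]]].
rewrite (Rintegral_cylinder_restrict (ltW T'T)); last first.
  move=> [t x] /= Tt; rewrite phi0 ?mulr0// => /andP[_ tb].
  by move: (lt_le_trans bT' Tt); rewrite ltNge tb.
pose Psi z := phi z *: Q.
have supp : exists a b, [/\ 0 < a, b < T &
    forall t x, ~ (a <= t <= b) -> Psi (t, x) = 0].
  exists a, b; split => //; first exact: lt_trans T'T.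
  by move=> t x tab; rewrite /Psi phi0// scale0r.
have sPsi : smooth Psi.
  apply: smooth_mx => i j.
  have -> : (fun y => Psi y i j) = (fun y => phi y * Q i j).
    by apply/funext => y; rewrite /Psi mxE.
  by apply: smooth_mul; [case: sphi|exact: smooth_cst].
have tPsi : test_function T Psi.
  split; last exact: supp.
  by split=> // t x i; rewrite /time_slice /Psi; congr (_ *: _);
    have [_ /(_ t x i)] := sphi.
have [_ PE] := pairing_integral lG (smooth_continuous sPsi) supp.
transitivity (\int[mu]_(z in cyl 0 T) mxdot (G z) (Psi z)).
  by congr fine; apply: eq_integral => z _; rewrite /Psi mxdotZr mulrC.
rewrite -PE -wGE//; last first.
  by move=> z; rewrite /Psi; exact: symmetric_mxZ.
rewrite op_slice_orthogonal// /pairing /inner_torus.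
rewrite /Rintegral integral0_eq// => t _; congr EFin.
rewrite /Rintegral integral0_eq// => x _; congr EFin.
exact: mxdot0r.
Qed.

(** Any linear projection onto the minimal subspace [S0] will do. Each entry of A - proj A is a
    linear functional of A, represented by a matrix P; symmetrizing P makes phi P an admissible test
    function without changing its product with symmetric A. All these functionals vanish on the
    values of the adjoint, hence almost everywhere on G. *)
Lemma weak_adjoint_Lambda : {ae mu, forall z, cyl 0 T' z -> Lambda L (G z)}.
Proof.
have [S0 [S1 SL SLam]] := Lambda_subspace.
pose ell i j (A : 'M[R]_N) := (A - projv S0 A) i j.
pose P i j : 'M[R]_N := \matrix_(k, l) ell i j (delta_mx k l).
have PE i j A : mxdot A (P i j) = ell i j A.
  rewrite /ell {2 3}(matrix_sum_delta A) linear_sum/= -sumrB summxE.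
  apply: eq_bigr => k _; rewrite linear_sum/= -sumrB summxE.
  apply: eq_bigr => l _; rewrite linearZ/= -scalerBr mxE mxE.
  by rewrite /ell.
pose Q i j := 2^-1 *: (P i j + (P i j)^T).
have sQ i j : symmetric_mx (Q i j).
  apply: symmetric_mxZ; rewrite /symmetric_mx linearD/= trmxK.
  exact: addrC.
have QE i j A : symmetric_mx A -> mxdot A (Q i j) = ell i j A.
  move=> sA; rewrite mxdotZr mxdotDr -{2}sA mxdot_tr PE; lra.
have aeQ : {ae mu, forall z i j, cyl 0 T' z -> mxdot (G z) (Q i j) = 0}.
  apply: ae_forall => i; apply: ae_forall => j.
  apply: weak_adjoint_orthogonal => // u su pu x.
  rewrite QE; last exact: apply_adjoint_symmetric.
  by rewrite /ell projv_id ?subrr ?mxE// SL.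
apply: (ae_imply aeQ) => z Hz zC; apply: SLam.
have -> : G z = projv S0 (G z).
  apply/eqP; rewrite -subr_eq0; apply/eqP/matrixP => i j.
  rewrite [RHS]mxE -(Hz i j zC) QE//; exact/sG/subC.
exact: memv_proj.
Qed.

End Lambda_membership.

(** * Dual certificates *)

Section time_weighted_tests.
Context {R : realType} {d : nat}.
Local Notation spacetime := (R * 'rV[R]_d)%type.

Lemma smooth_time_scale m k (th : R -> R) (Psi : spacetime -> 'M[R]_(m, k)) :
  smooth th -> smooth Psi -> smooth (fun z => th z.1 *: Psi z).
Proof.
move=> sth sP; apply: smooth_mx => i j.
have -> : (fun z => (th z.1 *: Psi z) i j) = (fun z => th z.1 * Psi z i j).
  by apply/funext => z; rewrite mxE.
apply: smooth_mul; last exact: smooth_entry.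
by apply: (@smooth_comp _ _ th fst) => //; exact: smooth_fst.
Qed.

Lemma test_time_scale m k (T : R) (th : R -> R) (Psi : spacetime -> 'M[R]_(m, k)) :
  smooth th -> smooth_spacetime Psi ->
  (exists a b, [/\ 0 < a, b < T & forall t, ~ (a <= t <= b) -> th t = 0]) ->
  test_function T (fun z => th z.1 *: Psi z).
Proof.
move=> sth [sP pP] [a [b [a0 bT th0]]]; split; last first.
  by exists a, b; split => // t x tab; rewrite /= th0// scale0r.
split; first exact: smooth_time_scale.
by move=> t x i; rewrite /time_slice /=; congr (_ *: _); exact: (pP t x i).
Qed.

Lemma time_derive_scale m k (th dth : R -> R) (Psi : spacetime -> 'M[R]_(m, k)) :
  smooth th -> (forall t, is_derive t (1 : R) th (dth t)) -> smooth Psi ->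
  time_derive (fun z => th z.1 *: Psi z) =
    fun z => dth z.1 *: Psi z + th z.1 *: time_derive Psi z.
Proof.
move=> sth dthE sP; rewrite !time_deriveE; apply/funext => z.
have sthP := smooth_time_scale sth sP.
rewrite derive_mx; last exact: smooth_derivable.
apply/matrixP => i j; rewrite !mxE.
have -> : (fun z => (th z.1 *: Psi z) i j) = (th \o fst) * (fun z => Psi z i j).
  by apply/funext => y; rewrite mxE.
have dfst := smooth_derivable (@smooth_fst R d) z time_dir.
have [H1 H2] := is_derive_comp_dir (smooth_derivable sth z.1 1) dfst.
have sPij := smooth_entry i j sP.
apply: etrans (deriveM H1 (smooth_derivable sPij z time_dir)) _.
rewrite H2; have [_ ->] := dthE z.1.
have -> : 'D_time_dir fst z = 1 :> R.
  apply/cvg_lim => //; apply: cvg_near_cst; near=> h.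
  rewrite /= addrK [h *: 1]mulr1 [_ *: _]mulVf//.
  by near: h; exact: nbhs_dnbhs_neq.
have -> : 'D_time_dir (fun y => Psi y i j) z = 'D_time_dir Psi z i j.
  exact: derive_entry.
by rewrite mulr1 addrC -![_ *: _]/(_ * _) /= (mulrC (Psi z i j)).
Unshelve. all: by end_near. Qed.

Lemma continuous_mx_bounded_cube m k (f : spacetime -> 'M[R]_(m, k)) (a b : R) :
  continuous f -> exists2 M : R, 0 <= M &
    forall z, a <= z.1 <= b -> @unit_cube R d z.2 -> `|f z| <= M.
Proof.
move=> cf; have cn : continuous (fun z => `|f z|).
  by move=> z; apply: cvg_norm; exact: cf.
have [M M0 HM] := continuous_bounded_cube a b cn; exists M => // z zab zc.
by have := HM z zab zc; rewrite normr_id.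
Qed.

(** The linear decay at t = 0 that compensates the growth of [deta]. *)
Lemma vanishing_at_0_bound m k (f : spacetime -> 'M[R]_(m, k)) (T : R) :
  smooth f -> (forall x, f (0, x) = 0) -> exists2 M : R, 0 <= M &
    forall t x, 0 <= t <= T -> @unit_cube R d x -> `|f (t, x)| <= M * t.
Proof.
move=> sf f0; have sD := smooth_derive time_dir sf.
(* The interval is symmetric because [MVT_line] locates the intermediate time only up to sign. *)
have [M M0 HM] := continuous_mx_bounded_cube (- T) T (smooth_continuous sD).
exists M => // t x /andP[t0 tT] xc.
apply: mx_norm_le => [|i j]; first exact: mulr_ge0.
have sfij := smooth_entry i j sf.
have [c ct] := MVT_line (0, x) t (fun y => smooth_derivable sfij y time_dir).
have E s : s *: time_dir + (0, x) = (s, x) :> spacetime.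
  by congr pair; rewrite /= ?scaler0 ?add0r// addr0 [s *: 1]mulr1.
rewrite !E f0 mxE subr0 => ->; rewrite normrM mulrC (ger0_norm t0) ler_wpM2r//.
have -> : 'D_time_dir (fun z => f z i j) (c, x) = 'D_time_dir f (c, x) i j.
  exact: derive_entry.
rewrite (le_trans (mx_entry_le_norm _ _ _))// HM//=.
by rewrite -ler_norml (le_trans ct)// ger0_norm.
Qed.

End time_weighted_tests.

Section dual_certificate.
Context {R : realType} {d n N : nat}.
Variables (F : 'rV[R]_n -> 'M[R]_N) (L : @diff_operator R d n N).
Hypothesis SA : standing_assumptions F L.
Local Notation mu := (@spacetime_measure R d).
Local Notation cyl := (@cylinder R d).
Local Notation spacetime := (R * 'rV[R]_d)%type.
Local Notation K := (entropy F).
Local Notation Ks := (entropy_dual F).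

Variables (T T' M lam : R).
Variables (u D : spacetime -> 'rV[R]_n) (G : spacetime -> 'M[R]_N).
Local Notation w := (sharp F u).
Hypotheses (T'T : T' < T) (M0 : 0 <= M).
Hypotheses (lam0 : 0 < lam) (lamM : 4 * (N%:R * M) <= lam).
Hypothesis uK : in_Orlicz mu (cyl 0 T) K u.
Hypothesis wD : weak_time_derivative T w D.
Hypothesis wG : weak_adjoint L T w G.
Hypothesis sG : forall z, cyl 0 T z -> symmetric_mx (G z).
Hypothesis GM : {ae mu, forall z, cyl 0 T' z -> `|G z| <= M}.
Hypothesis equ : forall l, {ae mu, forall z, cyl 0 T z ->
  D z 0 l + mxdot (G z) ('D_(basis_vec l) F (u z)) = 0}.

Let mC : measurable (cyl 0 T : set (measurableTypeR R * 'rV[R]_d)).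
Proof. exact: measurable_cylinder. Qed.

Let subC : cyl 0 T' `<=` cyl 0 T.
Proof. by apply: cylinder_subset => //; exact: ltW. Qed.

Definition dual_B (z : spacetime) : 'M[R]_N := chi lam T' z.1 *: G z.

Definition dual_E (z : spacetime) : 'rV[R]_n :=
  chi lam T' z.1 *: D z + dchi lam T' z.1 *: w z.

Definition entropy_rate (z : spacetime) : R := - dchi lam T' z.1.

Lemma entropy_rate_gt0 z : z.1 < T' -> 0 < entropy_rate z.
Proof. by move=> zT; rewrite oppr_gt0 dchi_lt0. Qed.

Lemma dual_B_late z : T' <= z.1 -> dual_B z = 0.
Proof. by move=> zT; rewrite /dual_B chi_eq0// scale0r. Qed.

Lemma dual_E_late z : T' <= z.1 -> dual_E z = 0.
Proof. by move=> zT; rewrite /dual_E chi_eq0// dchi_eq0// !scale0r addr0. Qed.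

Lemma cylinder_cases z : cyl 0 T z -> cyl 0 T' z \/ T' <= z.1.
Proof.
move=> [/= zT _]; have [zT'|] := ltP z.1 T'; [left|by right].
by split => //=; move: zT; rewrite !in_itv/= zT' => /andP[-> _].
Qed.

Definition regular_point (z : spacetime) : Prop :=
  [/\ `|G z| <= M, Lambda L (G z), symmetric_mx (G z) &
    forall l, D z 0 l + mxdot (G z) ('D_(basis_vec l) F (u z)) = 0].

Lemma ae_regular : {ae mu, forall z, cyl 0 T' z -> regular_point z}.
Proof.
have H := ae_forall equ.
have HL := weak_adjoint_Lambda T'T wG sG GM.
apply: (ae_imply2 (ae_imply2 HL GM (fun z h1 h2 => conj h1 h2)) H).
move=> z [h1 h2] h3 zC; split; [exact: h2|exact: h1|exact/sG/subC|].
by move=> l; apply: h3; exact: subC.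
Qed.

Lemma regular_D z : regular_point z -> D z = flux_field F (G z) (u z).
Proof.
move=> [_ _ _ H]; apply/rowP => l; rewrite mxE mxdotC.
by apply/eqP; rewrite -addr_eq0 H.
Qed.

(** Since grad K is half the trace of the derivative of F, chi' w is the flux field of (- chi' / 2)
    I, while chi D is that of chi G. *)
Lemma regular_E z : regular_point z ->
  dual_E z = flux_field F ((entropy_rate z / 2)%:M + dual_B z) (u z).
Proof.
move=> rz; rewrite /dual_E (regular_D rz); apply/rowP => l.
rewrite !mxE (derive_entropy SA) mxdotDr mxdot_scalar mxdotZr /entropy_rate; lra.
Qed.

(** The choice of [lam] gives N chi M <= lam chi / 4 <= - chi' / 4. The case c = - chi' / 4 serves
    the convexity inequality, c = - chi' / 2 the bound on E. *)
Lemma regular_psd z (c : R) : regular_point z -> entropy_rate z / 4 <= c ->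
  Lambda_psd L (c%:M + dual_B z).
Proof.
move=> [GMz LG sGz _] hc.
have chi0 := chi_ge0 lam T' z.1; have chil := lam_chi_le lam T' z.1.
split; first by apply: LambdaD; [exact: Lambda1|exact: LambdaZ].
apply: (psd_scalar_addmx (M := chi lam T' z.1 * M)).
- exact: symmetric_mxZ.
- by rewrite /dual_B normrZ ger0_norm// ler_wpM2l.
- apply: le_trans hc; rewrite ler_pdivlMr// (le_trans _ chil)//.
  by rewrite mulrCA -mulrA mulrC ler_wpM2r// mulrC.
Qed.

Lemma dual_B_bound z : regular_point z -> 0 < z.1 -> `|dual_B z| <= M.
Proof.
move=> [GMz _ _ _] z0; rewrite /dual_B normrZ ger0_norm ?chi_ge0//.
rewrite -[leRHS]mul1r ler_pM ?chi_ge0//.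
by rewrite chi_le1// ltW.
Qed.

Lemma norm_scalar_mx_le (c : R) : `|c%:M : 'M[R]_N| <= `|c|.
Proof.
apply: mx_norm_le => // i j; rewrite mxE.
by case: eqP => _; rewrite ?mulr1n// mulr0n normr0.
Qed.

(** The common integrable majorant on the cylinder; being at least 1, it also absorbs constants. *)
Let e (z : spacetime) : R := K (u z) + 1.

Let e1 z : 1 <= e z.
Proof. by rewrite lerDr (entropy_ge0 SA). Qed.

Lemma entry_bound (C : R) : 0 <= C -> exists2 C' : R, 0 <= C' &
  forall y z, Ks y <= C * e z -> forall l, `|y 0 l| <= C' * e z.
Proof.
move=> C0; pose k := \sum_(l < n) K (basis_vec l).
have k0 : 0 <= k by apply: sumr_ge0 => l _; exact: (entropy_ge0 SA).
exists (C + k) => [|y z yz l]; first exact: addr_ge0.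
rewrite (le_trans (entry_le_Legendre (N_entropy SA) y l))// mulrDl lerD//.
apply: (@le_trans _ _ k); last by rewrite ler_peMr.
by rewrite /k (bigD1 l)//= lerDl sumr_ge0// => i _; exact: (entropy_ge0 SA).
Qed.

Lemma sharp_entry_bound : exists2 C : R, 0 <= C & forall z l, `|w z 0 l| <= C * e z.
Proof.
have [C C0 HC] := sharp_bound SA; have [C' C'0 HC'] := entry_bound C0.
by exists C' => // z; apply: HC'; exact: HC.
Qed.

(** [flux_field_bound] requires a nonnegative matrix and G is indefinite, so G is written as (c I +
    G) - c I with c = N M. *)
Lemma regular_D_bound : exists2 C : R, 0 <= C &
  forall z, regular_point z -> forall l, `|D z 0 l| <= C * e z.
Proof.
pose c := N%:R * M; have c0 : 0 <= c by exact: mulr_ge0.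
have cM0 : 0 <= c + M by exact: addr_ge0.
have [C C0 HC] := flux_field_bound SA cM0; have [C' C'0 HC'] := entry_bound C0.
exists (C' * 2) => [|z rz l]; first exact: mulr_ge0.
rewrite (regular_D rz); have [GMz LG sGz _] := rz.
have -> : flux_field F (G z) (u z) 0 l =
    flux_field F (c%:M + G z) (u z) 0 l - flux_field F c%:M (u z) 0 l.
  by rewrite !mxE mxdotDr; lra.
have psd1 : Lambda_psd L (c%:M + G z).
  split; first by apply: LambdaD => //; exact: Lambda1.
  exact: psd_scalar_addmx sGz GMz (lexx _).
have psd2 : Lambda_psd L (c%:M : 'M[R]_N).
  by split; [exact: Lambda1|exact: psd_scalar_mx].
have nc : `|c%:M : 'M[R]_N| <= c.
  by rewrite (le_trans (norm_scalar_mx_le _))// ger0_norm.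
have b1 : `|flux_field F (c%:M + G z) (u z) 0 l| <= C' * e z.
  by apply: HC'; apply: HC => //; rewrite (le_trans (ler_normD _ _))// lerD.
have b2 : `|flux_field F c%:M (u z) 0 l| <= C' * e z.
  by apply: HC'; apply: HC => //; rewrite (le_trans nc)// lerDl.
by rewrite (le_trans (ler_normB _ _))//; lra.
Qed.

Lemma dual_E_bound : exists2 C : R, 0 <= C & {ae mu, forall z, cyl 0 T z ->
  Ks (dual_E z) <= C * e z}.
Proof.
have lM0 : 0 <= (lam + 4) + M by rewrite !addr_ge0// ltW.
have [C C0 HC] := flux_field_bound SA lM0; exists C => //.
apply: (ae_imply ae_regular) => z rz zC.
have [zC'|zT] := cylinder_cases zC; last first.
  rewrite dual_E_late//; apply: (@le_trans _ _ 0).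
    by apply: Legendre_le => y; rewrite mxdot0l sub0r oppr_le0 (entropy_ge0 SA).
  by rewrite mulr_ge0// (le_trans ler01).
have {}rz := rz zC'; rewrite (regular_E rz).
have z0 : 0 < z.1 by case: zC' => /= + _; rewrite in_itv/= => /andP[].
have r0 : 0 <= entropy_rate z by rewrite oppr_ge0 dchi_le0// ltW.
apply: HC.
  by apply: regular_psd => //; lra.
rewrite (le_trans (ler_normD _ _))// lerD ?dual_B_bound//.
rewrite (le_trans (norm_scalar_mx_le _))// ger0_norm ?divr_ge0//.
have := dchi_bound T' (ltW lam0) (ltW z0); rewrite -normrN ger0_norm// -/(entropy_rate z).
lra.
Qed.

Lemma integrable_e : mu.-integrable (cyl 0 T) (EFin \o e).
Proof.
apply: integrableD_R => //; last exact: integrable_cst_cylinder.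
apply: ge0_integrable_R => //.
- by case: uK => mu_ _; apply: measurable_continuous_comp => //; case: (C1_entropy SA).
- by move=> z _; exact: (entropy_ge0 SA).
- by case: uK.
Qed.

Lemma measurable_sharp : measurable_fun (cyl 0 T) w.
Proof.
apply/measurable_mxP => // i l; rewrite ord1.
have -> : (fun z => w z 0 l) = (fun z => 'D_(basis_vec l) K (u z)).
  by apply/funext => z; rewrite mxE.
have [_ _ cK] := C1_entropy SA; have [mu_ _] := uK.
exact: measurable_continuous_comp (cK (basis_vec l)) mu_.
Qed.

Lemma dchi_continuous : continuous (dchi lam T').
Proof.
have -> : dchi lam T' = 'D_1 (chi lam T').
  by apply/funext => t; have [_ ->] := is_derive_chi lam T' t.
apply: smooth_continuous; apply: smooth_derive; exact: chi_smooth.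
Qed.

Lemma measurable_time (g : R -> R) : continuous g ->
  measurable_fun (cyl 0 T) (fun z => g z.1).
Proof.
move=> cg; apply: measurable_funTS; apply: continuous_measurable_spacetime.
move=> z; apply: continuous_comp; [exact: cvg_fst|exact: cg].
Qed.

Lemma measurable_mxZ m k (g : spacetime -> R) (A : spacetime -> 'M[R]_(m, k)) :
  measurable_fun (cyl 0 T) g -> measurable_fun (cyl 0 T) A ->
  measurable_fun (cyl 0 T) (fun z => g z *: A z).
Proof.
move=> mg /(measurable_mxP _ mC) mA; apply/measurable_mxP => // i j.
have -> : (fun z => (g z *: A z) i j) = (fun z => g z * A z i j).
  by apply/funext => z; rewrite mxE.
by apply: measurable_funM; [exact: mg|exact: mA].
Qed.

Lemma measurable_D : measurable_fun (cyl 0 T) D.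
Proof. by case: wD => _ lD _; exact: locally_integrable_measurable. Qed.

Lemma measurable_dual_B : measurable_fun (cyl 0 T) dual_B.
Proof.
apply: measurable_mxZ; last exact: (measurable_weak_adjoint wG).
by apply: measurable_time; apply: smooth_continuous; exact: chi_smooth.
Qed.

Lemma measurable_dual_E : measurable_fun (cyl 0 T) dual_E.
Proof.
apply/measurable_mxP => // i l.
have -> : (fun z => dual_E z i l) =
    (fun z => (chi lam T' z.1 *: D z) i l + (dchi lam T' z.1 *: w z) i l).
  by apply/funext => z; rewrite [LHS]mxE.
have chiD : measurable_fun (cyl 0 T) (fun z => chi lam T' z.1 *: D z).
  apply: measurable_mxZ; last exact: measurable_D.
  by apply: measurable_time; apply: smooth_continuous; exact: chi_smooth.
have chiw : measurable_fun (cyl 0 T) (fun z => dchi lam T' z.1 *: w z).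
  apply: measurable_mxZ; last exact: measurable_sharp.
  by apply: (measurable_time (g := dchi lam T')); exact: dchi_continuous.
move/(measurable_mxP _ mC) : chiD => /(_ i l) chiD.
move/(measurable_mxP _ mC) : chiw => /(_ i l) chiw.
by apply: measurable_funD; [exact: chiD|exact: chiw].
Qed.

Lemma integrable_by_entropy (C : R) (f : spacetime -> R) :
  measurable_fun (cyl 0 T) f -> {ae mu, forall z, cyl 0 T z -> `|f z| <= C * e z} ->
  mu.-integrable (cyl 0 T) (EFin \o f).
Proof.
move=> mf bf; apply: (integrable_dominated _ _ _ bf) => //.
by apply: integrableZ_R => //; exact: integrable_e.
Qed.

Lemma in_Orlicz_dual_E : in_Orlicz mu (cyl 0 T) Ks dual_E.
Proof.
split; first exact: measurable_dual_E.
have mKs : measurable_fun (cyl 0 T) (fun z => Ks (dual_E z)).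
  apply: measurableT_comp; last exact: measurable_dual_E.
  exact: (measurable_Legendre (N_entropy SA)).
have [C C0 HC] := dual_E_bound.
have I : mu.-integrable (cyl 0 T) (EFin \o (fun z => Ks (dual_E z))).
  apply: (@integrable_by_entropy C) => //; apply: (ae_imply HC) => z Hz zC.
  by rewrite ger0_norm ?Hz// (Legendre_ge0 (N_entropy SA)).
have := integrable_lty mC I; exact.
Qed.

Lemma in_Linfty_dual_B_bound : {ae mu, forall z, cyl 0 T z -> `|dual_B z| <= M}.
Proof.
apply: (ae_imply ae_regular) => z rz zC.
have [zC'|zT] := cylinder_cases zC; last by rewrite dual_B_late// normr0.
have z0 : 0 < z.1 by case: zC' => /= + _; rewrite in_itv/= => /andP[].
exact: dual_B_bound (rz zC') z0.
Qed.

Lemma dual_B_Lambda : {ae mu, forall z, cyl 0 T z -> Lambda L (dual_B z)}.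
Proof.
apply: (ae_imply ae_regular) => z rz zC; have [zC'|zT] := cylinder_cases zC.
  by apply: LambdaZ; case: (rz zC').
by rewrite dual_B_late// => S _ _; exact: mem0v.
Qed.

Lemma in_Linfty_dual_B : in_Linfty_sym mu (cyl 0 T) dual_B.
Proof.
split; first exact: measurable_dual_B.
  by move=> z zC; apply: symmetric_mxZ; exact: sG.
by exists M; exact: in_Linfty_dual_B_bound.
Qed.

Let theta k (t : R) : R := eta k t * chi lam T' t.
Let dtheta k (t : R) : R := deta k t * chi lam T' t + eta k t * dchi lam T' t.

Let theta_smooth k : smooth (theta k).
Proof. by apply: smooth_mul; [exact: eta_smooth|exact: chi_smooth]. Qed.

Let is_derive_theta k (t : R) : is_derive t (1 : R) (theta k) (dtheta k t).
Proof.
have [H1 H2] := is_deriveM (is_derive_eta k t) (is_derive_chi lam T' t).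
split; first exact: H1.
by apply: etrans H2 _; rewrite /dtheta -![_ *: _]/(_ * _); ring.
Qed.

Let theta_supp k t : ~ (k.+1%:R^-1 <= t <= T') -> theta k t = 0 /\ dtheta k t = 0.
Proof.
move=> /negP; rewrite negb_and -!ltNge /theta /dtheta => /orP[tk|tT].
  by rewrite eta_eq0 ?deta_eq0 ?ltW// !mul0r addr0.
by rewrite chi_eq0 ?dchi_eq0 ?ltW// !mulr0 addr0.
Qed.

(* Test functions of the constraint vanish at time 0 but are not supported away
   from it; the factor [eta k] in [theta k] cuts them off near 0. *)
Lemma regularized_constraint k (Psi : spacetime -> 'M[R]_N) :
  smooth_spacetime Psi -> (forall z, symmetric_mx (Psi z)) ->
  let X z := theta k z.1 * mxdot (G z) (time_derive Psi z) +
    (theta k z.1 * mxdot (D z) (op_slice L Psi z) +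
     dtheta k z.1 * mxdot (w z) (op_slice L Psi z)) in
  mu.-integrable (cyl 0 T) (EFin \o X) /\ \int[mu]_(z in cyl 0 T) X z = 0.
Proof.
move=> sP symP X; have sP1 := sP.1.
have sPt : smooth_spacetime (time_derive Psi).
  by rewrite time_deriveE; exact: smooth_spacetime_derive.
have symPt z : symmetric_mx (time_derive Psi z).
  apply/matrixP => i j; rewrite time_deriveE mxE -!(derive_entry _ _ _ _ sP1).
  by congr ('D_time_dir _ z); apply/funext => y; rewrite -[in RHS](symP y) mxE.
have sLP := smooth_op_slice L sP.
have LPt := op_slice_time_derive L sP1.
have k0 : 0 < k.+1%:R^-1 :> R by rewrite invr_gt0.
have supp : exists a b, [/\ 0 < a, b < T &
    forall t, ~ (a <= t <= b) -> theta k t = 0].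
  by exists k.+1%:R^-1, T'; split => // t /theta_supp[].
(* The relation for G is tested with theta d_t Psi and the one for D with theta L Psi. As L commutes
   with d_t and with theta, the terms containing w and d_t L Psi cancel, leaving only the one with
   theta'. *)
pose phi1 z := theta k z.1 *: time_derive Psi z.
pose phi2 z := theta k z.1 *: op_slice L Psi z.
have t1 : test_function T phi1 by exact: test_time_scale.
have t2 : test_function T phi2 by exact: test_time_scale.
have [_ lG wGE] := wG; have [lw lD wDE] := wD.
have op1 : op_slice L phi1 = fun z => theta k z.1 *: time_derive (op_slice L Psi) z.
  by rewrite /phi1 (op_slice_time_scale L (theta k) sPt.1) LPt.
have dphi2 := time_derive_scale (theta_smooth k) (is_derive_theta k) sLP.1.
have st1 := t1.1.1; have st2 := t2.1.1.
have sop1 : smooth (op_slice L phi1) by apply: (smooth_op_slice L t1.1).1.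
have sd2 : smooth (time_derive phi2) by rewrite time_deriveE; exact: smooth_derive.
have suppW (W : lmodType R) (g : spacetime -> W) :
    (forall z, theta k z.1 = 0 -> dtheta k z.1 = 0 -> g z = 0) ->
    exists a b, [/\ 0 < a, b < T & forall t x, ~ (a <= t <= b) -> g (t, x) = 0].
  move=> g0; exists k.+1%:R^-1, T'; split => // t x /theta_supp[h1 h2].
  exact: g0.
have supp1 : exists a b, [/\ 0 < a, b < T &
    forall t x, ~ (a <= t <= b) -> op_slice L phi1 (t, x) = 0].
  by apply: suppW => z h1 _; rewrite op1 h1 scale0r.
have supp2 : exists a b, [/\ 0 < a, b < T &
    forall t x, ~ (a <= t <= b) -> time_derive phi2 (t, x) = 0].
  by apply: suppW => z h1 h2; rewrite dphi2 h1 h2 !scale0r addr0.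
have [I1 E1] := pairing_integral lw (smooth_continuous sop1) supp1.
have [I2 E2] := pairing_integral lw (smooth_continuous sd2) supp2.
have [I3 E3] := pairing_integral lG (smooth_continuous st1) t1.2.
have [I4 E4] := pairing_integral lD (smooth_continuous st2) t2.2.
have wG1 : pairing T w (op_slice L phi1) = pairing T G phi1.
  by apply: wGE => // z; exact: symmetric_mxZ.
have wD2 := wDE phi2 t2; rewrite E2 E4 in wD2; rewrite E1 E3 in wG1.
have I5 := integrableB_R mC I2 I1.
have I6 := integrableD_R mC I4 I5.
have I7 := integrableD_R mC I3 I6.
have XE : X = fun z => mxdot (G z) (phi1 z) + (mxdot (D z) (phi2 z) +
    (mxdot (w z) (time_derive phi2 z) - mxdot (w z) (op_slice L phi1 z))).
  apply/funext => z; rewrite /X /phi1 /phi2 op1 dphi2 mxdotDr !mxdotZr; ring.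
rewrite XE; split; first exact: I7.
rewrite RintegralD// RintegralD// RintegralB// wD2 -wG1; ring.
Qed.

Lemma cylinder_time z : cyl 0 T z -> 0 < z.1 < T.
Proof. by case=> /= + _; rewrite in_itv. Qed.

Lemma pair_integrands (Psi : spacetime -> 'M[R]_N) : smooth_spacetime Psi ->
  mu.-integrable (cyl 0 T) (EFin \o (fun z => mxdot (dual_B z) (time_derive Psi z))) /\
  mu.-integrable (cyl 0 T) (EFin \o (fun z => mxdot (dual_E z) (op_slice L Psi z))).
Proof.
move=> sP; have sPt : smooth (time_derive Psi).
  by rewrite time_deriveE; exact: smooth_derive sP.1.
have sLP := (smooth_op_slice L sP).1.
have [M1 M10 HM1] := continuous_mx_bounded_cube 0 T (smooth_continuous sPt).
have [M2 M20 HM2] := continuous_mx_bounded_cube 0 T (smooth_continuous sLP).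
have mcont m k (f : spacetime -> 'M[R]_(m, k)) : smooth f -> measurable_fun (cyl 0 T) f.
  move=> sf; apply/measurable_mxP => // i j; apply: measurable_funTS.
  apply: continuous_measurable_spacetime.
  exact/continuous_entry/smooth_continuous.
split.
- apply: (@integrable_by_entropy ((N * N)%:R * M * M1)).
    by apply: measurable_fun_mxdot => //; [exact: measurable_dual_B|exact: mcont].
  apply: (ae_imply2 in_Linfty_dual_B_bound (@ae_spacetime_cube R d)).
  move=> z BM zc zC; rewrite (le_trans (mxdot_norm_le _ _))//.
  apply: (@le_trans _ _ ((N * N)%:R * M * M1)).
    have /andP[z0 zT] := cylinder_time zC.
    have b1 : `|time_derive Psi z| <= M1 by apply: HM1; rewrite ?(ltW z0) ?(ltW zT).
    by rewrite ler_pM// ?mulr_ge0// ler_wpM2l// BM.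
  by rewrite ler_peMr ?e1// !mulr_ge0.
- have [C C0 HC] := dual_E_bound; have [C' C'0 HC'] := entry_bound C0.
  apply: (@integrable_by_entropy ((1 * n)%:R * C' * M2)).
    by apply: measurable_fun_mxdot => //; [exact: measurable_dual_E|exact: mcont].
  apply: (ae_imply2 HC (@ae_spacetime_cube R d)) => z KE zc zC.
  rewrite (le_trans (mxdot_norm_le _ _))// [leRHS]mulrAC.
  have /andP[z0 zT] := cylinder_time zC.
  have ez0 : 0 <= e z by rewrite (le_trans ler01).
  have b2 : `|op_slice L Psi z| <= M2 by apply: HM2; rewrite ?(ltW z0) ?(ltW zT).
  rewrite ler_pM// ?mulr_ge0//.
  rewrite -[leRHS]mulrA ler_wpM2l//; apply: mx_norm_le => [|i l]; first exact: mulr_ge0.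
  by rewrite ord1; apply: HC'; exact: KE.
Qed.

(** Let k tend to infinity in [regularized_constraint]: theta tends to chi and theta' to chi'.
    Domination by a multiple of [e] holds because Psi, hence L Psi, vanishes at time 0. *)
Lemma constraint_dual : constraint L T dual_E dual_B.
Proof.
move=> Psi sP symP P0.
have sPt : smooth (time_derive Psi).
  by rewrite time_deriveE; exact: smooth_derive sP.1.
have sLP := (smooth_op_slice L sP).1.
have [IB IE] := pair_integrands sP.
pose X z := mxdot (dual_B z) (time_derive Psi z) + mxdot (dual_E z) (op_slice L Psi z).
suff X0 : \int[mu]_(z in cyl 0 T) X z = 0.
  have [J1 E1] := integral_slices IB; have [J2 E2] := integral_slices IE.
  rewrite /inner_torus /time_slice.
  by rewrite RintegralD// E1 E2 -RintegralD.
pose X_ k z := theta k z.1 * mxdot (G z) (time_derive Psi z) +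
    (theta k z.1 * mxdot (D z) (op_slice L Psi z) +
     dtheta k z.1 * mxdot (w z) (op_slice L Psi z)).
have HX k := regularized_constraint k sP symP.
have [M1 M10 HM1] := continuous_mx_bounded_cube 0 T (smooth_continuous sPt).
have [M2 M20 HM2] := continuous_mx_bounded_cube 0 T (smooth_continuous sLP).
have [M3 M30 HM3] := vanishing_at_0_bound T sLP (op_slice0 L P0).
have [CD CD0 HCD] := regular_D_bound; have [Cw Cw0 HCw] := sharp_entry_bound.
pose C := (N * N)%:R * M * M1 + ((1 * n)%:R * CD * M2 +
  (1 * n)%:R * Cw * (5 * M3 + (lam + 4) * M2)).
have lam4 : 0 <= lam + 4 by rewrite addr_ge0// ltW.
have bound : {ae mu, forall z, cyl 0 T z -> forall k, `|X_ k z| <= C * e z}.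
  apply: (ae_imply2 ae_regular (@ae_spacetime_cube R d)) => z rz zc zC k.
  have /andP[z0 zT] := cylinder_time zC.
  have ez0 : 0 <= e z by rewrite (le_trans ler01).
  have [zC'|zT'] := cylinder_cases zC; last first.
    rewrite /X_ /theta /dtheta chi_eq0// dchi_eq0// !mulr0 addr0 !mul0r !addr0.
    by rewrite normr0 mulr_ge0// /C !addr_ge0// !mulr_ge0// addr_ge0// mulr_ge0.
  have {}rz := rz zC'; have [GMz _ _ _] := rz.
  have zT0 : 0 <= z.1 <= T by rewrite !ltW.
  have b1 := HM1 z zT0 zc; have b2 := HM2 z zT0 zc.
  have b3 : `|op_slice L Psi z| <= M3 * z.1.
    by have := HM3 z.1 z.2 zT0 zc; case: (z).
  have chi1 : `|chi lam T' z.1| <= 1.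
    by rewrite ger0_norm ?chi_ge0// chi_le1// ltW.
  have th1 : `|theta k z.1| <= 1.
    by rewrite normrM -[leRHS]mulr1 ler_pM ?eta_bound.
  have nD : `|D z| <= CD * e z.
    by apply: mx_norm_le => [|i l]; [exact: mulr_ge0|rewrite ord1; exact: HCD].
  have nw : `|w z| <= Cw * e z.
    by apply: mx_norm_le => [|i l]; [exact: mulr_ge0|rewrite ord1; exact: HCw].
  (* The only singular term: [deta] is at most 5 / t and L Psi at most M3 t, uniformly in k. *)
  have dth : `|dtheta k z.1| * `|op_slice L Psi z| <= 5 * M3 + (lam + 4) * M2.
    apply: (@le_trans _ _ ((`|deta k z.1| + (lam + 4)) * `|op_slice L Psi z|)).
      rewrite ler_wpM2r// (le_trans (ler_normD _ _))//.
      rewrite (normrM (deta k z.1)) (normrM (eta k z.1)) lerD//.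
        by rewrite ler_piMr.
      rewrite -[leRHS]mul1r ler_pM ?eta_bound//.
      by rewrite dchi_bound// ltW.
    rewrite mulrDl lerD//; last by rewrite ler_wpM2l.
    apply: (@le_trans _ _ (`|deta k z.1| * (M3 * z.1))); first by rewrite ler_wpM2l.
    rewrite mulrCA mulrC ler_wpM2r//.
    have := deta_bound k z.1; rewrite normrM (ger0_norm (ltW z0)) mulrC.
    exact.
  rewrite /X_ (le_trans (ler_normD _ _))// /C [leRHS]mulrDl lerD//.
    rewrite normrM; apply: (@le_trans _ _ ((N * N)%:R * M * M1)); last first.
      by rewrite ler_peMr ?e1// !mulr_ge0.
    rewrite -[leRHS]mul1r ler_pM// (le_trans (mxdot_norm_le _ _))//.
    by rewrite ler_pM// ?mulr_ge0// ler_wpM2l.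
  rewrite (le_trans (ler_normD _ _))// [leRHS]mulrDl lerD//.
    rewrite normrM -[leRHS]mul1r ler_pM// (le_trans (mxdot_norm_le _ _))//.
    rewrite [leRHS]mulrAC ler_pM// ?mulr_ge0//.
    by rewrite -[leRHS]mulrA ler_wpM2l.
  rewrite normrM (le_trans (ler_wpM2l _ (mxdot_norm_le _ _)))//.
  rewrite [leLHS]mulrCA [leRHS]mulrAC ler_pM// ?mulr_ge0//.
  by rewrite -[leRHS]mulrA ler_wpM2l.
have mX : measurable_fun (cyl 0 T) X.
  by apply: measurable_funD; apply/measurable_EFinP; [exact: measurable_int IB|exact: measurable_int IE].
have mX_ k : measurable_fun (cyl 0 T) (X_ k).
  by apply/measurable_EFinP; have [I _] := HX k; exact: measurable_int I.
have lim : {ae mu, forall z, cyl 0 T z -> X_ k z @[k --> \oo] --> X z}.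
  apply/aeW => z zC; have /andP[z0 _] := cylinder_time zC.
  have -> : X z = (1 * chi lam T' z.1) * mxdot (G z) (time_derive Psi z) +
    ((1 * chi lam T' z.1) * mxdot (D z) (op_slice L Psi z) +
     (0 * chi lam T' z.1 + 1 * dchi lam T' z.1) * mxdot (w z) (op_slice L Psi z)).
    rewrite /X /dual_B /dual_E mxdotDl !mxdotZl; ring.
  have lth : theta k z.1 @[k --> \oo] --> 1 * chi lam T' z.1.
    by apply: cvgM; [exact: cvg_eta|exact: cvg_cst].
  have ldth : dtheta k z.1 @[k --> \oo] --> 0 * chi lam T' z.1 + 1 * dchi lam T' z.1.
    apply: cvgD; apply: cvgM; try exact: cvg_cst.
      exact: cvg_deta.
    exact: cvg_eta.
  apply: cvgD; first by apply: cvgM lth _; exact: cvg_cst.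
  apply: cvgD; first by apply: cvgM lth _; exact: cvg_cst.
  by apply: cvgM ldth _; exact: cvg_cst.
have Ie : mu.-integrable (cyl 0 T) (EFin \o (fun z => C * e z)).
  by apply: integrableZ_R => //; exact: integrable_e.
have [_ H] := dominated_convergence_R mC mX_ mX lim Ie bound.
apply: (cvg_unique _ H); first exact: Rhausdorff.
have -> : (fun k => \int[mu]_(z in cyl 0 T) X_ k z) = fun=> 0.
  by apply/funext => k; have [_] := HX k.
exact: cvg_cst.
Qed.

Lemma dual_certificate : exists E B,
  [/\ in_Orlicz mu (cyl 0 T) Ks E, in_Linfty_sym mu (cyl 0 T) B,
      {ae mu, forall z, cyl 0 T z -> Lambda L (B z)}, constraint L T E B &
      {ae mu, forall z, cyl 0 T z -> forall y,
        entropy_rate z / 2 * (K y - K (u z) - mxdot (grad K (u z)) (y - u z)) <=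
        mxdot (y - u z) (E z) + mxdot (F y - F (u z)) (B z)
          + entropy_rate z * (K y - K (u z))}].
Proof.
exists dual_E, dual_B; split.
- exact: in_Orlicz_dual_E.
- exact: in_Linfty_dual_B.
- exact: dual_B_Lambda.
- exact: constraint_dual.
apply: (ae_imply ae_regular) => z rz zC y.
have [zC'|zT] := cylinder_cases zC; last first.
  rewrite /entropy_rate dchi_eq0// dual_E_late// dual_B_late// !mxdot0r.
  by rewrite oppr0 !mul0r !addr0.
rewrite [mxdot _ (dual_E z)]mxdotC (regular_E (rz zC')).
apply: (relative_entropy_inequality SA).
exact: regular_psd (rz zC') (lexx _).
Qed.

End dual_certificate.

(** * Uniqueness of strong solutions *)

Section strong_uniqueness.
Context {R : realType} {d n N : nat}.
Variables (F : 'rV[R]_n -> 'M[R]_N) (L : @diff_operator R d n N).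
Hypothesis SA : standing_assumptions F L.
Local Notation leb := (@lebesgue_measure R).
Local Notation mu := (@spacetime_measure R d).
Local Notation cyl := (@cylinder R d).
Local Notation spacetime := (R * 'rV[R]_d)%type.
Local Notation K := (entropy F).
Local Notation Ks := (entropy_dual F).

Variables (T : R) (h : R -> R) (v0 : 'rV[R]_d -> 'rV[R]_n).
Hypotheses (T0 : 0 < T) (wh : weight T h) (v0K : in_Orlicz (torus d) setT K v0).

Let mC : measurable (cyl 0 T : set (measurableTypeR R * 'rV[R]_d)).
Proof. exact: measurable_cylinder. Qed.

(** Dividing by [H], which is positive before T and at least q = c (T - T') before T', transfers
    symmetry and boundedness from H G to G. The equation is rewritten at u through grad K^* (grad
    K(u)) = u. *)
Lemma strong_solution_regularity (u : spacetime -> 'rV[R]_n) (T' : R) :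
  strong_solution F L T h v0 u -> T' < T ->
  exists D G, exists2 M : R, 0 <= M &
    [/\ weak_time_derivative T (sharp F u) D, weak_adjoint L T (sharp F u) G,
        forall z, cyl 0 T z -> symmetric_mx (G z),
        {ae mu, forall z, cyl 0 T' z -> `|G z| <= M} &
        forall l, {ae mu, forall z, cyl 0 T z ->
          D z 0 l + mxdot (G z) ('D_(basis_vec l) F (u z)) = 0}].
Proof.
move=> [_ _ [D [G [wD wG [_ sHG [C HC]] eqn]]] _] T'T; exists D, G.
have [c c0 Hc] := cumulated_weight_ge wh.
pose q := c * (T - T'); have q0 : 0 < q by rewrite mulr_gt0// subr_gt0.
exists (`|C| / q); first by rewrite divr_ge0// ltW.
split; [exact: wD|exact: wG| | |].
- move=> z zC; have := sHG z zC => /(symmetric_mxZ (cumulated_weight T h z.1)^-1).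
  rewrite scalerA mulVf ?scale1r// gt_eqF//.
  have : 0 < z.1 < T by case: zC => /= + _; rewrite in_itv.
  move=> /andP[z0 zT]; apply: lt_le_trans (Hc z.1 _); last by rewrite !ltW.
  by rewrite mulr_gt0// subr_gt0.
- apply: (ae_imply HC) => z Hz zC'.
  have zC : cyl 0 T z by apply: cylinder_subset zC' => //; exact: ltW.
  have : 0 < z.1 < T' by case: zC' => /= + _; rewrite in_itv.
  move=> /andP[z0 zT']; rewrite ler_pdivlMr//.
  have qH : q <= cumulated_weight T h z.1.
    apply: le_trans (Hc z.1 _); last by rewrite !ltW// (lt_trans zT').
    by rewrite ler_wpM2l ?(ltW c0)// lerD2l lerN2 ltW.
  apply: le_trans (le_trans (Hz zC) (ler_norm C)); rewrite normrZ mulrC.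
  by rewrite ler_wpM2r// (le_trans qH)// ler_norm.
- move=> l; apply: (ae_imply (eqn l)) => z Hz zC.
  by have := Hz zC; rewrite /sharp (grad_sharp SA).
Qed.

Lemma integrable_initial : mu.-integrable (cyl 0 T) (EFin \o (fun z => K (v0 z.2))).
Proof.
have [mv0 Iv0] := v0K.
have mK : measurable_fun setT (fun x => K (v0 x)).
  by apply: measurable_continuous_comp => //; case: (C1_entropy SA).
have K0 := entropy_ge0 SA.
apply: ge0_integrable_R => //.
  by apply: measurable_funTS; apply: (measurableT_comp mK).
rewrite integral_mkcond.
pose g : measurableTypeR R * 'rV[R]_d -> \bar R :=
  (fun z => (K (v0 z.2))%:E) \_ (cyl 0 T).
have mg : measurable_fun setT g.
  apply/(measurable_restrictT _ mC)/measurable_EFinP/measurable_funTS.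
  exact: (measurableT_comp mK).
have g0 z : (0 <= g z)%E by rewrite /g patchE; case: ifP; rewrite ?lee_fin.
rewrite -/g [ltLHS](@fubini_tonelli1 _ _ _ _ _ leb (torus d) g mg g0).
pose I := (\int[torus d]_x (K (v0 x))%:E)%E.
have I0 : (0 <= I)%E by apply: integral_ge0 => x _; rewrite lee_fin.
have -> : (\int[leb]_t fubini_F (torus d) g t = \int[leb]_(t in `]0%R, T[) I)%E.
  rewrite [RHS]integral_mkcond; apply: eq_integral => t _.
  rewrite /fubini_F patchE; case: ifPn => tT.
    apply: eq_integral => x _; rewrite /g patchE mem_set//; split => //=.
    by rewrite inE in tT.
  rewrite integral0_eq// => x _; rewrite /g patchE memNset// => -[/= tT' _].
  by move/negP: tT; apply; rewrite inE.
have Ifin : I \is a fin_num by rewrite ge0_fin_numE.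
rewrite -(fineK Ifin) integral_cst// [X in (_ * X)%E]lebesgue_measure_itv/=.
by rewrite lte_fin T0 -EFinM ltry.
Qed.

(** The Young inequality for E and for - E, the dual being even. *)
Lemma integrable_Orlicz_pair (v E : spacetime -> 'rV[R]_n) :
  measurable_fun (cyl 0 T) v -> measurable_fun (cyl 0 T) E ->
  mu.-integrable (cyl 0 T) (EFin \o (fun z => K (v z))) ->
  mu.-integrable (cyl 0 T) (EFin \o (fun z => Ks (E z))) ->
  mu.-integrable (cyl 0 T) (EFin \o (fun z => mxdot (v z) (E z))).
Proof.
move=> mv mE Iv IE.
apply: (integrable_dominated (g := fun z => K (v z) + Ks (E z)) mC) => //.
- exact: measurable_fun_mxdot.
- exact: integrableD_R.
apply/aeW => z _; rewrite mxdotC ler_norml; apply/andP; split.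
  have := Legendre_young (N_entropy SA) (- E z) (v z).
  by rewrite mxdotNl (LegendreN (N_entropy SA)) /entropy_dual; lra.
exact: (Legendre_young (N_entropy SA)).
Qed.

Lemma Orlicz_integrable (v : spacetime -> 'rV[R]_n) :
  in_Orlicz mu (cyl 0 T) K v -> mu.-integrable (cyl 0 T) (EFin \o (fun z => K (v z))).
Proof.
move=> [mv Iv]; apply: ge0_integrable_R => //.
  by apply: measurable_continuous_comp => //; case: (C1_entropy SA).
by move=> z _; exact: (entropy_ge0 SA).
Qed.

Lemma Orlicz_dual_integrable (E : spacetime -> 'rV[R]_n) :
  in_Orlicz mu (cyl 0 T) Ks E -> mu.-integrable (cyl 0 T) (EFin \o (fun z => Ks (E z))).
Proof.
move=> [mE IE]; apply: ge0_integrable_R => //.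
  apply: measurableT_comp mE; exact: (measurable_Legendre (N_entropy SA)).
by move=> z _; exact: (Legendre_ge0 (N_entropy SA)).
Qed.

(** Besides passing to space-time integrals, this secures the integrability of F(v) : B. The growth
    bound of F : A by K is available for A in [Lambda], which is why the certificate records where B
    takes its values. *)
Lemma weak_solution_identity (v E : spacetime -> 'rV[R]_n)
    (B : spacetime -> 'M[R]_N) : weak_solution F L T v0 v ->
  in_Orlicz mu (cyl 0 T) Ks E -> in_Linfty_sym mu (cyl 0 T) B ->
  {ae mu, forall z, cyl 0 T z -> Lambda L (B z)} -> constraint L T E B ->
  let X z := mxdot (v z - v0 z.2) (E z) + mxdot (F (v z)) (B z) in
  mu.-integrable (cyl 0 T) (EFin \o X) /\ \int[mu]_(z in cyl 0 T) X z = 0.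
Proof.
move=> [vK Hv] EK BL LB cEB X; have := Hv E B EK BL cEB.
have [mv _] := vK; have [mE _] := EK; have [mB sB [M BM]] := BL.
have [mv0 _] := v0K.
have mv0' : measurable_fun (cyl 0 T) (fun z => v0 z.2).
  by apply: measurable_funTS; apply: (measurableT_comp mv0).
have IE := Orlicz_dual_integrable EK.
have I1 := integrable_Orlicz_pair mv mE (Orlicz_integrable vK) IE.
have I2 := integrable_Orlicz_pair mv0' mE integrable_initial IE.
have I3 : mu.-integrable (cyl 0 T) (EFin \o (fun z => mxdot (v z - v0 z.2) (E z))).
  have := integrableB_R mC I1 I2; apply: eq_integrable => // z _ /=.
  by rewrite mxdotBl.
have [k k0 Hk] := flux_mxdot_bound SA (normr_ge0 M).
have mFv : measurable_fun (cyl 0 T) (fun z => F (v z)).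
  apply/measurable_mxP => // i j.
  apply: (measurable_continuous_comp (g := fun y => F y i j)) => //.
  by apply: continuous_entry; exact: (flux_continuous SA).
have I4 : mu.-integrable (cyl 0 T) (EFin \o (fun z => mxdot (F (v z)) (B z))).
  apply: (integrable_dominated (g := fun z => 2 ^+ k * (K (v z) + 1)) mC) => //.
  - exact: measurable_fun_mxdot.
  - apply: integrableZ_R => //; apply: integrableD_R => //.
      exact: Orlicz_integrable.
    exact: integrable_cst_cylinder.
  - apply: (ae_imply2 LB BM) => z h1 h2 zC; apply: Hk; [exact: h1|exact: sB|].
    by rewrite (le_trans (h2 zC))// ler_norm.
have [J1 E1] := integral_slices I3; have [J2 E2] := integral_slices I4.
rewrite /inner_torus /time_slice RintegralD// [X in X + _]E1 [X in _ + X]E2.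
rewrite -RintegralD// => X0; split => //; exact: integrableD_R.
Qed.

Lemma strong_solutions_ae_eq (u v : spacetime -> 'rV[R]_n) (T' : R) :
  strong_solution F L T h v0 u -> strong_solution F L T h v0 v ->
  T' < T -> {ae mu, forall z, cyl 0 T' z -> u z = v z}.
Proof.
move=> su sv T'T.
have [wu _ _ _] := su; have [wv _ _ _] := sv.
have [D1 [G1 [M1 M10 [wD1 wG1 sG1 GM1 eq1]]]] := strong_solution_regularity su T'T.
have [D2 [G2 [M2 M20 [wD2 wG2 sG2 GM2 eq2]]]] := strong_solution_regularity sv T'T.
pose M := Num.max M1 M2; have M0 : 0 <= M by rewrite le_max M10.
have GM1' : {ae mu, forall z, cyl 0 T' z -> `|G1 z| <= M}.
  by apply: (ae_imply GM1) => z Hz zC; rewrite le_max Hz.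
have GM2' : {ae mu, forall z, cyl 0 T' z -> `|G2 z| <= M}.
  by apply: (ae_imply GM2) => z Hz zC; rewrite le_max Hz// orbT.
(* One [lam] serves both certificates, so that they share the rate - chi' and the entropy
   differences cancel. The [+ 1] keeps it positive when N M = 0. *)
pose lam := 4 * (N%:R * M) + 1.
have lamM : 4 * (N%:R * M) <= lam by rewrite lerDl.
have lam0 : 0 < lam by rewrite ltr_wpDl// !mulr_ge0.
have [E1 [B1 [EK1 BL1 LB1 c1 ineq1]]] :=
  dual_certificate SA T'T M0 lam0 lamM wu.1 wD1 wG1 sG1 GM1' eq1.
have [E2 [B2 [EK2 BL2 LB2 c2 ineq2]]] :=
  dual_certificate SA T'T M0 lam0 lamM wv.1 wD2 wG2 sG2 GM2' eq2.
have [I1 Z1] := weak_solution_identity wv EK1 BL1 LB1 c1.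
have [I2 Z2] := weak_solution_identity wu EK1 BL1 LB1 c1.
have [I3 Z3] := weak_solution_identity wu EK2 BL2 LB2 c2.
have [I4 Z4] := weak_solution_identity wv EK2 BL2 LB2 c2.
(* Each certificate is tested on both solutions; subtracting the two identities eliminates the
   common datum. *)
pose X1 z := mxdot (v z - v0 z.2) (E1 z) + mxdot (F (v z)) (B1 z) -
  (mxdot (u z - v0 z.2) (E1 z) + mxdot (F (u z)) (B1 z)).
pose X2 z := mxdot (u z - v0 z.2) (E2 z) + mxdot (F (u z)) (B2 z) -
  (mxdot (v z - v0 z.2) (E2 z) + mxdot (F (v z)) (B2 z)).
have IX1 : mu.-integrable (cyl 0 T) (EFin \o X1) by exact: integrableB_R.
have IX2 : mu.-integrable (cyl 0 T) (EFin \o X2) by exact: integrableB_R.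
have IY := integrableD_R mC IX1 IX2.
have X1E z : X1 z = mxdot (v z - u z) (E1 z) + mxdot (F (v z) - F (u z)) (B1 z).
  by rewrite /X1 !mxdotBl; ring.
have X2E z : X2 z = mxdot (u z - v z) (E2 z) + mxdot (F (u z) - F (v z)) (B2 z).
  by rewrite /X2 !mxdotBl; ring.
have Y0 : \int[mu]_(z in cyl 0 T) (X1 z + X2 z) <= 0.
  rewrite (RintegralD mC IX1 IX2) (RintegralB mC I1 I2) (RintegralB mC I3 I4).
  by rewrite Z1 Z2 Z3 Z4 !subrr addr0.
pose r (z : spacetime) := entropy_rate T' lam z.
pose S1 z := K (v z) - K (u z) - mxdot (grad K (u z)) (v z - u z).
pose S2 z := K (u z) - K (v z) - mxdot (grad K (v z)) (u z - v z).
have S10 z : 0 <= S1 z.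
  have := convex_tangent (u z) (v z) (entropy_convex SA) (C1_entropy SA).
  by rewrite /S1; lra.
have S20 z : 0 <= S2 z.
  have := convex_tangent (v z) (u z) (entropy_convex SA) (C1_entropy SA).
  by rewrite /S2; lra.
have YS : {ae mu, forall z, cyl 0 T z -> r z / 2 * S1 z + r z / 2 * S2 z <= X1 z + X2 z}.
  apply: (ae_imply2 ineq1 ineq2) => z h1 h2 zC.
  have := h1 zC (v z); have := h2 zC (u z).
  rewrite X1E X2E -/(r z) -/(S1 z) -/(S2 z); lra.
have r0 z : 0 <= r z by rewrite /r /entropy_rate oppr_ge0 dchi_le0// ltW.
have Yge0 : {ae mu, forall z, cyl 0 T z -> 0 <= X1 z + X2 z}.
  apply: (ae_imply YS) => z Hz zC; apply: le_trans (Hz zC).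
  by rewrite addr_ge0// mulr_ge0// divr_ge0.
have YE0 := Rintegral_le0_ae mC IY Yge0 Y0.
apply: (ae_imply2 YS YE0) => z h1 h2 zC'.
have zC : cyl 0 T z by apply: cylinder_subset zC' => //; exact: ltW.
have zT' : z.1 < T' by case: zC' => /= + _; rewrite in_itv/= => /andP[].
have rz : 0 < r z / 2 by rewrite divr_gt0// /r entropy_rate_gt0.
have H : r z / 2 * S1 z <= 0.
  have := h1 zC; rewrite h2//; have : 0 <= r z / 2 * S2 z by rewrite mulr_ge0// ltW.
  lra.
rewrite pmulr_rle0// in H; apply/esym.
apply: (strictly_convex_tangent (entropy_strictly_convex SA) (entropy_convex SA)
  (C1_entropy SA)).
by move: H; rewrite /S1; lra.
Qed.

End strong_uniqueness.

(** * Continuous representatives *)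

Section representatives.
Context {R : realType} {d n N : nat}.
Variables (F : 'rV[R]_n -> 'M[R]_N) (L : @diff_operator R d n N).
Hypothesis SA : standing_assumptions F L.
Local Notation leb := (@lebesgue_measure R).
Local Notation mu := (@spacetime_measure R d).
Local Notation cyl := (@cylinder R d).
Local Notation K := (entropy F).
Local Notation Ks := (entropy_dual F).

(** Pick l < eps admissible in the Luxemburg norm and integrate the entry bound for f / l: the dual
    term contributes at most 1 and the basis vector a constant, the torus having mass 1. *)
Lemma Luxemburg_L1 (f : 'rV[R]_d -> 'rV[R]_n) (eps : R) i :
  measurable_fun setT f -> (Luxemburg (torus d) Ks f < eps%:E)%E ->
  (\int[torus d]_x `|f x 0 i|%:E <= (eps * (1 + K (basis_vec i)))%:E)%E.
Proof.
move=> mf /ereal_inf_lt[_ [l [l0 Il] <-]]; rewrite lte_fin => leps.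
have NK := N_entropy SA; have K0 := entropy_ge0 SA.
have mfi : measurable_fun setT (fun x => f x 0 i).
  by have /(measurable_mxP _ measurableT) := mf; exact.
have mKs : measurable_fun setT (fun x => Ks (l^-1 *: f x)).
  apply: (@measurableT_comp _ _ _ _ _ _ Ks).
    exact: measurable_Legendre.
  apply/measurable_mxP => // j k.
  have -> : (fun x => (l^-1 *: f x) j k) = (fun x => l^-1 * f x j k).
    by apply/funext => x; rewrite mxE.
  apply: measurable_funM; first exact: measurable_cst.
  by have /(measurable_mxP _ measurableT) := mf; exact.
have li0 : 0 < l^-1 by rewrite invr_gt0.
have step : (\int[torus d]_x (l^-1 * `|f x 0 i|)%:E <= (1 + K (basis_vec i))%:E)%E.
  apply: (@le_trans _ _ (\int[torus d]_x (Ks (l^-1 *: f x) + K (basis_vec i))%:E)%E).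
    apply: ge0_le_integral => //.
    - by move=> x _; rewrite lee_fin mulr_ge0// ltW.
    - apply/measurable_EFinP; apply: measurable_funM; first exact: measurable_cst.
      exact: measurableT_comp.
    - by apply/measurable_EFinP; apply: measurable_funD => //; exact: measurable_cst.
    - move=> x _; rewrite lee_fin.
      have := entry_le_Legendre NK (l^-1 *: f x) i.
      by rewrite mxE normrM (gtr0_norm li0).
  under eq_integral do rewrite EFinD.
  rewrite ge0_integralD//; last 3 first.
  - by move=> x _; rewrite lee_fin (Legendre_ge0 NK).
  - exact/measurable_EFinP.
  - by move=> x _; rewrite lee_fin.
  rewrite EFinD leeD// integral_cst// [X in (_ * X)%E]probability_setT mule1.
  by [].
have E : (\int[torus d]_x (l^-1 * `|f x 0 i|)%:E =
    l^-1%:E * \int[torus d]_x `|f x 0 i|%:E)%E.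
  under eq_integral do rewrite EFinM.
  rewrite ge0_integralZl//; last by rewrite lee_fin ltW.
  by apply/measurable_EFinP; exact: measurableT_comp.
move: step; rewrite E -(@lee_pmul2l _ l%:E)// ?lte_fin// muleA -EFinM divff ?gt_eqF//.
rewrite mul1e -EFinM => /le_trans; apply.
by rewrite lee_fin ler_wpM2r ?addr_ge0// ltW.
Qed.

(** Two functions that are approximated to any accuracy by almost everywhere equal ones have equal
    entries, by the triangle inequality in L^1. *)
Lemma ae_eq_L1_limit (f g : 'rV[R]_d -> 'rV[R]_n) :
  measurable_fun setT f -> measurable_fun setT g ->
  (forall eps : R, 0 < eps -> exists f' g' : 'rV[R]_d -> 'rV[R]_n,
    [/\ measurable_fun setT f' /\ measurable_fun setT g',
        {ae torus d, forall x, f' x = g' x},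
        (Luxemburg (torus d) Ks (f' \- f)%R < eps%:E)%E &
        (Luxemburg (torus d) Ks (g' \- g)%R < eps%:E)%E]) ->
  {ae torus d, forall x, f x = g x}.
Proof.
move=> mf mg H; have K0 := entropy_ge0 SA.
have mB (p q : 'rV[R]_d -> 'rV[R]_n) : measurable_fun setT p ->
    measurable_fun setT q -> measurable_fun setT (p \- q)%R.
  move=> mp mq; apply/measurable_mxP => // j k.
  have -> : (fun x => (p \- q)%R x j k) = (fun x => p x j k - q x j k).
    by apply/funext => x; rewrite !mxE.
  move/(measurable_mxP _ measurableT) : mp => /(_ j k) mp.
  move/(measurable_mxP _ measurableT) : mq => /(_ j k) mq.
  exact: measurable_funB.
have mBi (p q : 'rV[R]_d -> 'rV[R]_n) i : measurable_fun setT p -> measurable_fun setT q ->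
    measurable_fun setT (fun x => `|(p \- q)%R x 0 i|%:E).
  move=> mp mq; apply/measurable_EFinP; apply: measurableT_comp => //.
  by have /(measurable_mxP _ measurableT) := mB p q mp mq; exact.
have small i : (\int[torus d]_x `|(f \- g)%R x 0 i|%:E <= 0)%E.
  apply/lee_addgt0Pr => e e0; rewrite add0e.
  pose k := 1 + K (basis_vec i); have k0 : 0 < k by rewrite ltr_pwDl.
  have e1 : 0 < e / 2 / k by rewrite !divr_gt0.
  have [f' [g' [[mf' mg'] fg' h1 h2]]] := H _ e1.
  have b1 := Luxemburg_L1 i (mB _ _ mf' mf) h1.
  have b2 := Luxemburg_L1 i (mB _ _ mg' mg) h2.
  rewrite -/k divfK ?gt_eqF// in b1 b2.
  apply: (@le_trans _ _ (\int[torus d]_x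
      (`|(f' \- f)%R x 0 i|%:E + `|(g' \- g)%R x 0 i|%:E))%E).
    apply: ae_ge0_le_integral => //.
    - exact: mBi.
    - by move=> x _; rewrite adde_ge0// lee_fin.
    - by apply: emeasurable_funD; exact: mBi.
    - apply: (ae_imply fg') => x E _; rewrite -EFinD lee_fin /= !mxE E.
      have -> : f x 0 i - g x 0 i = (g' x 0 i - g x 0 i) - (g' x 0 i - f x 0 i).
        by ring.
      by rewrite [leRHS]addrC; exact: ler_normB.
  rewrite ge0_integralD//; [|exact: mBi|exact: mBi].
  by rewrite (splitr e) EFinD leeD.
have ae0 i : {ae torus d, forall x, (f \- g)%R x 0 i = 0}.
  have : ae_eq (torus d) setT (fun x => `|(f \- g)%R x 0 i|%:E) (cst 0%E).
    apply/ae_eq_integral_abs => //; first exact: mBi.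
    apply/eqP; rewrite eq_le integral_ge0// andbT.
    by apply: le_trans (small i); under eq_integral do rewrite /= normr_id.
  by apply: filterS => x /(_ I) [] /eqP; rewrite normr_eq0 => /eqP.
apply: (ae_imply (ae_forall ae0)) => x Hx; apply/eqP.
rewrite -subr_eq0; apply/eqP/rowP => i; rewrite [RHS]mxE; exact: Hx.
Qed.

End representatives.

Lemma ae_exists_between {R : realType} (P : R -> Prop) (a b : R) : a < b ->
  {ae (@lebesgue_measure R), forall s, P s} -> exists2 s, a < s < b & P s.
Proof.
move=> ab [A [mA A0 PA]]; apply: contrapT => H.
have : (@lebesgue_measure R `]a, b[%classic <= @lebesgue_measure R A)%E.
  apply: le_measure; rewrite ?inE//.
  move=> s; rewrite /= in_itv/= => sab; apply: PA => Ps; apply: H; exists s => //.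
rewrite A0 lebesgue_measure_itv/= lte_fin ab -EFinB lee_fin subr_le0.
by rewrite leNgt ab.
Qed.

Lemma cvg0_lt {R : realType} (X : topologicalType) (G : set_system X)
    {FG : Filter G} (f : X -> \bar R) (eps : R) : 0 < eps ->
  f x @[x --> G] --> 0%E -> \forall x \near G, (f x < eps%:E)%E.
Proof.
move=> e0 f0; apply: (f0 [set y | (y < eps%:E)%E]).
by apply: open_nbhs_nbhs; split; [exact: open_ereal_lt_ereal|rewrite /= lte_fin].
Qed.

Theorem theorem6p1 (R : realType) (d n N : nat)
    (F : 'rV[R]_n -> 'M[R]_N) (L : @diff_operator R d n N)
    (T : R) (h : R -> R) (v0 : 'rV[R]_d -> 'rV[R]_n)
    (u v : R * 'rV[R]_d -> 'rV[R]_n) :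
  standing_assumptions F L ->
  0 < T -> weight T h ->
  in_Orlicz (torus d) setT (entropy F) v0 ->
  strong_solution F L T h v0 u ->
  strong_solution F L T h v0 v ->
  forall U V : R -> 'rV[R]_d -> 'rV[R]_n,
    continuous_representative F T (sharp F u) U ->
    continuous_representative F T (sharp F v) V ->
    forall t, 0 <= t < T ->
      {ae torus d, forall x,
        grad (entropy_dual F) (U t x) = grad (entropy_dual F) (V t x)}.
Proof.
move=> SA T0 wh v0K su sv U V [UK Uc Uu] [VK Vc Vv] t t0T.
have /andP[t0 tT] := t0T.
(* Strictly beyond t, so that times slightly larger than t remain before T', and strictly before T,
   where G is bounded. *)
pose T' := (t + T) / 2.
have tT' : t < T' by rewrite /T'; lra.
have T'T : T' < T by rewrite /T'; lra.
have uv := strong_solutions_ae_eq SA T0 wh v0K su sv T'T.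
have UV : {ae (@lebesgue_measure R), forall s, 0 < s < T' ->
    {ae torus d, forall x, U s x = V s x}}.
  apply: (ae_imply2 (ae_slices uv) (ae_imply2 Uu Vv (fun s p q => conj p q))).
  move=> s uvs [Us Vs] /andP[s0 sT'].
  have s0T : 0 < s < T by rewrite s0 (lt_trans sT').
  apply: (ae_imply2 uvs (ae_imply2 (Us s0T) (Vs s0T) (fun x p q => conj p q))).
  move=> x uvx [-> ->]; rewrite /sharp uvx//.
  by split => //=; rewrite in_itv/= s0.
suff : {ae torus d, forall x, U t x = V t x} by move=> H; apply: (ae_imply H) => x ->.
apply: (ae_eq_L1_limit SA); [by case: (UK t t0T)|by case: (VK t t0T)|].
move=> eps eps0.
have near_t := filterI (cvg0_lt eps0 (Uc t t0T)) (cvg0_lt eps0 (Vc t t0T)).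
have /nbhs_ballP[r /= r0 Hr] : nbhs t [set s | `[0, T[%classic s ->
    (Luxemburg (torus d) (entropy_dual F) (U s \- U t)%R < eps%:E)%E /\
    (Luxemburg (torus d) (entropy_dual F) (V s \- V t)%R < eps%:E)%E].
  exact: near_t.
(* The comparison time s is taken to the right of t, which also covers t = 0; a null set of times
   cannot contain the whole interval. *)
have tr : t < Num.min (t + r) T' by rewrite lt_min tT' andbT ltrDl.
have [s] := ae_exists_between tr UV.
rewrite lt_min => /andP[ts /andP[sr sT']] UVs.
have s0 : 0 < s by rewrite (le_lt_trans t0).
have sT : s < T by rewrite (lt_trans sT').
have s0T : 0 <= s < T by rewrite (ltW s0) sT.
exists (U s), (V s).
have [h1 h2] : (Luxemburg (torus d) (entropy_dual F) (U s \- U t)%R < eps%:E)%E /\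
    (Luxemburg (torus d) (entropy_dual F) (V s \- V t)%R < eps%:E)%E.
  apply: Hr; last by rewrite /= in_itv/=.
  by rewrite -ball_normE/= distrC gtr0_norm ?subr_gt0// ltrBlDl.
split => //; last by apply: UVs; rewrite s0.
by split; [case: (UK s s0T)|case: (VK s s0T)].
Qed.
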